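(* Let $\gamma$ be a smooth geodesically convex simple closed curve on the unit sphere $S^2\subset\mathbb{R}^3$, of length $L$, parameterized by arc length $s$, bounding a convex domain of area $A$, and let $k(s)$ be its geodesic curvature. Then there are at least four distinct points of $\gamma$ at which the geodesic curvature equals the average curvature of $\gamma$, that is, at which $$k(s)=\bar k,\qquad \bar k=\frac{1}{L}\int_0^L k(s)\,ds=\frac{2\pi-A}{L}.$$
   Context: The unit sphere carries its standard round metric of constant curvature $1$. A smooth simple closed curve on the sphere is geodesically convex if it lies in an open hemisphere and bounds, within that hemisphere, a geodesically convex domain $D$ (the shortest geodesic segment between any two points of $D$ lies in $D$). The area $A$ is the area of this domain. The geodesic curvature $k$ is taken with the sign that makes it non-negative for such a curve (that is, with respect to the normal pointing into $D$). The equality $\int_0^L k\,ds=2\pi-A$ is the Gauss-Bonnet formula. *)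

(* Defs.v *)
From HB Require Import structures.
From mathcomp Require Import all_boot all_order all_algebra.
From mathcomp Require Import all_classical all_reals all_analysis.

Set Implicit Arguments.
Unset Strict Implicit.
Unset Printing Implicit Defensive.

Import Order.TTheory GRing.Theory Num.Theory.
Import numFieldNormedType.Exports.

Local Open Scope classical_set_scope.
Local Open Scope ring_scope.

(* The norm `|x| of the library on 'rV[R]_3 is the sup norm, so the Euclidean
   structure is expressed through [dot]. *)
Definition dot (R : realType) (u v : 'rV[R]_3) : R :=
  \sum_(i < 3) u ord0 i * v ord0 i.

Definition sphere (R : realType) : set 'rV[R]_3 := [set x | dot x x = 1].

Definition open_hemisphere (R : realType) (p : 'rV[R]_3) : set 'rV[R]_3 :=
  [set x | sphere x /\ 0 < dot p x].

(* For x on the sphere and v a unit vector orthogonal to x, this is the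
   unit-speed geodesic (great circle) from x with initial velocity v; it is
   minimizing on [0, l] exactly when l <= pi. *)
Definition geodesic (R : realType) (x v : 'rV[R]_3) (t : R) : 'rV[R]_3 :=
  cos t *: x + sin t *: v.

Definition geodesically_convex (R : realType) (D : set 'rV[R]_3) : Prop :=
  forall (x v : 'rV[R]_3) (l : R),
    D x -> dot v v = 1 -> dot x v = 0 -> 0 <= l <= pi ->
    D (geodesic x v l) ->
    forall t : R, 0 <= t <= l -> D (geodesic x v t).

(* Nonempty, connected, and open in the relative topology of the sphere. *)
Definition spherical_domain (R : realType) (D : set 'rV[R]_3) : Prop :=
  [/\ D !=set0, connected D &
      exists2 U : set 'rV[R]_3, open U & D = U `&` @sphere R].

Definition smooth (R : realType) (f : R -> 'rV[R]_3) : Prop :=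
  forall (n : nat) (s : R), derivable (derive1n n f) s 1.

(* A closed curve of length L is an L-periodic map on the whole line. *)
Definition smooth_simple_closed_curve (R : realType)
    (gamma : R -> 'rV[R]_3) (L : R) : Prop :=
  [/\ 0 < L,
      smooth gamma,
      forall s, sphere (gamma s),
      forall s, dot (derive1 gamma s) (derive1 gamma s) = 1 &
      (forall s, gamma (s + L) = gamma s) /\
      {in `[0, L[ &, injective gamma}].

(* As D is relatively open in the closed set [sphere], [closure D `\` D] is the
   boundary of D in the sphere. *)
Definition bounds_convex_domain (R : realType)
    (gamma : R -> 'rV[R]_3) (D : set 'rV[R]_3) : Prop :=
  exists p : 'rV[R]_3,
    [/\ sphere p,
        range gamma `<=` open_hemisphere p,
        D `<=` open_hemisphere p,
        spherical_domain D /\ geodesically_convex D &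
        closure D `\` D = range gamma].

(* nu is the unit normal of gamma in the sphere pointing into D: the geodesic
   leaving gamma s in the direction nu s immediately enters D. *)
Definition inward_normal (R : realType) (gamma : R -> 'rV[R]_3)
    (D : set 'rV[R]_3) (nu : R -> 'rV[R]_3) : Prop :=
  forall s : R,
    [/\ dot (nu s) (nu s) = 1,
        dot (nu s) (gamma s) = 0,
        dot (nu s) (derive1 gamma s) = 0 &
        \forall t \near 0^'+, D (geodesic (gamma s) (nu s) t)].

(* For a unit-speed curve the covariant acceleration is the tangential part of
   gamma'', whose component along the tangent vector nu is dot gamma'' nu. *)
Definition geodesic_curvature (R : realType)
    (gamma nu : R -> 'rV[R]_3) (s : R) : R :=
  dot (derive1n 2 gamma s) (nu s).

Definition average_curvature (R : realType)
    (gamma nu : R -> 'rV[R]_3) (L : R) : R :=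
  L^-1 * \int[lebesgue_measure]_(s in `[0, L]) geodesic_curvature gamma nu s.

Definition spherical_coordinates (R : realType) (phi theta : R) : 'rV[R]_3 :=
  \row_(i < 3) [:: sin phi * cos theta; sin phi * sin theta; cos phi]`_i.

(* The Riemannian area: the round metric is
   dphi^2 + (sin phi)^2 dtheta^2, with area element sin phi dphi dtheta. *)
Definition sphere_area (R : realType) (E : set 'rV[R]_3) : \bar R :=
  (\int[lebesgue_measure]_(theta in `[0%R, (2 * pi)%R])
    \int[lebesgue_measure]_(phi in `[0%R, pi])
      (sin phi * \1_E (spherical_coordinates phi theta))%:E)%E.

(* Main.v *)
Require Import Defs.
From HB Require Import structures.
From mathcomp Require Import all_boot all_order all_algebra.
From mathcomp Require Import all_classical all_reals all_analysis.
From mathcomp Require Import measurable_realfun.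
From mathcomp Require Import ring lra.

Set Implicit Arguments.
Unset Strict Implicit.
Unset Printing Implicit Defensive.

Import Order.TTheory GRing.Theory Num.Theory.
Import numFieldNormedType.Exports.

Local Open Scope classical_set_scope.
Local Open Scope ring_scope.

(** Let [x] be the curve, [t] its velocity and [n] its inward normal, so that
    [t' = - x + k n], and let [b] be the mean of [k]. Up to the constant factor
    [sqrt (1 + b ^ 2)], the curve [d = x - b n] is the equidistant curve of [x]
    at distance [arctan b] outside the domain. Its velocity is [(1 + b k) t] and
    its conormal is proportional to [n + b x], whose derivative is
    [- (k - b) t]. As [k] is non-negative ([curvature_ge0]), so is [b], hence [d]
    is regular; it has its inflections where [k = b], and its total geodesic
    curvature, the integral of [(k - b) / sqrt (1 + b ^ 2)], is 0. By
    Gauss-Bonnet [d] therefore bisects the area of the sphere. That a curve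
    which bisects the sphere has four inflections is the tennis ball theorem; it
    is needed here only for a curve that is a graph over the equator of some
    axis, where it has a short proof of the kind used for Sturm's theorem.

    The axis [p] is a point of the domain with [p . x > 0] along the curve
    ([exists_center]); convexity gives [p . n > 0] as well ([normal_pos]). Then
    [p . (n + b x) > 0], so that [d] turns around [p] with positive angular
    speed, and the great circle tangent to [d] at time [s] is a graph over the
    longitudes, with heights [A s cos phi + B s sin phi]. Here
    [A' = - g sin theta] and [B' = g cos theta], where [theta] is the longitude
    of [d] and [g] has the sign of [k - b] ([dv_tangent1], [dv_tangent2]). If
    [k - b] changes sign at most twice in a period ([sign_changes]) and one of
    the two arcs spans more than half a turn, then the great circle tangent to
    [d] at the middle of that arc lies on one side of [d] ([sturm_short]). Both
    bisect the sphere, so they coincide and [k = b] on an arc. The case of two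
    half turns is settled directly in [sturm_two_arcs], and
    [four_average_points] puts these facts together.

    The value of the mean is the Gauss-Bonnet formula, obtained from the same
    computation with [b = 0]: the angle between the curve and the parallels of
    the axis has derivative [k - x3 theta'] ([dv_course]), where [x3 = p . x]
    and [theta] is the longitude of [x], so the integrals of [k] and of
    [x3 theta'] over a period agree. The longitude makes exactly one turn as the
    curve is simple ([boundary_winding]), and every meridian meets the domain in
    an arc that ends on the curve ([radial_slice]); in polar coordinates around
    [p] the area is thus the integral of [1 - x3] over one turn of longitudes
    ([axis_area]). The area is defined in coordinates around a fixed axis.
    Rotations around that axis preserve it by periodicity, and those around the
    first coordinate axis because, under central projection to the planes that
    touch the sphere at the ends of this axis, they become plane isometries that
    preserve the density of the area ([ray_area_rotation_x]). *)

(** * Differential calculus on the line *)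

Section Calculus.
Variable R : realType.
Implicit Types (f g : R -> R) (x y a b d : R).

Definition has_deriv f x d : Prop := is_derive x (1 : R) f d.

Lemma dv_eq f x d d' : has_deriv f x d -> d = d' -> has_deriv f x d'.
Proof. by move=> h <-. Qed.

Lemma dv_fun f g x d : f =1 g -> has_deriv f x d -> has_deriv g x d.
Proof. by move=> /funext ->. Qed.

Lemma dv_near f g x d : (\forall y \near x, f y = g y) ->
  has_deriv f x d -> has_deriv g x d.
Proof. by move=> fg hf; apply: near_eq_is_derive fg hf. Qed.

Lemma dvD f g x a b : has_deriv f x a -> has_deriv g x b ->
  has_deriv (fun y => f y + g y) x (a + b).
Proof. by move=> hf hg; exact: is_deriveD. Qed.

Lemma dvN f x a : has_deriv f x a -> has_deriv (fun y => - f y) x (- a).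
Proof. by move=> hf; exact: is_deriveN. Qed.

Lemma dvM f g x a b : has_deriv f x a -> has_deriv g x b ->
  has_deriv (fun y => f y * g y) x (f x * b + g x * a).
Proof. by move=> hf hg; exact: is_deriveM. Qed.

Lemma dvV f x a : f x != 0 -> has_deriv f x a ->
  has_deriv (fun y => (f y)^-1) x (- a / (f x ^+ 2)).
Proof.
move=> f0 hf; apply: (dv_eq (is_deriveV f0 hf)).
by rewrite /GRing.scale/= mulNr mulrC mulNr.
Qed.

Lemma dv_comp f g x a b : has_deriv f (g x) a -> has_deriv g x b ->
  has_deriv (fun y => f (g y)) x (a * b).
Proof. by move=> hf hg; exact: (is_derive1_comp hf hg). Qed.

Lemma dv_cst (c x : R) : has_deriv (fun _ : R => c) x 0.
Proof. exact: is_derive_cst. Qed.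

Lemma dv_id x : has_deriv (fun y => y) x 1.
Proof. exact: is_derive_id. Qed.

Lemma dv_cont f x d : has_deriv f x d -> {for x, continuous f}.
Proof. by move=> [h _]; apply/differentiable_continuous/derivable1_diffP. Qed.

Lemma dv_val f x d : has_deriv f x d -> derive1 f x = d.
Proof. by move=> [_ h]; rewrite derive1E. Qed.

Lemma dv_within f f' (A : set R) : (forall x, has_deriv f x (f' x)) -> {within A, continuous f}.
Proof. by move=> h; apply: continuous_subspaceT => x; exact: dv_cont. Qed.

Lemma dv_incr f f' a b : (forall x, has_deriv f x (f' x)) ->
  (forall x, a < x < b -> 0 <= f' x) -> a <= b -> f a <= f b.
Proof.
move=> df f0 ab.
have df1 x : x \in `]a, b[ -> derivable f x 1 by case: (df x).
have df2 x : x \in `]a, b[ -> 0 <= derive1 f x.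
  by rewrite (dv_val (df x)) in_itv/=; exact: f0.
exact: (ger0_derive1_ndecr df1 df2 (dv_within (A := `[a, b]) df)).
Qed.

Lemma dv_decr f f' a b : (forall x, has_deriv f x (f' x)) ->
  (forall x, a < x < b -> f' x <= 0) -> a <= b -> f b <= f a.
Proof.
move=> df f0 ab; rewrite -lerN2.
apply: (dv_incr (fun x => dvN (df x))) => // x xab.
by rewrite oppr_ge0 f0.
Qed.

Lemma dv_sincr f f' a b : (forall x, has_deriv f x (f' x)) ->
  (forall x, a < x < b -> 0 < f' x) -> a < b -> f a < f b.
Proof.
move=> df f0 ab.
have df1 x : x \in `]a, b[ -> derivable f x 1 by case: (df x).
have df2 x : x \in `]a, b[ -> 0 < derive1 f x.
  by rewrite (dv_val (df x)) in_itv/=; exact: f0.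
exact: (gtr0_derive1_incr df1 df2 (dv_within (A := `[a, b]) df)).
Qed.

Lemma dv_flat f f' x (e : R) : (forall x, has_deriv f x (f' x)) -> 0 < e ->
  (forall y, x - e < y < x + e -> f y = f x) -> f' x = 0.
Proof.
move=> df e0 h.
have h1 : has_deriv f x 0.
  apply: (@dv_near (fun=> f x)); last exact: dv_cst.
  near=> y; apply/esym/h; near: y.
  have /= := @nbhsx_ballx _ R x e e0; apply: filterS => y.
  by rewrite /ball/= ltr_distlC.
by rewrite -(dv_val (df x)) (dv_val h1).
Unshelve. all: by end_near. Qed.

(** A non-decreasing function with equal end values is constant, hence has a
    vanishing derivative inside. *)
Lemma dv_eq_ends f f' a b : (forall x, has_deriv f x (f' x)) ->
  (forall x, a < x < b -> 0 <= f' x) -> f a = f b ->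
  forall x, a < x < b -> f' x = 0.
Proof.
move=> df f0 fab x /andP[ax xb].
have cst y : a <= y <= b -> f y = f a.
  move=> /andP[ay yb]; apply/eqP; rewrite eq_le {1}fab; apply/andP; split.
    by apply: dv_incr df _ yb => z /andP[yz zb]; rewrite f0// zb (le_lt_trans ay).
  by apply: dv_incr df _ ay => z /andP[yz zb]; rewrite f0// yz (lt_le_trans zb).
pose e := Num.min (x - a) (b - x).
have e0 : 0 < e by rewrite lt_min !subr_gt0 ax.
have ea : a <= x - e by rewrite lerBrDl -lerBrDr /e ge_min lexx.
have eb : x + e <= b by rewrite -lerBrDl /e ge_min lexx orbT.
apply: (dv_flat df e0) => y /andP[y1 y2].
by rewrite !cst// ?(ltW ax) ?(ltW xb)// (le_trans ea (ltW y1)) (le_trans (ltW y2)).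
Qed.

Lemma dv_cstT f x y : (forall x, has_deriv f x 0) -> f x = f y.
Proof. exact: is_derive_0_is_cst. Qed.

Lemma primitive_from f (a : R) : continuous f ->
  exists F : R -> R, forall x, a < x -> has_deriv F x (f x).
Proof.
move=> cf; exists (fun x => \int[lebesgue_measure]_(t in [set` `[a, x]]) f t)%R => x ax.
have [] := @continuous_FTC1_closed R f a x (x + 1) _ _ ax (cf x).
- by rewrite ltrDl.
- apply: continuous_compact_integrable; first exact: segment_compact.
  exact: continuous_subspaceT.
by move=> d1 d2; apply: DeriveDef; [exact: d1|rewrite -derive1E; exact: d2].
Qed.

Lemma continuous_primitive f : continuous f ->
  exists F : R -> R, forall x, has_deriv F x (f x).
Proof.
move=> cf.
have [F hF] := @primitive_from f (-1) cf.
have cfN : continuous (fun x => f (- x)).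
  by move=> x; apply: continuous_comp; [exact: opp_continuous|exact: cf].
have [G hG] := @primitive_from (fun x => f (- x)) (-1) cfN.
have hG' x : x < 1 -> has_deriv (fun y => - G (- y)) x (f x).
  move=> x1; apply: dv_eq.
    apply: dvN; apply: dv_comp; first by apply: hG; rewrite ltrN2.
    by apply: dvN; exact: dv_id.
  by rewrite opprK mulrN1 opprK.
pose c := F 0 + G 0.
(* both candidates differ by a constant on the overlap of their domains *)
have FG x : -1 < x < 1 -> F x = c - G (- x).
  move=> x1; pose D y := F y - - G (- y).
  have dD y : -1 < y < 1 -> has_deriv D y 0.
    by move=> /andP[y1 y2]; apply: (dv_eq (dvD (hF y y1) (dvN (hG' y y2)))); rewrite subrr.
  have cD (u v : R) : -1 < u -> v < 1 -> u <= v -> D u = D v.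
    move=> u1 v1 uv; have sub y : y \in `[u, v] -> -1 < y < 1.
      by rewrite in_itv/= => /andP[? ?]; rewrite (lt_le_trans u1)//= (le_lt_trans _ v1).
    have cw : {within `[u, v], continuous D}.
      apply: continuous_in_subspaceT => y; rewrite inE/= => /sub yy.
      exact: dv_cont (dD _ yy).
    have [w _ ] := @MVT_segment _ D (fun=> 0) _ _ uv
      (fun y yv => dD y (sub y (subset_itv_oo_cc yv))) cw.
    by rewrite mul0r => /eqP; rewrite subr_eq0 => /eqP.
  have : D x = D 0.
    case/andP: x1 => x1 x2; have [x0|/ltW x0] := leP x 0; first exact: cD.
    by apply/esym; exact: cD.
  by rewrite /D oppr0 !opprK -/c => <-; rewrite addrK.
exists (fun x => if 0 <= x then F x else c - G (- x)) => x.
have [x0|x0] := leP (2^-1) x.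
  apply: (@dv_near F); last by apply: hF; lra.
  near=> y; have : 0 <= y by near: y; apply: lt_le_nbhsr; lra.
  by move=> ->.
apply: (@dv_near (fun y => c - G (- y))); last first.
  apply: dv_eq; first by apply: dvD; [exact: dv_cst|apply: hG'; lra].
  by rewrite add0r.
near=> y; case: ifPn => // y0; apply/esym/FG.
have : y < 1 by near: y; apply: lt_nbhsl; lra.
by move=> ->; rewrite andbT (lt_le_trans _ y0).
Unshelve. all: by end_near. Qed.
End Calculus.

(** * Continuous determination of an angle *)

Section Angles.
Variable R : realType.
Implicit Types (x y : R).

Lemma exists_angle (u v : R) : u ^+ 2 + v ^+ 2 = 1 ->
  exists a, [/\ cos a = u, sin a = v & `|a| <= pi].
Proof.
move=> uv; have u1 : -1 <= u <= 1.
  by rewrite -ler_norml -(@expr_le1 _ 2)// real_normK ?num_real//; nra.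
have sE : sin (acos u) = `|v|.
  by rewrite sin_acos// -sqrtr_sqr; congr Num.sqrt; rewrite -uv; ring.
have al : `|acos u| <= pi by rewrite ger0_norm ?acos_ge0// acos_lepi.
have [v0|v0] := leP 0 v.
  by exists (acos u); rewrite acosK// sE ger0_norm.
by exists (- acos u); rewrite cosN sinN normrN acosK// sE ltr0_norm// opprK.
Qed.

(** A closed form is exact on the line: integrating the angular speed of a plane
    curve that avoids the origin gives a continuous determination of its
    argument. *)
Lemma angle_lift (X Y X' Y' : R -> R) :
  (forall x, has_deriv X x (X' x)) -> (forall x, has_deriv Y x (Y' x)) ->
  continuous X' -> continuous Y' -> (forall x, 0 < X x ^+ 2 + Y x ^+ 2) ->
  exists th : R -> R, forall x,
    [/\ has_deriv th x ((X x * Y' x - Y x * X' x) / (X x ^+ 2 + Y x ^+ 2)),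
        X x = Num.sqrt (X x ^+ 2 + Y x ^+ 2) * cos (th x) &
        Y x = Num.sqrt (X x ^+ 2 + Y x ^+ 2) * sin (th x)].
Proof.
move=> dX dY cX' cY' N0.
pose N x := X x ^+ 2 + Y x ^+ 2; pose rho x := Num.sqrt (N x).
have rho0 x : 0 < rho x by rewrite sqrtr_gt0; exact: N0.
have rhoE x : rho x ^+ 2 = N x by rewrite sqr_sqrtr//; exact/ltW/N0.
have cX x : {for x, continuous X} by exact: dv_cont (dX x).
have cY x : {for x, continuous Y} by exact: dv_cont (dY x).
have cw : continuous (fun x => (X x * Y' x - Y x * X' x) / N x).
  move=> x; apply: cvgM.
    by apply: cvgB; apply: cvgM; [exact: cX|exact: cY'|exact: cY|exact: cX'].
  apply: cvgV; first by rewrite gt_eqF// N0.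
  by apply: cvgD; apply: cvgM; [exact: cX|exact: cX|exact: cY|exact: cY].
have [F dF] := continuous_primitive cw.
have [a [ca sa _]] : exists a, [/\ cos a = X 0 / rho 0, sin a = Y 0 / rho 0 & `|a| <= pi].
  apply: exists_angle; rewrite !expr_div_n -mulrDl rhoE divff//.
  by rewrite gt_eqF// N0.
pose th x := F x + (a - F 0).
have dth x : has_deriv th x ((X x * Y' x - Y x * X' x) / N x).
  by apply: dv_eq; [apply: dvD; [exact: dF|exact: dv_cst]|rewrite addr0].
have th0 : th 0 = a by rewrite /th addrC subrK.
have drho x : has_deriv rho x ((X x * X' x + Y x * Y' x) / rho x).
  apply: dv_eq.
    apply: (@dv_comp _ Num.sqrt N); first exact: (is_derive1_sqrt (N0 x)).
    by apply: dvD; apply: dvM; [exact: dX|exact: dX|exact: dY|exact: dY].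
  by rewrite -/(rho x); field; rewrite gt_eqF.
have dc x : has_deriv (fun y => cos (th y)) x (- sin (th x) * ((X x * Y' x - Y x * X' x) / N x)).
  by apply: dv_comp (dth x); exact: is_derive_cos.
have ds x : has_deriv (fun y => sin (th y)) x (cos (th x) * ((X x * Y' x - Y x * X' x) / N x)).
  by apply: dv_comp (dth x); exact: is_derive_sin.
pose P x := (X x * cos (th x) + Y x * sin (th x)) / rho x.
pose Q x := (Y x * cos (th x) - X x * sin (th x)) / rho x.
have rn x : rho x != 0 by rewrite gt_eqF.
have P1 x : P x = 1.
  have -> : 1 = P 0.
    have -> : P 0 = (X 0 ^+ 2 + Y 0 ^+ 2) / rho 0 ^+ 2.
      by rewrite /P th0 ca sa; field.
    by rewrite rhoE divff// gt_eqF// N0.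
  apply: dv_cstT => z; apply: dv_eq.
    apply: dvM; last by apply: dvV (drho z).
    by apply: dvD; apply: dvM; [exact: dX|exact: dc|exact: dY|exact: ds].
  have hr := rhoE z; rewrite -hr; set c := cos _; set s := sin _.
  transitivity ((rho z ^+ 2 * (c * X' z + s * Y' z) +
    (X z * Y' z - Y z * X' z) * (Y z * c - X z * s) -
    (X z * c + Y z * s) * (X z * X' z + Y z * Y' z)) / rho z ^+ 3); first by field.
  by rewrite hr /N; set num := (X in X / _); have -> : num = 0; [rewrite /num; ring|rewrite mul0r].
have Q0 x : Q x = 0.
  have -> : 0 = Q 0 by rewrite /Q th0 ca sa; field.
  apply: dv_cstT => z; apply: dv_eq.
    apply: dvM; last by apply: dvV (drho z).
    by apply: dvD; [apply: dvM|apply/dvN/dvM]; [exact: dY|exact: dc|exact: dX|exact: ds].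
  have hr := rhoE z; rewrite -hr; set c := cos _; set s := sin _.
  transitivity ((rho z ^+ 2 * (c * Y' z - s * X' z) -
    (X z * Y' z - Y z * X' z) * (X z * c + Y z * s) -
    (Y z * c - X z * s) * (X z * X' z + Y z * Y' z)) / rho z ^+ 3); first by field.
  by rewrite hr /N; set num := (X in X / _); have -> : num = 0; [rewrite /num; ring|rewrite mul0r].
have PE x : X x * cos (th x) + Y x * sin (th x) = rho x.
  by have := P1 x; rewrite /P => /(congr1 (fun u => u * rho x)); rewrite divfK ?mul1r.
have QE x : Y x * cos (th x) - X x * sin (th x) = 0.
  by have := Q0 x; rewrite /Q => /(congr1 (fun u => u * rho x)); rewrite divfK ?mul0r.
have c2 x := cos2Dsin2 (th x).
exists th => x; rewrite -/(N x) -/(rho x); split; first exact: dth.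
  transitivity (X x * (cos (th x) ^+ 2 + sin (th x) ^+ 2)); first by rewrite c2 mulr1.
  by rewrite -PE -[RHS]subr0 -(mulr0 (sin (th x))) -(QE x); ring.
transitivity (Y x * (cos (th x) ^+ 2 + sin (th x) ^+ 2)); first by rewrite c2 mulr1.
by rewrite -PE -[RHS]addr0 -(mulr0 (cos (th x))) -(QE x); ring.
Qed.

End Angles.

(** * Trigonometric preliminaries *)

Section TrigFacts.
Variable R : realType.
Implicit Types (x y z : R).

Lemma sin_le0 x : - pi <= x <= 0 -> sin x <= 0.
Proof.
by move=> /andP[h1 h2]; rewrite -oppr_ge0 -sinN sin_ge0_pi// oppr_ge0 h2 lerNl.
Qed.

Lemma cosD_turn x : cos (x + 2 * pi) = cos x.
Proof. by rewrite mulr_natl cosD2pi. Qed.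

Lemma sinD_turn x : sin (x + 2 * pi) = sin x.
Proof. by rewrite mulr_natl sinD2pi. Qed.

(** The sine of the latitude whose tangent is [x]. *)
Definition sinlat x := x / Num.sqrt (1 + x ^+ 2).

Lemma sqrt1D2_gt0 x : 0 < Num.sqrt (1 + x ^+ 2).
Proof. by rewrite sqrtr_gt0 ltr_pwDl// sqr_ge0. Qed.

Lemma sqr_sqrt1D2 x : Num.sqrt (1 + x ^+ 2) ^+ 2 = 1 + x ^+ 2.
Proof. by rewrite sqr_sqrtr// addr_ge0// sqr_ge0. Qed.

Lemma dv_sqrt1D2 (f : R -> R) x (d : R) : has_deriv f x d ->
  has_deriv (fun y => Num.sqrt (1 + f y ^+ 2)) x (f x * d / Num.sqrt (1 + f x ^+ 2)).
Proof.
move=> df; apply: dv_eq.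
  apply: (@dv_comp _ Num.sqrt (fun y => 1 + f y ^+ 2)).
    by apply: is_derive1_sqrt; rewrite ltr_pwDl// sqr_ge0.
  by apply: dvD; [exact: dv_cst|exact: (dvM df df)].
by have := sqrt1D2_gt0 (f x) => h; field; rewrite gt_eqF.
Qed.

Lemma sinlat_lt x y : x < y -> sinlat x < sinlat y.
Proof.
have dS z : has_deriv sinlat z (Num.sqrt (1 + z ^+ 2) ^- 3).
  apply: dv_eq.
    apply: dvM; first exact: dv_id.
    apply: dvV; last by apply: (@dv_sqrt1D2 id); exact: dv_id.
    by rewrite gt_eqF// sqrt1D2_gt0.
  have := sqr_sqrt1D2 z; have := sqrt1D2_gt0 z; set r := Num.sqrt _ => r0 hr.
  transitivity ((r ^+ 2 - z ^+ 2) / r ^+ 3); first by field; rewrite gt_eqF.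
  by rewrite hr addrK mul1r.
move=> xy; apply: dv_sincr dS _ xy => z _.
by rewrite invr_gt0 exprn_gt0// sqrt1D2_gt0.
Qed.

Lemma sinlat_le x y : x <= y -> sinlat x <= sinlat y.
Proof. by rewrite le_eqVlt => /predU1P[->//|/sinlat_lt/ltW]. Qed.

Lemma sinlat_inj x y : sinlat x = sinlat y -> x = y.
Proof. by case: (ltgtP x y) => // /sinlat_lt + e; rewrite e ltxx. Qed.

Lemma sinlatN x : sinlat (- x) = - sinlat x.
Proof. by rewrite /sinlat sqrrN mulNr. Qed.

Lemma dv_atan (f : R -> R) x (d : R) : has_deriv f x d ->
  has_deriv (fun y => atan (f y)) x (d / (1 + f x ^+ 2)).
Proof.
move=> df; apply: dv_eq; first by apply: dv_comp df; exact: is_derive1_atan.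
by rewrite mulrC.
Qed.

End TrigFacts.

(** * Supporting great circles of a curve that bisects the sphere *)

Lemma dv_eq_on (R : realType) (f g f' g' : R -> R) (a b : R) :
  (forall x, has_deriv f x (f' x)) -> (forall x, has_deriv g x (g' x)) ->
  (forall x, a < x < b -> f x = g x) -> forall x, a < x < b -> f' x = g' x.
Proof.
move=> df dg fg x /andP[ax xb].
have d0 y : has_deriv (fun z => f z - g z) y (f' y - g' y) := dvD (df y) (dvN (dg y)).
pose e := Num.min (x - a) (b - x).
have e0 : 0 < e by rewrite lt_min !subr_gt0 ax.
have ea : a <= x - e by rewrite lerBrDl -lerBrDr /e ge_min lexx.
have eb : x + e <= b by rewrite -lerBrDl /e ge_min lexx orbT.
apply/eqP; rewrite -subr_eq0; apply/eqP/(dv_flat d0 e0) => y /andP[y1 y2].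
by rewrite !fg ?subrr// ?ax// (le_lt_trans ea y1) (lt_le_trans y2).
Qed.

Lemma dv_incr_le (R : realType) (f : R -> R) (x y : R) :
  (forall x y, x < y -> f x < f y) -> (f x <= f y) = (x <= y).
Proof.
move=> h; case: (ltgtP x y) => [/h/ltW->//|/h|->]; last by rewrite lexx.
by move=> hh; apply/negbTE; rewrite -ltNge.
Qed.

(** A curve is given by its longitude [th], with angular speed [w], and its
    height [h], the tangent of the latitude; [A] and [B] are the coefficients of
    its tangent great circles, which turn at the rate [g]. The periodic [Psi]
    says that the integral of the sine of the latitude over a turn is 0, that
    is, that the curve bisects the area of the sphere. *)
Section Sturm.
Variables (R : realType) (th w A B g Psi : R -> R) (L : R).
Hypothesis dth : forall x, has_deriv th x (w x).
Hypothesis w0 : forall x, 0 < w x.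
Hypothesis thL : forall x, th (x + L) = th x + 2 * pi.
Hypothesis dA : forall x, has_deriv A x (- (g x * sin (th x))).
Hypothesis dB : forall x, has_deriv B x (g x * cos (th x)).
Hypothesis AL : forall x, A (x + L) = A x.
Hypothesis BL : forall x, B (x + L) = B x.
Let h x := A x * cos (th x) + B x * sin (th x).
Hypothesis dPsi : forall x, has_deriv Psi x (sinlat (h x) * w x).
Hypothesis PsiL : forall x, Psi (x + L) = Psi x.

(** The height at longitude [phi] of the great circle tangent at time [x]. *)
Let F phi x := A x * cos phi + B x * sin phi.

Let th_lt x y : x < y -> th x < th y.
Proof. by move=> xy; apply: dv_sincr dth _ xy => z _. Qed.

Let th_le x y : (th x <= th y) = (x <= y).
Proof. exact: dv_incr_le th_lt. Qed.

Let dF phi x : has_deriv (F phi) x (g x * sin (phi - th x)).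
Proof.
apply: dv_eq; first by apply: dvD; (apply: dvM; last exact: dv_cst); [exact: dA|exact: dB].
by rewrite sinB; ring.
Qed.

Let dcos x : has_deriv (fun y => cos (th y)) x (- sin (th x) * w x).
Proof. by apply: dv_comp (dth x); exact: is_derive_cos. Qed.

Let dsin x : has_deriv (fun y => sin (th y)) x (cos (th x) * w x).
Proof. by apply: dv_comp (dth x); exact: is_derive_sin. Qed.

Let hL x : h (x + L) = h x.
Proof. by rewrite /h AL BL thL cosD_turn sinD_turn. Qed.

Let hF x : h x = F (th x) x. Proof. by []. Qed.

Let th_surj a b v : a <= b -> th a <= v <= th b -> exists2 c, a <= c <= b & th c = v.
Proof.
move=> ab vab.
have cth : {within `[a, b], continuous th} := dv_within (A := `[a, b]) dth.
have [|c] := @IVT R th a b v ab cth; last by rewrite in_itv/=; exists c.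
have thab : th a <= th b by rewrite th_le.
by rewrite min_l// max_r.
Qed.

(** The great circle [C] tangent at the middle [s0] of the arc [a, b] lies above
    the curve. On that arc this is because the height at a fixed longitude of
    the tangent circle at time [y] is monotone in [y] before and after the
    time of this longitude. The other arc is shorter than half a turn and is below its end
    tangents, whose comparison with [C] interpolates. As the curve and [C] both
    bisect the sphere, they coincide. *)
Lemma sturm_short a b : a < b < a + L ->
  (forall x, a < x < b -> g x <= 0) -> (forall x, b < x < a + L -> 0 <= g x) ->
  th (a + L) - th b < pi -> forall x, a < x < a + L -> g x = 0.
Proof.
move=> /andP[ab baL] gn gp short.
have p0 : 0 < pi :> R := pi_gt0 R.
have thab := th_lt ab; have thbL := th_lt baL; have thLa := thL a.
have [s0 /andP[as0 s0b] th0] : exists2 s0, a <= s0 <= b & th s0 = (th a + th b) / 2.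
  by apply: th_surj; [exact: ltW|apply/andP; split; lra].
have le1 x : a <= x <= b -> h x <= F (th x) s0.
  move=> /andP[ax xb]; rewrite hF.
  have t1 : th a <= th x by rewrite th_le.
  have t2 : th x <= th b by rewrite th_le.
  have [s0x|/ltW xs0] := leP s0 x.
    apply: (dv_decr (dF (th x))) s0x => y /andP[y1 y2].
    have y3 := th_lt y1; have y4 := th_lt y2.
    apply: mulr_le0_ge0; last by apply: sin_ge0_pi; apply/andP; split; lra.
    by apply: gn; rewrite (le_lt_trans as0 y1) (lt_le_trans y2).
  apply: (dv_incr (dF (th x))) xs0 => y /andP[y1 y2].
  have y3 := th_lt y1; have y4 := th_lt y2.
  apply: mulr_le0; last by apply: sin_le0; apply/andP; split; lra.
  by apply: gn; rewrite (le_lt_trans ax y1) (lt_le_trans y2).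
have hb : h b <= F (th b) s0 by apply: le1; rewrite (ltW ab) lexx.
have ha : h a <= F (th a) s0 by apply: le1; rewrite lexx (ltW ab).
have le2 x : b <= x <= a + L -> h x <= F (th x) s0.
  move=> /andP[bx xaL].
  have t1 : th b <= th x by rewrite th_le.
  have t2 : th x <= th (a + L) by rewrite th_le.
  have e1 : F (th b) x <= F (th b) b.
    apply: (dv_decr (dF (th b))) bx => y /andP[y1 y2].
    have y3 := th_lt y1; have y4 := th_lt y2.
    apply: mulr_ge0_le0; last by apply: sin_le0; apply/andP; split; lra.
    by apply: gp; rewrite y1 (lt_le_trans y2).
  have e2 : F (th (a + L)) x <= F (th (a + L)) (a + L).
    apply: (dv_incr (dF (th (a + L)))) xaL => y /andP[y1 y2].
    have y3 := th_lt y1; have y4 := th_lt y2.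
    apply: mulr_ge0; last by apply: sin_ge0_pi; apply/andP; split; lra.
    by apply: gp; rewrite y2 (le_lt_trans bx).
  have f1 : F (th b) x <= F (th b) s0 := le_trans e1 hb.
  have f2 : F (th (a + L)) x <= F (th (a + L)) s0.
    apply: (le_trans e2); rewrite -hF hL; apply: (le_trans ha).
    by rewrite thL /F cosD_turn sinD_turn.
  have sg : 0 < sin (th (a + L) - th b) by apply: sin_gt0_pi; apply/andP; split; lra.
  have s1 : 0 <= sin (th (a + L) - th x) by apply: sin_ge0_pi; apply/andP; split; lra.
  have s2 : 0 <= sin (th x - th b) by apply: sin_ge0_pi; apply/andP; split; lra.
  rewrite hF -(ler_pM2l sg).
  (* a height that is linear in (cos, sin) interpolates between its values at
     two longitudes less than a half turn apart *)
  have interp y : sin (th (a + L) - th b) * F (th x) y =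
      sin (th (a + L) - th x) * F (th b) y + sin (th x - th b) * F (th (a + L)) y.
    rewrite /F !sinB; set c1 := cos (th (a + L)); set c2 := cos (th b); set c3 := cos (th x).
    set d1 := sin (th (a + L)); set d2 := sin (th b); set d3 := sin (th x); ring.
  by rewrite !interp lerD// ler_wpM2l.
have hl x : a <= x <= a + L -> h x <= F (th x) s0.
  by move=> /andP[x1 x2]; have [xb|/ltW bx] := leP x b; [apply: le1|apply: le2]; apply/andP.
(* [M] is the latitude integral of the great circle [C] in closed form *)
pose A0 := A s0; pose B0 := B s0.
pose l x := A0 * cos (th x) + B0 * sin (th x).
pose l' x := A0 * sin (th x) - B0 * cos (th x).
have dl x : has_deriv l x (- l' x * w x).
  apply: dv_eq; first by apply: dvD; (apply: dvM; first exact: dv_cst); [exact: dcos|exact: dsin].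
  by rewrite /l'; ring.
have dl' x : has_deriv l' x (l x * w x).
  apply: dv_eq; first by apply: dvD; [|apply: dvN]; (apply: dvM; first exact: dv_cst); [exact: dsin|exact: dcos].
  by rewrite /l; ring.
pose M x := atan (l' x / Num.sqrt (1 + l x ^+ 2)).
have dM x : has_deriv M x (sinlat (l x) * w x).
  apply: dv_eq.
    apply: dv_atan; apply: dvM; first exact: dl'.
    by apply: dvV; [rewrite gt_eqF// sqrt1D2_gt0|apply: dv_sqrt1D2; exact: dl].
  have := sqr_sqrt1D2 (l x); have := sqrt1D2_gt0 (l x); rewrite /sinlat.
  set r := Num.sqrt _ => r0 hr.
  have q0 : 0 < r ^+ 2 + l' x ^+ 2 by rewrite ltr_pwDl ?exprn_gt0// sqr_ge0.
  field.
  by rewrite (gt_eqF r0) gt_eqF.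
have ML x : M (x + L) = M x by rewrite /M /l /l' thL cosD_turn sinD_turn.
have flat : forall x, a < x < a + L -> sinlat (l x) * w x - sinlat (h x) * w x = 0.
  apply: (@dv_eq_ends _ (fun x => M x - Psi x) (fun x => sinlat (l x) * w x - sinlat (h x) * w x)).
  - by move=> x; exact: dvD (dM x) (dvN (dPsi x)).
  - move=> x /andP[ax xb]; rewrite subr_ge0 ler_pM2r//; apply: sinlat_le.
    by apply: hl; rewrite (ltW ax) (ltW xb).
  - by rewrite ML PsiL.
have hE x : a < x < a + L -> h x = l x.
  move=> xab; apply/esym/sinlat_inj/(@mulIf _ (w x)); first by rewrite gt_eqF.
  by apply/eqP; rewrite -subr_eq0 flat.
have dh x : has_deriv h x ((B x * cos (th x) - A x * sin (th x)) * w x).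
  apply: dv_eq.
    by apply: dvD; apply: dvM; [exact: dA|exact: dcos|exact: dB|exact: dsin].
  by rewrite /=; ring.
have AE x : a < x < a + L -> A x = A0 /\ B x = B0.
  move=> xab; have e1 := hE x xab.
  have e2 : B x * cos (th x) - A x * sin (th x) = - l' x.
    apply: (@mulIf _ (w x)); first by rewrite gt_eqF.
    exact: (dv_eq_on dh dl hE xab).
  have c2 := cos2Dsin2 (th x); move: e1 e2; rewrite /h /l /l'.
  move: (cos _) (sin _) c2 => c s c2 e1 e2; split.
    have : (A x - A0) * (c ^+ 2 + s ^+ 2) = 0; last by rewrite c2; lra.
    transitivity (c * ((A x * c + B x * s) - (A0 * c + B0 * s)) -
      s * ((B x * c - A x * s) - (- (A0 * s - B0 * c)))); first by ring.
    by rewrite e1 e2 !subrr !mulr0 subr0.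
  have : (B x - B0) * (c ^+ 2 + s ^+ 2) = 0; last by rewrite c2; lra.
  transitivity (s * ((A x * c + B x * s) - (A0 * c + B0 * s)) +
    c * ((B x * c - A x * s) - (- (A0 * s - B0 * c)))); first by ring.
  by rewrite e1 e2 !subrr !mulr0 addr0.
move=> x xab.
have d1 : - (g x * sin (th x)) = 0.
  by apply: (dv_eq_on dA (dv_cst A0) _ xab) => y /AE[].
have d2 : g x * cos (th x) = 0.
  by apply: (dv_eq_on dB (dv_cst B0) _ xab) => y /AE[].
have : g x * (cos (th x) ^+ 2 + sin (th x) ^+ 2) = 0; last by rewrite cos2Dsin2 mulr1.
transitivity (cos (th x) * (g x * cos (th x)) - sin (th x) * - (g x * sin (th x))); first by ring.
by rewrite d1 d2 !mulr0 subr0.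
Qed.
End Sturm.

Section SturmTwoArcs.
Variables (R : realType) (th w A B g Psi : R -> R) (L : R).
Hypothesis dth : forall x, has_deriv th x (w x).
Hypothesis w0 : forall x, 0 < w x.
Hypothesis thL : forall x, th (x + L) = th x + 2 * pi.
Hypothesis dA : forall x, has_deriv A x (- (g x * sin (th x))).
Hypothesis dB : forall x, has_deriv B x (g x * cos (th x)).
Hypothesis AL : forall x, A (x + L) = A x.
Hypothesis BL : forall x, B (x + L) = B x.
Hypothesis gL : forall x, g (x + L) = g x.
Hypothesis dPsi : forall x,
  has_deriv Psi x (sinlat (A x * cos (th x) + B x * sin (th x)) * w x).
Hypothesis PsiL : forall x, Psi (x + L) = Psi x.

Lemma sturm_two_arcs a b : a < b < a + L ->
  (forall x, a < x < b -> g x <= 0) -> (forall x, b < x < a + L -> 0 <= g x) ->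
  exists c d, c < d <= c + L /\ forall x, c < x < d -> g x = 0.
Proof.
move=> /andP[ab baL] gn gp; have L0 : a < a + L := lt_trans ab baL.
have th_lt x y : x < y -> th x < th y by move=> xy; apply: dv_sincr dth _ xy => z _.
have thab := th_lt _ _ ab; have thbL := th_lt _ _ baL; have thLa := thL a.
have [lt|gt|eq] := ltgtP (th (a + L) - th b) pi.
- exists a, (a + L); split; first by rewrite L0 lexx.
  by apply: (sturm_short dth w0 thL dA dB AL BL dPsi PsiL) gn gp lt; rewrite ab.
(* the reflection in the equator exchanges the two arcs *)
- exists b, (b + L); split; first by rewrite lexx andbT ltrDl -(ltrDl a).
  move=> x xb; apply/eqP; rewrite -oppr_eq0; apply/eqP.
  pose nA x := - A x; pose nB x := - B x; pose ng x := - g x; pose nPsi x := - Psi x.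
  have dnA y : has_deriv nA y (- (ng y * sin (th y))).
    by apply: (dv_eq (dvN (dA y))); rewrite /ng mulNr.
  have dnB y : has_deriv nB y (ng y * cos (th y)).
    by apply: (dv_eq (dvN (dB y))); rewrite /ng mulNr.
  have dnPsi y : has_deriv nPsi y (sinlat (nA y * cos (th y) + nB y * sin (th y)) * w y).
    by apply: (dv_eq (dvN (dPsi y))); rewrite /nA /nB !mulNr -opprD sinlatN mulNr.
  apply: (sturm_short dth w0 thL dnA dnB _ _ dnPsi _ _ _ _ _ xb (b := a + L)).
  + by move=> y; rewrite /nA AL.
  + by move=> y; rewrite /nB BL.
  + by move=> y; rewrite /nPsi PsiL.
  + by rewrite baL ltrD2r.
  + by move=> y yb; rewrite oppr_le0 gp.
  + move=> y /andP[y1 y2]; rewrite oppr_ge0 -(subrK L y) gL gn//.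
    by rewrite ltrBrDr y1 ltrBlDr.
  + by rewrite thL; lra.
(* for two half turns the height at longitude [th b] of the tangent circle is
   monotone over the whole period *)
exists a, b; split; first by rewrite ab ltW.
pose F x := A x * cos (th b) + B x * sin (th b).
have dF x : has_deriv F x (g x * sin (th b - th x)).
  apply: dv_eq; first by apply: dvD; (apply: dvM; last exact: dv_cst); [exact: dA|exact: dB].
  by rewrite sinB /=; ring.
have F0 : forall x, a < x < a + L -> - (g x * sin (th b - th x)) = 0.
  apply: (dv_eq_ends (fun x => dvN (dF x))).
    move=> x /andP[ax xL]; rewrite oppr_ge0; have t1 := th_lt _ _ ax; have t2 := th_lt _ _ xL.
    have [xb|bx|->] := ltgtP x b; last by rewrite subrr sin0 mulr0.
      have t3 := th_lt _ _ xb; apply: mulr_le0_ge0; first by apply: gn; rewrite ax.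
      by apply: sin_ge0_pi; apply/andP; split; lra.
    have t3 := th_lt _ _ bx; apply: mulr_ge0_le0; first by apply: gp; rewrite bx.
    by apply: sin_le0; apply/andP; split; lra.
  by rewrite /F AL BL.
move=> x /andP[ax xb]; have t1 := th_lt _ _ ax; have t2 := th_lt _ _ xb.
have sp : 0 < sin (th b - th x) by apply: sin_gt0_pi; apply/andP; split; lra.
have := F0 x; rewrite ax (lt_trans xb baL) => /(_ isT)/eqP.
by rewrite oppr_eq0 mulf_eq0 (gt_eqF sp) orbF => /eqP.
Qed.

End SturmTwoArcs.

(** * Sign changes of a periodic function *)

Section Alternation.
Variable R : realType.

Lemma periodic_int (T : Type) (f : R -> T) (L : R) : (forall x, f (x + L) = f x) ->
  forall x (k : int), f (x + k%:~R * L) = f x.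
Proof.
move=> fL; have nat_case x (n : nat) : f (x + n%:R * L) = f x.
  elim: n x => [|n IH] x; first by rewrite mul0r addr0.
  by rewrite -natr1 mulrDl mul1r addrA fL IH.
move=> x [n|n]; first exact: nat_case.
by rewrite NegzE mulrNz mulNr -[LHS](nat_case _ n.+1) pmulrn subrK.
Qed.

Lemma shift_into (L m x : R) : 0 < L -> exists k : int, m <= x + k%:~R * L < m + L.
Proof.
move=> L0; pose y := (x - m) / L; exists (- Num.floor y).
have xE : x = m + y * L by rewrite /y divfK ?gt_eqF//; ring.
have /andP[f1 f2] := real_floor_itv (num_real y).
rewrite mulrNz mulNr {1 2}xE; rewrite intrD in f2.
by apply/andP; split; nra.
Qed.

(** Start from a positive value at [m] and a negative one at [n], in this order
    in a period. If no four points carry alternating signs, then the last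
    positive point before [n] and the first one after [n] are the ends of an arc
    outside which [f] is non-negative. *)
Lemma sign_changes (f : R -> R) (L : R) : 0 < L -> continuous f ->
  (forall x, f (x + L) = f x) ->
  [\/ exists s1 s2 s3 s4, [/\ s1 < s2 < s3, s3 < s4 < s1 + L &
        [/\ f s1 = 0, f s2 = 0, f s3 = 0 & f s4 = 0]],
      exists a b, [/\ a < b < a + L, forall x, a < x < b -> f x <= 0 &
        forall x, b < x < a + L -> 0 <= f x],
      forall x, 0 <= f x |
      forall x, f x <= 0].
Proof.
move=> L0 cf fL.
have [pos|/forallNP npos] := pselect (exists m, 0 < f m); last first.
  by constructor 4 => x; rewrite leNgt; apply/negP.
have [neg|/forallNP nneg] := pselect (exists n, f n < 0); last first.
  by constructor 3 => x; rewrite leNgt; apply/negP.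
case: pos neg => m fm [n0 fn0].
have [n /andP[mn nmL] fn] : exists2 n, m < n < m + L & f n < 0.
  have [k /andP[k1 k2]] := shift_into m n0 L0.
  exists (n0 + k%:~R * L); last by rewrite periodic_int.
  rewrite k2 andbT lt_neqAle k1 andbT; apply/eqP => e.
  by move: fm; rewrite e periodic_int// ltNge (ltW fn0).
have zero x y : x < y -> f x * f y < 0 -> exists2 z, x < z < y & f z = 0.
  move=> xy fxy.
  have [|z] := @IVT R f x y 0 (ltW xy) (continuous_subspaceT cf).
    by case: (ltgtP (f x) (f y)) => *; apply/andP; split; nra.
  rewrite in_itv/= => /andP[xz zy] fz; exists z => //.
  rewrite !lt_neqAle xz zy !andbT; apply/andP; split; apply/eqP => e.
    by move: fxy; rewrite e fz mul0r ltxx.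
  by move: fxy; rewrite -e fz mulr0 ltxx.
have [[x1 [x2 [x3 [x4 [h1 h2 h3 h4 [g1 g2 g3 g4]]]]]]|nalt] := pselect (exists x1 x2 x3 x4,
    [/\ x1 < x2, x2 < x3, x3 < x4, x4 < x1 + L &
     [/\ 0 < f x1, f x2 < 0, 0 < f x3 & f x4 < 0]]).
  have [s1 /andP[? ?] ?] := zero _ _ h1 ltac:(nra).
  have [s2 /andP[? ?] ?] := zero _ _ h2 ltac:(nra).
  have [s3 /andP[? ?] ?] := zero _ _ h3 ltac:(nra).
  have [s4 /andP[? ?] ?] := zero _ _ h4 ltac:(rewrite fL; nra).
  by constructor 1; exists s1, s2, s3, s4; split => //; apply/andP; split; lra.
constructor 2.
have [d d0 nbn] : exists2 d, 0 < d & forall x, n - d < x < n + d -> f x < 0.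
  have /nbhs_ballP[d d0 dn] := cf n _ (lt_nbhsl fn).
  by exists d => // x xn; apply: dn; rewrite /ball/= ltr_distlC.
have [e e0 nbm] : exists2 d, 0 < d & forall x, m - d < x < m + d -> 0 < f x.
  have /nbhs_ballP[d' d'0 dn] := cf m _ (lt_nbhsr fm).
  by exists d' => // x xn; apply: dn; rewrite /ball/= ltr_distlC.
pose P := [set s | m <= s <= n /\ 0 < f s].
pose Q := [set s | n <= s <= m + L /\ 0 < f s].
have supP : has_sup P.
  by split; [exists m; rewrite /P/= lexx ltW|exists n => s [/andP[]]].
have infQ : has_inf Q.
  split; first by exists (m + L); rewrite /Q/= lexx fL ltW.
  by exists n => s [/andP[]].
exists (sup P), (inf Q).
have bn : sup P <= n - d.
  apply: ge_sup; first by case: supP.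
  move=> s [/andP[ms sn] fs]; rewrite leNgt; apply/negP => sd.
  have fsn : f s < 0 by apply: nbn; apply/andP; split; lra.
  by move: fs; rewrite ltNge ltW.
have nQ : n <= inf Q by apply: lb_le_inf; [case: infQ|move=> s [/andP[]]].
have mP : m < sup P.
  pose y := Num.min (m + e / 2) n.
  have my : m < y by rewrite lt_min mn andbT ltrDl divr_gt0.
  apply: (lt_le_trans my); apply: ub_le_sup; first by case: supP.
  split; first by rewrite (ltW my) ge_min lexx orbT.
  apply: nbm; apply/andP; split; first by lra.
  by rewrite gt_min; apply/orP; left; lra.
have Qm : inf Q <= m + L.
  by apply: ge_inf; [case: infQ|split; [rewrite lexx ltW|rewrite fL]].
split.
- by apply/andP; split; lra.
- move=> x /andP[px xq]; rewrite leNgt; apply/negP => fx.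
  have [xn|/ltW nx] := leP x n.
    suff : x <= sup P by rewrite leNgt px.
    by apply: ub_le_sup; [case: supP|split => //; rewrite xn andbT ltW// (lt_trans mP)].
  suff : inf Q <= x by rewrite leNgt xq.
  by apply: ge_inf; [case: infQ|split => //; rewrite nx ltW// (lt_le_trans xq)].
- have below x : m < x < sup P -> 0 <= f x.
    move=> /andP[mx xp]; rewrite leNgt; apply/negP => fx.
    have xp0 : 0 < sup P - x by rewrite subr_gt0.
    have [y [/andP[my yn] fy]] := sup_adherent xp0 supP.
    rewrite subKr => xy; apply: nalt; exists m, x, y, n; split => //.
    rewrite lt_neqAle yn andbT; apply/eqP => yE; move: fy; rewrite yE ltNge ltW//.
  move=> x /andP[qx xp].
  have [xm|mx|->] := ltgtP x (m + L); last by rewrite fL ltW.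
    rewrite leNgt; apply/negP => fx.
    have xq0 : 0 < x - inf Q by rewrite subr_gt0.
    have [y [/andP[ny ym] fy]] := inf_adherent xq0 infQ.
    rewrite addrC subrK => yx; apply: nalt; exists m, n, y, x; split => //.
    rewrite lt_neqAle ny andbT; apply/eqP => yE; move: fy; rewrite -yE ltNge ltW//.
  rewrite -(subrK L x) fL; apply: below.
  by rewrite ltrBrDr mx ltrBlDr.
Qed.

End Alternation.

(** * Equidistant curves in coordinates *)

Section OrthonormalPair.
Variables (R : realType) (x1 x2 x3 t1 t2 t3 : R).
Hypothesis xx : x1 ^+ 2 + x2 ^+ 2 + x3 ^+ 2 = 1.
Hypothesis tt : t1 ^+ 2 + t2 ^+ 2 + t3 ^+ 2 = 1.
Hypothesis xt : x1 * t1 + x2 * t2 + x3 * t3 = 0.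
Let n1 := x2 * t3 - x3 * t2.
Let n2 := x3 * t1 - x1 * t3.
Let n3 := x1 * t2 - x2 * t1.

Lemma cross_x_n : [/\ x2 * n3 - x3 * n2 = - t1, x3 * n1 - x1 * n3 = - t2 &
  x1 * n2 - x2 * n1 = - t3].
Proof.
have e (x t : R) : x * (x1 * t1 + x2 * t2 + x3 * t3) -
    t * (x1 ^+ 2 + x2 ^+ 2 + x3 ^+ 2) = - t by rewrite xx xt; ring.
rewrite -(e x1 t1) -(e x2 t2) -(e x3 t3) /n1 /n2 /n3.
by split; ring.
Qed.

Lemma cross_n_t : n1 * t2 - n2 * t1 = - x3.
Proof.
transitivity (t3 * (x1 * t1 + x2 * t2 + x3 * t3) - x3 * (t1 ^+ 2 + t2 ^+ 2 + t3 ^+ 2)).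
  by rewrite /n1 /n2; ring.
by rewrite tt xt; ring.
Qed.

Lemma last_column : x3 ^+ 2 + t3 ^+ 2 + n3 ^+ 2 = 1.
Proof.
have -> : n3 ^+ 2 = (x1 ^+ 2 + x2 ^+ 2 + x3 ^+ 2 - x3 ^+ 2) *
  (t1 ^+ 2 + t2 ^+ 2 + t3 ^+ 2 - t3 ^+ 2) -
  (x1 * t1 + x2 * t2 + x3 * t3 - x3 * t3) ^+ 2 by rewrite /n3; ring.
by rewrite xx tt xt; ring.
Qed.

Lemma norm_cross : n1 ^+ 2 + n2 ^+ 2 + n3 ^+ 2 = 1.
Proof.
have -> : n1 ^+ 2 + n2 ^+ 2 + n3 ^+ 2 = (x1 ^+ 2 + x2 ^+ 2 + x3 ^+ 2) *
  (t1 ^+ 2 + t2 ^+ 2 + t3 ^+ 2) - (x1 * t1 + x2 * t2 + x3 * t3) ^+ 2.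
  by rewrite /n1 /n2 /n3; ring.
by rewrite xx tt xt; ring.
Qed.

End OrthonormalPair.

(** A unit-speed spherical curve in coordinates: [x] is the position, [t] the
    velocity and [n] the conormal [x] cross [t]. The [eqd] are the coordinates
    of [x - b n], which up to a factor is the curve at distance arctan [b] from
    [x], and the [con] those of its conormal [n + b x]; [rad2] is the squared
    distance of [x - b n] from the third axis, and [angspeed] its angular speed
    around this axis. *)
Section Equidistant.
Variables (R : realType) (x1 x2 x3 t1 t2 t3 k : R -> R) (b : R).
Let n1 s := x2 s * t3 s - x3 s * t2 s.
Let n2 s := x3 s * t1 s - x1 s * t3 s.
Let n3 s := x1 s * t2 s - x2 s * t1 s.
Hypothesis xx : forall s, x1 s ^+ 2 + x2 s ^+ 2 + x3 s ^+ 2 = 1.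
Hypothesis tt : forall s, t1 s ^+ 2 + t2 s ^+ 2 + t3 s ^+ 2 = 1.
Hypothesis xt : forall s, x1 s * t1 s + x2 s * t2 s + x3 s * t3 s = 0.
Hypothesis dx1 : forall s, has_deriv x1 s (t1 s).
Hypothesis dx2 : forall s, has_deriv x2 s (t2 s).
Hypothesis dx3 : forall s, has_deriv x3 s (t3 s).
Hypothesis dt1 : forall s, has_deriv t1 s (- x1 s + k s * n1 s).
Hypothesis dt2 : forall s, has_deriv t2 s (- x2 s + k s * n2 s).
Hypothesis dt3 : forall s, has_deriv t3 s (- x3 s + k s * n3 s).
Hypothesis ck : continuous k.

Definition eqd1 s := x1 s - b * n1 s.
Definition eqd2 s := x2 s - b * n2 s.
Definition eqd3 s := x3 s - b * n3 s.
Definition con1 s := n1 s + b * x1 s.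
Definition con2 s := n2 s + b * x2 s.
Definition con3 s := n3 s + b * x3 s.
Definition rad2 s := eqd1 s ^+ 2 + eqd2 s ^+ 2.
Definition angspeed s := (1 + b * k s) * con3 s / rad2 s.
Let q := Num.sqrt (1 + b ^+ 2).

Hypothesis G0 : forall s, 0 < con3 s.

Let dn1 s : has_deriv n1 s (- k s * t1 s).
Proof.
apply: dv_eq; first by apply: dvD; [|apply: dvN]; apply: dvM;
  [exact: dx2|exact: dt3|exact: dx3|exact: dt2].
have [h _ _] := cross_x_n (xx s) (xt s).
by rewrite mulNr -mulrN -h /n1 /n2 /n3; ring.
Qed.

Let dn2 s : has_deriv n2 s (- k s * t2 s).
Proof.
apply: dv_eq; first by apply: dvD; [|apply: dvN]; apply: dvM;
  [exact: dx3|exact: dt1|exact: dx1|exact: dt3].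
have [_ h _] := cross_x_n (xx s) (xt s).
by rewrite mulNr -mulrN -h /n1 /n2 /n3; ring.
Qed.

Let dn3 s : has_deriv n3 s (- k s * t3 s).
Proof.
apply: dv_eq; first by apply: dvD; [|apply: dvN]; apply: dvM;
  [exact: dx1|exact: dt2|exact: dx2|exact: dt1].
have [_ _ h] := cross_x_n (xx s) (xt s).
by rewrite mulNr -mulrN -h /n1 /n2 /n3; ring.
Qed.

Let deqd (x n t : R -> R) s : has_deriv x s (t s) -> has_deriv n s (- k s * t s) ->
  has_deriv (fun s => x s - b * n s) s ((1 + b * k s) * t s).
Proof.
move=> dx dn; apply: dv_eq.
  by apply: dvD; [exact: dx|apply: dvN; apply: dvM; [exact: dv_cst|exact: dn]].
by rewrite /=; ring.
Qed.

Let dcon (x n t : R -> R) s : has_deriv x s (t s) -> has_deriv n s (- k s * t s) ->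
  has_deriv (fun s => n s + b * x s) s (- (k s - b) * t s).
Proof.
move=> dx dn; apply: dv_eq.
  by apply: dvD; [exact: dn|apply: dvM; [exact: dv_cst|exact: dx]].
by rewrite /=; ring.
Qed.

Let q2 : q ^+ 2 = 1 + b ^+ 2.
Proof. by rewrite sqr_sqrt1D2. Qed.

Let q0 : 0 < q. Proof. exact: sqrt1D2_gt0. Qed.

Lemma rad2_eqd3 s : rad2 s + eqd3 s ^+ 2 = 1 + b ^+ 2.
Proof.
have h := norm_cross (xx s) (tt s) (xt s).
transitivity ((x1 s ^+ 2 + x2 s ^+ 2 + x3 s ^+ 2) + b ^+ 2 * (n1 s ^+ 2 + n2 s ^+ 2 + n3 s ^+ 2)).
  by rewrite /rad2 /eqd1 /eqd2 /eqd3 /n1 /n2 /n3; ring.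
by rewrite /n1 /n2 /n3 h xx mulr1.
Qed.

Lemma rad2_con3 s : rad2 s = con3 s ^+ 2 + (1 + b ^+ 2) * t3 s ^+ 2.
Proof.
have h := last_column (xx s) (tt s) (xt s).
apply: (@addIr _ (eqd3 s ^+ 2)); rewrite rad2_eqd3.
transitivity ((1 + b ^+ 2) * (x3 s ^+ 2 + t3 s ^+ 2 + n3 s ^+ 2)).
  by rewrite h mulr1.
by rewrite /eqd3 /con3; ring.
Qed.

Lemma rad2_gt0 s : 0 < rad2 s.
Proof.
rewrite rad2_con3 ltr_pwDl ?exprn_gt0//.
by rewrite mulr_ge0 ?sqr_ge0// addr_ge0 ?sqr_ge0.
Qed.

Lemma cross_eqd_t s : eqd1 s * t2 s - eqd2 s * t1 s = con3 s.
Proof.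
have h := cross_n_t (tt s) (xt s).
transitivity (n3 s - b * (n1 s * t2 s - n2 s * t1 s)).
  by rewrite /eqd1 /eqd2 /n3; ring.
by rewrite /n1 /n2 h /con3; ring.
Qed.

Lemma con_orth_eqd s : con1 s * eqd1 s + con2 s * eqd2 s = - (con3 s * eqd3 s).
Proof.
have h := norm_cross (xx s) (tt s) (xt s).
apply/eqP; rewrite -subr_eq0 opprK; apply/eqP.
transitivity (b * (x1 s ^+ 2 + x2 s ^+ 2 + x3 s ^+ 2) -
  b * (n1 s ^+ 2 + n2 s ^+ 2 + n3 s ^+ 2)).
  by rewrite /con1 /con2 /con3 /eqd1 /eqd2 /eqd3 /n1 /n2 /n3; ring.
by rewrite /n1 /n2 /n3 h xx; ring.
Qed.

Lemma equidistant_angle : exists th : R -> R, forall s,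
  [/\ has_deriv th s (angspeed s), eqd1 s = Num.sqrt (rad2 s) * cos (th s) &
      eqd2 s = Num.sqrt (rad2 s) * sin (th s)].
Proof.
have ct1 : continuous t1 by move=> s; exact: dv_cont (dt1 s).
have ct2 : continuous t2 by move=> s; exact: dv_cont (dt2 s).
have cont1 t : continuous t -> continuous (fun s => (1 + b * k s) * t s).
  move=> ct s; apply: cvgM; last exact: ct.
  by apply: cvgD; [exact: cvg_cst|apply: cvgM; [exact: cvg_cst|exact: ck]].
have [th h] := angle_lift (fun s => deqd (dx1 s) (dn1 s)) (fun s => deqd (dx2 s) (dn2 s))
  (cont1 _ ct1) (cont1 _ ct2) rad2_gt0.
exists th => s; have [h1 h2 h3] := h s; split; [|exact: h2|exact: h3].
apply: (dv_eq h1); rewrite /angspeed -cross_eqd_t /rad2 /eqd1 /eqd2; congr (_ / _); ring.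
Qed.

(** The angle between the equidistant curve and the parallels changes by the
    geodesic curvature [k - b] less the turning of the parallels; over a period
    this is the Gauss-Bonnet formula. *)
Lemma dv_course s : has_deriv (fun s => atan (q * t3 s / con3 s)) s
  ((k s - b - eqd3 s * angspeed s) / q).
Proof.
apply: dv_eq.
  apply: dv_atan; apply: dvM; first by apply: dvM; [exact: dv_cst|exact: dt3].
  by apply: dvV; [rewrite gt_eqF|exact: dcon (dx3 s) (dn3 s)].
have G := G0 s; have r0 := rad2_gt0 s; have rE := rad2_con3 s; rewrite -q2 in rE.
have xE : - x3 s + k s * n3 s = ((k s - b) * con3 s - (1 + b * k s) * eqd3 s) / q ^+ 2.
  rewrite q2; have q20 : 1 + b ^+ 2 != 0 by rewrite gt_eqF// -q2 exprn_gt0.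
  by apply: (mulIf q20); rewrite divfK// /con3 /eqd3; ring.
rewrite /angspeed {}xE; rewrite /= rE.
have r1 : con3 s ^+ 2 + q ^+ 2 * t3 s ^+ 2 != 0 by rewrite -rE gt_eqF.
move: (con3 s) (eqd3 s) G r1 {rE r0} => c e G r1.
by field; rewrite exprMn r1 (gt_eqF G) (gt_eqF q0).
Qed.

(** The great circle tangent to the equidistant curve lies in the plane
    orthogonal to the conormal, hence is the graph of the linear function with
    coefficients [- con1 / con3] and [- con2 / con3]. *)
Lemma dv_tangent1 s : has_deriv (fun s => - con1 s / con3 s) s
  (- ((k s - b) / con3 s ^+ 2 * eqd2 s)).
Proof.
apply: dv_eq.
  apply: dvM; first by apply: dvN; exact: dcon (dx1 s) (dn1 s).
  by apply: dvV; [rewrite gt_eqF|exact: dcon (dx3 s) (dn3 s)].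
have G := G0 s.
have e : eqd2 s = t3 s * con1 s - t1 s * con3 s.
  rewrite /eqd2 /con1 /con3.
  transitivity ((t3 s * n1 s - t1 s * n3 s) - b * n2 s); last by rewrite /n1 /n2 /n3; ring.
  congr (_ - _).
  transitivity (x2 s * (t1 s ^+ 2 + t2 s ^+ 2 + t3 s ^+ 2) - t2 s *(x1 s * t1 s + x2 s * t2 s + x3 s * t3 s)).
    by rewrite tt xt; ring.
  by rewrite /n1 /n3; ring.
rewrite e /=; move: (con1 s) (con3 s) G => c1 c3 G.
by field; rewrite gt_eqF.
Qed.

Lemma dv_tangent2 s : has_deriv (fun s => - con2 s / con3 s) s
  ((k s - b) / con3 s ^+ 2 * eqd1 s).
Proof.
apply: dv_eq.
  apply: dvM; first by apply: dvN; exact: dcon (dx2 s) (dn2 s).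
  by apply: dvV; [rewrite gt_eqF|exact: dcon (dx3 s) (dn3 s)].
have G := G0 s.
have e : eqd1 s = t2 s * con3 s - t3 s * con2 s.
  rewrite /eqd1 /con2 /con3.
  transitivity ((t2 s * n3 s - t3 s * n2 s) - b * n1 s); last by rewrite /n1 /n2 /n3; ring.
  congr (_ - _).
  transitivity (x1 s * (t1 s ^+ 2 + t2 s ^+ 2 + t3 s ^+ 2) - t1 s *(x1 s * t1 s + x2 s * t2 s + x3 s * t3 s)).
    by rewrite tt xt; ring.
  by rewrite /n2 /n3; ring.
rewrite e /=; move: (con2 s) (con3 s) G => c2 c3 G.
by field; rewrite gt_eqF.
Qed.

End Equidistant.

(** * Four points of average curvature *)

Section Winding.
Variable R : realType.

Lemma periodic_increment (f f' : R -> R) (L x : R) :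
  (forall x, has_deriv f x (f' x)) -> (forall x, f' (x + L) = f' x) ->
  f (x + L) - f x = f L - f 0.
Proof.
move=> df fL; rewrite -[L in RHS]add0r.
apply: (@dv_cstT _ (fun x => f (x + L) - f x)) => z; apply: dv_eq.
  apply: dvD; last by apply: dvN; exact: df.
  apply: (@dv_comp _ f (fun y => y + L)); first exact: df.
  by apply: dvD; [exact: dv_id|exact: dv_cst].
by rewrite /= fL addr0 mulr1 subrr.
Qed.

Lemma cos_eq1 (c : R) : cos c = 1 -> 0 < c -> 2 * pi <= c.
Proof.
move=> c1 c0; rewrite leNgt; apply/negP => cpi.
have s0 : 0 < sin (c / 2) by apply: sin_gt0_pi; apply/andP; split; lra.
have : cos (c / 2 + c / 2) = 1 by rewrite -splitr.
have := cos2Dsin2 (c / 2); rewrite cosD; nra.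
Qed.

Let winding_step (D : R -> R) (x y : R) : x <= y -> continuous D ->
  (forall s, cos (D s) != -1) -> D y < D x + 2 * pi.
Proof.
move=> xy cD nD; rewrite ltNge; apply/negP => Dy.
have cc : continuous (fun z : R => cos (z / 2)).
  move=> z; apply: (@continuous_comp _ _ _ (fun z : R => z / 2)); last exact: continuous_cos.
  exact: cvgMl.
have D2 : D x <= D x + 2 * pi by rewrite lerDl mulr_ge0// pi_ge0.
have [|v] := @IVT R (fun z => cos (z / 2)) (D x) (D x + 2 * pi) 0 D2 (continuous_subspaceT cc).
  have -> : (D x + 2 * pi) / 2 = D x / 2 + pi by field.
  rewrite cosDpi; case: (ltgtP (cos (D x / 2)) (- cos (D x / 2))) => *; apply/andP; split; lra.
rewrite in_itv/= => /andP[v1 v2] cv.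
have [|s _ Ds] := @IVT R D x y v xy (continuous_subspaceT cD).
  have DD : D x <= D y by have := pi_ge0 R; lra.
  by rewrite min_l// max_r// v1 (le_trans v2 Dy).
move: (nD s); rewrite Ds (splitr v) cosD cv; have := cos2Dsin2 (v / 2); rewrite cv.
by move=> h; apply/negP; rewrite negbK; apply/eqP; lra.
Qed.

(** An angle that never takes the value of a half turn cannot wind. *)
Lemma winding_eq0 (D : R -> R) (L c : R) : 0 < L -> continuous D ->
  (forall s, D (s + L) = D s + c) -> cos c = 1 -> (forall s, cos (D s) != -1) -> c = 0.
Proof.
move=> L0 cD DL c1 nD.
have s1 : c < 2 * pi.
  have := @winding_step D 0 L (ltW L0) cD nD.
  by have := DL 0; rewrite add0r; lra.
have s2 : - c < 2 * pi.
  have cDN : continuous (fun s => - D s) by move=> s; apply: cvgN; exact: cD.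
  have := @winding_step _ 0 L (ltW L0) cDN; have := DL 0; rewrite add0r => -> h.
  suff : - (D 0 + c) < - D 0 + 2 * pi by lra.
  by apply: h => s; rewrite cosN.
have [c0|c0|//] := ltgtP c 0.
  by have := cos_eq1 (c := - c); rewrite cosN c1 oppr_gt0 => /(_ erefl c0); lra.
by have := cos_eq1 c1 c0; lra.
Qed.

Lemma four_in_interval (f : R -> R) (L c d : R) : c < d <= c + L ->
  (forall x, c < x < d -> f x = 0) ->
  exists s1 s2 s3 s4, [/\ s1 < s2 < s3, s3 < s4 < s1 + L &
    [/\ f s1 = 0, f s2 = 0, f s3 = 0 & f s4 = 0]].
Proof.
move=> /andP[cd dL] f0; pose e := (d - c) / 5.
exists (c + e), (c + 2 * e), (c + 3 * e), (c + 4 * e); rewrite /e.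
split; [| |split; apply: f0]; apply/andP; split; lra.
Qed.

End Winding.

Section FourPoints.
Variables (R : realType) (x1 x2 x3 t1 t2 t3 k K th0 : R -> R) (b L : R).
Let n1 s := x2 s * t3 s - x3 s * t2 s.
Let n2 s := x3 s * t1 s - x1 s * t3 s.
Let n3 s := x1 s * t2 s - x2 s * t1 s.
Hypothesis L0 : 0 < L.
Hypothesis xx : forall s, x1 s ^+ 2 + x2 s ^+ 2 + x3 s ^+ 2 = 1.
Hypothesis tt : forall s, t1 s ^+ 2 + t2 s ^+ 2 + t3 s ^+ 2 = 1.
Hypothesis xt : forall s, x1 s * t1 s + x2 s * t2 s + x3 s * t3 s = 0.
Hypothesis dx1 : forall s, has_deriv x1 s (t1 s).
Hypothesis dx2 : forall s, has_deriv x2 s (t2 s).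
Hypothesis dx3 : forall s, has_deriv x3 s (t3 s).
Hypothesis dt1 : forall s, has_deriv t1 s (- x1 s + k s * n1 s).
Hypothesis dt2 : forall s, has_deriv t2 s (- x2 s + k s * n2 s).
Hypothesis dt3 : forall s, has_deriv t3 s (- x3 s + k s * n3 s).
Hypothesis ck : continuous k.
Hypotheses (x1L : forall s, x1 (s + L) = x1 s) (x2L : forall s, x2 (s + L) = x2 s)
  (x3L : forall s, x3 (s + L) = x3 s).
Hypotheses (t1L : forall s, t1 (s + L) = t1 s) (t2L : forall s, t2 (s + L) = t2 s)
  (t3L : forall s, t3 (s + L) = t3 s).
Hypothesis kL : forall s, k (s + L) = k s.
Hypothesis dK : forall s, has_deriv K s (k s).
Hypothesis KL : forall s, K (s + L) = K s + b * L.
Hypothesis k0 : forall s, 0 <= k s.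
Hypothesis n30 : forall s, 0 < n3 s.
Hypothesis x30 : forall s, 0 < x3 s.
Hypothesis dth0 : forall s, has_deriv th0 s (n3 s / (x1 s ^+ 2 + x2 s ^+ 2)).
Hypothesis x1E : forall s, x1 s = Num.sqrt (x1 s ^+ 2 + x2 s ^+ 2) * cos (th0 s).
Hypothesis x2E : forall s, x2 s = Num.sqrt (x1 s ^+ 2 + x2 s ^+ 2) * sin (th0 s).
Hypothesis th0L : forall s, th0 (s + L) = th0 s + 2 * pi.

(** When [k - b] has two sign changes, [sturm_two_arcs] applies to the
    equidistant curve at distance arctan [b], and shows that [k = b] on a whole
    arc. *)
Lemma four_average_points : exists s1 s2 s3 s4, [/\ s1 < s2 < s3, s3 < s4 < s1 + L &
  [/\ k s1 = b, k s2 = b, k s3 = b & k s4 = b]].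
Proof.
pose f s := k s - b.
have cf : continuous f by move=> s; apply: cvgB; [exact: ck|exact: cvg_cst].
have fL s : f (s + L) = f s by rewrite /f kL.
suff [s1 [s2 [s3 [s4 [h1 h2 [z1 z2 z3 z4]]]]]] : exists s1 s2 s3 s4,
    [/\ s1 < s2 < s3, s3 < s4 < s1 + L & [/\ f s1 = 0, f s2 = 0, f s3 = 0 & f s4 = 0]].
  exists s1, s2, s3, s4; split=> //.
  by split; apply/eqP; rewrite -subr_eq0; apply/eqP.
have dKb s : has_deriv (fun s => K s - b * s) s (f s).
  apply: dv_eq; first by apply: dvD; [exact: dK|apply: dvN; apply: dvM; [exact: dv_cst|exact: dv_id]].
  by rewrite /= /f; ring.
have KbL s : K (s + L) - b * (s + L) = K s - b * s by rewrite KL; ring.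
have b0 : 0 <= b.
  rewrite -(pmulr_lge0 _ L0); have := KL 0; rewrite add0r.
  by have := dv_incr dK (fun s _ => k0 s) (ltW L0); lra.
have [//|[a [a' [h1 h2 h3]]]|pos|neg] := sign_changes L0 cf fL; last first.
- apply: (@four_in_interval _ f L 0 L); first by rewrite L0 add0r lexx.
  move=> s sL; apply/eqP; rewrite -oppr_eq0; apply/eqP; move: s sL.
  apply: (dv_eq_ends (fun s => dvN (dKb s))); first by move=> s _; rewrite oppr_ge0.
  by rewrite -[L in RHS]add0r KbL.
- apply: (@four_in_interval _ f L 0 L); first by rewrite L0 add0r lexx.
  apply: (dv_eq_ends dKb); first by move=> s _; exact: pos.
  by rewrite -[L in RHS]add0r KbL.
pose d1 := eqd1 x1 x2 x3 t2 t3 b; pose d2 := eqd2 x1 x2 x3 t1 t3 b.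
pose d3 := eqd3 x1 x2 x3 t1 t2 b; pose G3 := con3 x1 x2 x3 t1 t2 b.
pose r2 := rad2 x1 x2 x3 t1 t2 t3 b; pose w := angspeed x1 x2 x3 t1 t2 t3 k b.
have G0 s : 0 < G3 s by apply: ltr_pwDl; [exact: n30|rewrite mulr_ge0// ltW].
have r20 s : 0 < r2 s := rad2_gt0 xx tt xt G0 s.
have rho0 s : 0 < Num.sqrt (r2 s) by rewrite sqrtr_gt0.
have w0 s : 0 < w s.
  apply: divr_gt0; [apply: mulr_gt0; last exact: G0|exact: r20].
  by rewrite ltr_pwDl ?mulr_ge0.
have [th th_spec] := equidistant_angle xx tt xt dx1 dx2 dx3 dt1 dt2 dt3 ck G0.
have dth s : has_deriv th s (w s) by have [] := th_spec s.
have d1E s : d1 s = Num.sqrt (r2 s) * cos (th s) by have [] := th_spec s.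
have d2E s : d2 s = Num.sqrt (r2 s) * sin (th s) by have [] := th_spec s.
have d1L s : d1 (s + L) = d1 s by rewrite /d1 /eqd1 x1L x2L x3L t2L t3L.
have d2L s : d2 (s + L) = d2 s by rewrite /d2 /eqd2 x1L x2L x3L t1L t3L.
have G3L s : G3 (s + L) = G3 s by rewrite /G3 /con3 x1L x2L x3L t1L t2L.
have r2L s : r2 (s + L) = r2 s by rewrite /r2 /rad2 -/d1 -/d2 d1L d2L.
have wL s : w (s + L) = w s by rewrite /w /angspeed -/r2 -/G3 kL G3L r2L.
(* the equidistant point and the position turn equally often around the axis:
   the horizontal velocity is to the left of both, so they are never on opposite
   sides of the axis *)
have thL s : th (s + L) = th s + 2 * pi.
  pose D s := th s - th0 s.
  have cD : continuous D.
    by move=> x; apply: cvgB; [exact: dv_cont (dth x)|exact: dv_cont (dth0 x)].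
  have incr x : th (x + L) = th x + (th L - th 0).
    by rewrite -(periodic_increment x dth wL) [RHS]addrC subrK.
  pose c := th L - th 0 - 2 * pi.
  have DL x : D (x + L) = D x + c by rewrite /D /c incr th0L; ring.
  suff c0 : c = 0 by rewrite incr; move: c0; rewrite /c; lra.
  apply: (winding_eq0 L0 cD DL).
    have e1 : cos (th 0 + (th L - th 0)) = cos (th 0).
      have := d1L 0; rewrite !d1E r2L incr => /mulfI; apply.
      by rewrite gt_eqF.
    have e2 : sin (th 0 + (th L - th 0)) = sin (th 0).
      have := d2L 0; rewrite !d2E r2L incr => /mulfI; apply.
      by rewrite gt_eqF.
    have -> : cos c = cos (th 0 + (th L - th 0) - th 0).
      by rewrite -(cosD_turn c) /c; congr cos; ring.
    by rewrite cosB e1 e2 -!expr2 cos2Dsin2.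
  move=> x; apply/eqP => Dx.
  have sD : sin (D x) = 0.
    by have := cos2Dsin2 (D x); rewrite Dx => h; apply/eqP; rewrite -sqrf_eq0; apply/eqP; lra.
  have thE : th x = th0 x + D x by rewrite /D addrC subrK.
  have := cross_eqd_t b tt xt x; have := G0 x; rewrite -/d1 -/d2 -/G3 d1E d2E thE cosD sinD Dx sD.
  rewrite !mulr0 subr0 addr0 => g e.
  have X0 : 0 < x1 x ^+ 2 + x2 x ^+ 2.
    have := n30 x; rewrite /n3; have := sqr_ge0 (x1 x); have := sqr_ge0 (x2 x).
    rewrite le_eqVlt => /predU1P[/esym/eqP|h _ _]; last by rewrite ltr_wpDl ?sqr_ge0.
    rewrite sqrf_eq0 => /eqP ->; rewrite le_eqVlt => /predU1P[/esym/eqP|h _].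
      by rewrite sqrf_eq0 => /eqP ->; rewrite !mul0r subrr ltxx.
    by rewrite ltr_pwDl ?sqr_ge0.
  have R0 : 0 < Num.sqrt (x1 x ^+ 2 + x2 x ^+ 2) by rewrite sqrtr_gt0.
  pose y := cos (th0 x) * t2 x - sin (th0 x) * t1 x.
  have e1 : G3 x = - (Num.sqrt (r2 x) * y) by rewrite -e /y; ring.
  have e2 : n3 x = Num.sqrt (x1 x ^+ 2 + x2 x ^+ 2) * y.
    by rewrite /y mulrBr !mulrA -x1E -x2E.
  have y0 : 0 < y by rewrite -(pmulr_rgt0 _ R0) -e2.
  by move: g; rewrite e1 oppr_gt0 pmulr_rlt0// ltNge ltW.
pose A s := - con1 x1 x2 x3 t2 t3 b s / G3 s.
pose B s := - con2 x1 x2 x3 t1 t3 b s / G3 s.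
pose g s := f s / G3 s ^+ 2 * Num.sqrt (r2 s).
have dA s : has_deriv A s (- (g s * sin (th s))).
  apply: dv_eq (dv_tangent1 xx tt xt dx1 dx2 dx3 dt1 dt2 dt3 G0 s) _.
  by rewrite -/d2 d2E /g mulrA.
have dB s : has_deriv B s (g s * cos (th s)).
  apply: dv_eq (dv_tangent2 xx tt xt dx1 dx2 dx3 dt1 dt2 dt3 G0 s) _.
  by rewrite -/d1 d1E /g mulrA.
have AL s : A (s + L) = A s by rewrite /A G3L /con1 x1L x2L x3L t2L t3L.
have BL s : B (s + L) = B s by rewrite /B G3L /con2 x1L x2L x3L t1L t3L.
have gL s : g (s + L) = g s by rewrite /g fL G3L r2L.
pose q := Num.sqrt (1 + b ^+ 2).
have q0 : 0 < q := sqrt1D2_gt0 b.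
have hE s : sinlat (A s * cos (th s) + B s * sin (th s)) = d3 s / q.
  have -> : A s * cos (th s) + B s * sin (th s) = d3 s / Num.sqrt (r2 s).
    have := con_orth_eqd b xx tt xt s; rewrite -/d1 -/d2 -/d3 -/G3 d1E d2E /A /B.
    have := rho0 s; have := G0 s; move: (G3 s) (Num.sqrt _) (con1 _ _ _ _ _ _ _) (con2 _ _ _ _ _ _ _).
    move=> G r c1 c2 Gp rp e; apply: (@mulIf _ (G * r)); first by rewrite gt_eqF// mulr_gt0.
    transitivity (- (c1 * (r * cos (th s)) + c2 * (r * sin (th s)))).
      by field; rewrite gt_eqF.
    by rewrite e; field; rewrite gt_eqF.
  have -> : sinlat (d3 s / Num.sqrt (r2 s)) = d3 s / Num.sqrt (r2 s) / (q / Num.sqrt (r2 s)).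
    rewrite /sinlat; congr (_ / _).
    rewrite expr_div_n sqr_sqrtr ?ltW//.
    have -> : 1 + d3 s ^+ 2 / r2 s = (1 + b ^+ 2) / r2 s.
      by rewrite -(rad2_eqd3 b xx tt xt s) -/d3 -/r2; field; rewrite gt_eqF.
    by rewrite sqrtrM ?addr_ge0 ?sqr_ge0// sqrtrV// ltW.
  by field; rewrite (gt_eqF q0) (gt_eqF (rho0 s)).
(* the integral of the sine of the latitude [d3 / q], in closed form *)
pose Psi s := (K s - b * s) / q - atan (q * t3 s / G3 s).
have dPsi s : has_deriv Psi s (sinlat (A s * cos (th s) + B s * sin (th s)) * w s).
  apply: dv_eq.
    apply: dvD; first by apply: dvM; [exact: dKb|exact: dv_cst].
    by apply: dvN; exact: (dv_course xx tt xt dx1 dx2 dx3 dt1 dt2 dt3 G0 s).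
  by rewrite hE -/d3 -/w -/q /f /=; field; rewrite gt_eqF.
have PsiL s : Psi (s + L) = Psi s by rewrite /Psi KbL t3L G3L.
have gf0 s : g s = 0 -> f s = 0.
  move/eqP; rewrite /g !mulf_eq0 invr_eq0 sqrf_eq0 (gt_eqF (G0 s)) (gt_eqF (rho0 s)).
  by rewrite !orbF => /eqP.
have coef s : 0 <= (G3 s ^+ 2)^-1 * Num.sqrt (r2 s) by rewrite mulr_ge0 ?invr_ge0 ?sqr_ge0// ltW.
have [||e [e' [ee' ge]]] := sturm_two_arcs dth w0 thL dA dB AL BL gL dPsi PsiL h1.
- by move=> s /h2 fs; rewrite /g -mulrA mulr_le0_ge0.
- by move=> s /h3 fs; rewrite /g -mulrA mulr_ge0.
by apply: (@four_in_interval _ f L e e' ee') => s /ge/gf0.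
Qed.
End FourPoints.

(** * Changes of variables in Lebesgue integrals *)

Section WeightedPushforward.
Local Open Scope ereal_scope.
Context d1 d2 (X : measurableType d1) (Y : measurableType d2) (R : realType).
Variables (m : {measure set X -> \bar R}) (phi : X -> Y) (w : X -> R).
Hypotheses (mphi : measurable_fun setT phi) (mw : measurable_fun setT w).
Hypothesis w0 : forall x, (0 <= w x)%R.

(** The image under [phi] of the measure with density [w]. The hypotheses are
    arguments so that the measure structure can be inferred from the term. *)
Definition wpush (_ : measurable_fun setT phi) (_ : measurable_fun setT w)
  (_ : forall x, (0 <= w x)%R) (B : set Y) : \bar R := \int[m]_(x in phi @^-1` B) (w x)%:E.

Local Notation nu := (wpush mphi mw w0).

Let mpre B : measurable B -> measurable (phi @^-1` B).
Proof. by move=> mB; rewrite -[X in measurable X]setTI; exact: mphi. Qed.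

Let wpush0 : nu set0 = 0.
Proof. by rewrite /wpush preimage_set0 integral_set0. Qed.

Let wpush_ge0 B : 0 <= nu B.
Proof. by apply: integral_ge0 => x _; rewrite lee_fin. Qed.

Let wpush_sigma_additive : semi_sigma_additive nu.
Proof.
move=> /= B mB tB mUB; rewrite /wpush preimage_bigcup ge0_integral_bigcup//.
- apply: is_cvg_ereal_nneg_natsum_cond => n _ _.
  by apply: integral_ge0 => x _; rewrite lee_fin.
- by move=> n; exact: mpre.
- exact/measurable_EFinP/measurable_funTS.
- by move=> x _; rewrite lee_fin.
- apply/trivIsetP => i j _ _ ij; rewrite -preimage_setI.
  by move/trivIsetP : tB => ->//; rewrite preimage_set0.
Qed.

HB.instance Definition _ := isMeasure.Build _ _ _ nu wpush0 wpush_ge0 wpush_sigma_additive.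

Import HBNNSimple.

Let integral_wpush_indic (B : set Y) : measurable B ->
  \int[nu]_y (\1_B y)%:E = \int[m]_x (\1_B (phi x) * w x)%:E.
Proof.
move=> mB; rewrite integral_indic// setIT.
transitivity (\int[m]_(x in phi @^-1` B) (w x)%:E) => //; rewrite integral_mkcond.
apply: eq_integral => x _; rewrite patchE indicE.
have -> : (x \in phi @^-1` B) = (phi x \in B) by apply/idP/idP; rewrite !inE.
by case: (phi x \in B); rewrite ?mul1r ?mul0r.
Qed.

Lemma integral_wpush (F : Y -> \bar R) : measurable_fun setT F -> (forall y, 0 <= F y) ->
  \int[nu]_y F y = \int[m]_x (F (phi x) * (w x)%:E).
Proof.
move=> mF F0; pose h := nnsfun_approx measurableT mF.
have mwE : measurable_fun [set: X] (EFin \o w) by exact/measurable_EFinP.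
transitivity (limn (fun n => \int[nu]_y (h n y)%:E)).
  rewrite -monotone_convergence//.
  - by apply: eq_integral => y _; apply/esym/cvg_lim => //; exact: cvg_nnsfun_approx.
  - by move=> n; exact/measurable_EFinP.
  - by move=> n y _; rewrite lee_fin.
  - by move=> y _ a b ab; rewrite lee_fin; exact/lefP/nd_nnsfun_approx.
transitivity (limn (fun n => \int[m]_x ((h n (phi x))%:E * (w x)%:E))); last first.
  rewrite -monotone_convergence//.
  - apply: eq_integral => x _; apply/cvg_lim => //.
    by apply: cvgeZr => //; exact: cvg_nnsfun_approx.
  - move=> n; apply: emeasurable_funM => //; apply/measurable_EFinP.
    exact: measurableT_comp.
  - by move=> n x _; rewrite mule_ge0// lee_fin.
  - move=> x _ a b ab; rewrite lee_wpmul2r ?lee_fin//; exact/lefP/nd_nnsfun_approx.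
apply: congr_lim; apply/funext => n.
transitivity (\int[nu]_y (\sum_(r \in range (h n)) (r * \1_(h n @^-1` [set r]) y)%:E)).
  by apply: eq_integral => y _; rewrite /= fimfunE -fsumEFin.
rewrite ge0_integral_fsum//; last 2 first.
- by move=> r; apply/measurable_EFinP; exact: measurable_funM.
- by move=> r y _; exact: nnfun_muleindic_ge0.
have mi r : measurable_fun [set: X] (fun x => \1_(h n @^-1` [set r]) (phi x) : R).
  by apply: measurableT_comp.
transitivity (\int[m]_x (\sum_(r \in range (h n))
    (r * \1_(h n @^-1` [set r]) (phi x))%:E * (w x)%:E)); last first.
  apply: eq_integral => x _; rewrite -ge0_mule_fsuml.
    by rewrite fsumEFin// -(fimfunE _ (phi x)).
  by move=> r; exact: nnfun_muleindic_ge0.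
rewrite ge0_integral_fsum//; last 2 first.
- move=> r; apply: emeasurable_funM => //; apply/measurable_EFinP.
  exact: measurable_funM.
- by move=> r x _; apply: mule_ge0; [exact: nnfun_muleindic_ge0|rewrite lee_fin].
apply: eq_fsbigr => r _.
transitivity (r%:E * \int[nu]_y (\1_(h n @^-1` [set r]) y)%:E).
  exact: integralZl_indic_nnsfun.
rewrite integral_wpush_indic//.
have [r0|r0] := leP 0%R r.
  rewrite -ge0_integralZl//.
  - by apply: eq_integral => x _; rewrite -!EFinM mulrA.
  - by apply/measurable_EFinP; exact: measurable_funM.
  - by move=> x _; rewrite lee_fin mulr_ge0// indicE; case: (_ \in _).
rewrite !integral0_eq ?mule0// => x _; rewrite preimage_nnfun0// indic0 ?mulr0 ?mul0r ?mul0e//.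
Qed.

End WeightedPushforward.

(** The Lebesgue measure is determined by the lengths of half-open intervals, so
    it is the image under [phi] of the measure with density [w]. *)
Lemma change_of_variable (R : realType) (phi : R -> R) (w : R -> R) :
  measurable_fun setT phi -> measurable_fun setT w -> (forall x, 0 <= w x) ->
  (forall u v : R, u < v ->
    (\int[lebesgue_measure]_(x in phi @^-1` `]u, v]%classic) (w x)%:E = (v - u)%:E)%E) ->
  forall F : R -> \bar R, measurable_fun setT F -> (forall x, 0 <= F x)%E ->
  (\int[lebesgue_measure]_x F x = \int[lebesgue_measure]_x (F (phi x) * (w x)%:E))%E.
Proof.
move=> mphi mw w0 itvE F mF F0.
pose X := measurableTypeR R.
pose nu : {measure set X -> \bar R} := @wpush _ _ X X R lebesgue_measure phi w mphi mw w0.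
transitivity (\int[nu]_x F x)%E; last exact: (@integral_wpush _ _ X X R).
apply: eq_measure_integral => A mA _.
apply: (@lebesgue_measure_unique R nu) => // B [[u v] _ <-] /=.
rewrite lebesgue_measure_itv/=; case: ifPn => [|]; rewrite lte_fin => uv.
  by rewrite [RHS]itvE.
have -> : (`]u, v] = set0)%classic by apply: set_itv_ge; rewrite bnd_simp -leNgt leNgt.
by rewrite measure0.
Qed.

Section Substitutions.
Variable R : realType.
Notation mu := (@lebesgue_measure R).
Implicit Types (F : R -> \bar R).

Lemma integral_affine (a c : R) F : a != 0 ->
  measurable_fun setT F -> (forall x, 0 <= F x)%E ->
  (\int[mu]_x F x = `|a|%:E * \int[mu]_x F (a * x + c)%R)%E.
Proof.
move=> a0 mF F0.
have mphi : measurable_fun [set: R] (fun x => a * x + c).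
  by apply: measurable_funD => //; exact: measurable_funM.
rewrite (@change_of_variable R (fun x => a * x + c) (fun=> `|a|)) //; last first.
  move=> u v uv.
  have -> : (\int[mu]_(x in (fun x => a * x + c)%R @^-1` `]u, v]%classic) `|a|%:E =
      `|a|%:E * mu ((fun x => a * x + c)%R @^-1` `]u, v]%classic))%E.
    rewrite (integral_cst mu)//= -[X in measurable X]setTI; apply: mphi => //.
  have [a_gt|a_lt|] := ltgtP 0 a; last by move=> e; rewrite -e eqxx in a0.
    have -> : (fun x => a * x + c) @^-1` `]u, v]%classic = `](u - c) / a, (v - c) / a]%classic.
      apply/seteqP; split => x /=; rewrite !in_itv/= ltr_pdivrMr// ler_pdivlMr//;
        by rewrite ltrBlDr lerBrDr [x * a]mulrC.
    rewrite lebesgue_measure_itv/= lte_fin ltr_pM2r ?invr_gt0// ltrD2r uv.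
    by rewrite -EFinB -EFinM gtr0_norm//; congr EFin; field; rewrite gt_eqF.
  have -> : (fun x => a * x + c) @^-1` `]u, v]%classic = `[(v - c) / a, (u - c) / a[%classic.
    apply/seteqP; split => x /=; rewrite !in_itv/= ltr_ndivlMr// ler_ndivrMr//;
      by rewrite ltrBlDr lerBrDr [x * a]mulrC andbC.
  rewrite lebesgue_measure_itv/= lte_fin ltr_nM2r ?invr_lt0// ltrD2r uv.
  by rewrite -EFinB -EFinM ltr0_norm//; congr EFin; field; rewrite lt_eqF.
rewrite -ge0_integralZl//; first by apply: eq_integral => x _; rewrite muleC.
exact: measurableT_comp mF mphi.
Qed.

Let I : set R := `](- (pi / 2)), (pi / 2)[%classic.

Let cos0 y : I y -> 0 < cos y.
Proof. by rewrite /I/= => h; exact: cos_gt0_pihalf. Qed.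

Let ccos2V y : I y -> {for y, continuous (fun y => cos y ^- 2)}.
Proof.
move=> /cos0 c0; apply: dv_cont; apply: (@dvV _ (fun y => cos y ^+ 2)).
  by rewrite expf_neq0// gt_eqF.
exact: (dvM (is_derive_cos y) (is_derive_cos y)).
Qed.

Let mI : measurable I. Proof. exact: measurable_itv. Qed.

Lemma integral_tan F : measurable_fun setT F -> (forall x, 0 <= F x)%E ->
  (\int[mu]_(y in `](- (pi / 2))%R, (pi / 2)%R[%classic) F (tan y) =
   \int[mu]_x (F x * ((1 + x ^+ 2)^-1)%R%:E))%E.
Proof.
move=> mF F0; pose phi := tan \_ I; pose w := (fun y : R => (cos y) ^- 2) \_ I.
have mphi : measurable_fun [set: R] phi.
  apply/measurable_restrict => //; rewrite setTI.
  apply: open_continuous_measurable_fun => // y; rewrite inE => Iy.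
  by apply: dv_cont (is_derive_tan _); rewrite gt_eqF// cos0.
have mcos2 : measurable_fun I (fun y => (cos y) ^- 2).
  by apply: open_continuous_measurable_fun => // y; rewrite inE; exact: ccos2V.
have mw : measurable_fun [set: R] w by apply/measurable_restrict => //; rewrite setTI.
have w0 y : 0 <= w y by rewrite /w patchE; case: ifP => // _; rewrite invr_ge0 sqr_ge0.
have itvE (u v : R) : u < v -> (\int[mu]_(x in phi @^-1` `]u, v]%classic) (w x)%:E = (v - u)%:E)%E.
  move=> uv; have auv : atan u < atan v := lt_atan uv.
  have -> : (\int[mu]_(x in phi @^-1` `]u, v]%classic) (w x)%:E =
      \int[mu]_(x in `]atan u, atan v]%classic) ((cos x) ^- 2)%R%:E)%E.
    rewrite integral_mkcond [RHS]integral_mkcond; apply: eq_integral => x _.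
    rewrite !patchE /w patchE.
    have [xI|xI] := boolP (x \in I); last first.
      rewrite !if_same; case: ifP => // ; rewrite inE/= in_itv/= => /andP[x1 x2].
      case/negP: xI; rewrite inE /I/= in_itv/= (lt_trans (atan_gtNpi2 u) x1).
      by rewrite (le_lt_trans x2 (atan_ltpi2 v)).
    have xI' : x \in `](- (pi / 2)), (pi / 2)[ by move: xI; rewrite inE.
    congr (if _ then _ else _); apply/idP/idP; rewrite !inE /= /phi patchE xI !in_itv/=.
      move=> /andP[x1 x2]; rewrite -(tanK xI') lt_atan//.
      exact: le_atan.
    move=> /andP[x1 x2]; move: x1 x2; rewrite -{1 2}(tanK xI') => x1 x2; apply/andP; split.
      by rewrite ltNge; apply/negP => /le_atan; rewrite leNgt x1.
    by rewrite leNgt; apply/negP => /lt_atan; rewrite ltNge x2.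
  rewrite integral_itv_obnd_cbnd; last first.
    apply/measurable_EFinP; apply: measurable_funS mcos2 => // x /=.
    rewrite /I/= !in_itv/= => /andP[x1 x2].
    by rewrite (lt_le_trans (atan_gtNpi2 u) (ltW x1)) (le_lt_trans x2 (atan_ltpi2 v)).
  have sub x : atan u <= x <= atan v -> I x.
    move=> /andP[x1 x2]; rewrite /I/= in_itv/=.
    by rewrite (lt_le_trans (atan_gtNpi2 u) x1) (le_lt_trans x2 (atan_ltpi2 v)).
  have dtan x : I x -> has_deriv tan x ((cos x) ^- 2).
    by move=> /cos0 c0; apply: is_derive_tan; rewrite gt_eqF.
  rewrite (@continuous_FTC2 R _ tan)//.
  - by rewrite !atanK.
  - apply: continuous_in_subspaceT => x; rewrite inE/= in_itv/= => /sub.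
    exact: ccos2V.
  - split.
    + move=> x; rewrite in_itv/= => /andP[x1 x2].
      by case: (dtan x (sub x _)) => //; rewrite (ltW x1) (ltW x2).
    + apply: cvg_at_right_filter; apply: dv_cont (dtan _ (sub _ _)).
      by rewrite lexx (ltW auv).
    + apply: cvg_at_left_filter; apply: dv_cont (dtan _ (sub _ _)).
      by rewrite lexx (ltW auv).
  - move=> x; rewrite in_itv/= => /andP[x1 x2]; apply: dv_val; apply: dtan.
    by apply: sub; rewrite (ltW x1) (ltW x2).
have mden : measurable_fun [set: R] (fun x : R => (1 + x ^+ 2)^-1).
  apply: continuous_measurable_fun => x; apply: dv_cont.
  apply: (@dvV _ (fun x => 1 + x ^+ 2)); first by rewrite gt_eqF// ltr_pwDl// sqr_ge0.
  exact: (dvD (dv_cst 1 x) (dvM (dv_id x) (dv_id x))).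
rewrite [RHS](change_of_variable mphi mw w0 itvE); last 2 first.
- by apply: emeasurable_funM => //; exact/measurable_EFinP.
- by move=> x; rewrite mule_ge0// lee_fin invr_ge0 addr_ge0// sqr_ge0.
rewrite integral_mkcond; apply: eq_integral => y _.
rewrite patchE /phi /w !patchE; case: ifPn => yI; last by rewrite mule0.
have c0 : cos y != 0 by rewrite gt_eqF// cos0//; move: yI; rewrite inE.
rewrite -muleA -EFinM.
have -> : (1 + tan y ^+ 2)^-1 * (cos y) ^- 2 = 1.
  have -> : 1 + tan y ^+ 2 = (cos y ^+ 2 + sin y ^+ 2) / cos y ^+ 2.
    by rewrite /tan; field.
  by rewrite cos2Dsin2 mul1r invrK divff// expf_neq0.
by rewrite mule1.
Qed.

End Substitutions.

Section PlaneIntegrals.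
Variable R : realType.
Notation mu := (@lebesgue_measure R).
Local Notation RR := (measurableTypeR R).
Implicit Types (F : RR -> \bar R) (P : RR * RR -> \bar R).

Lemma measurable_lin (a b : R) :
  measurable_fun [set: RR * RR] (fun z => a * z.1 + b * z.2 : R).
Proof.
apply: measurable_funD; apply: measurable_funM => //.
Qed.

Lemma measurable_linmap (a b c d : R) :
  measurable_fun [set: RR * RR] (fun z => (a * z.1 + b * z.2, c * z.1 + d * z.2) : RR * RR).
Proof. by apply: measurable_fun_pair; exact: measurable_lin. Qed.

Lemma measurable_slice1 P x : measurable_fun setT P -> measurable_fun [set: RR] (fun y => P (x, y)).
Proof. by move=> mP; exact: (measurableT_comp mP (pair1_measurable x)). Qed.

Lemma measurable_slice2 P y : measurable_fun setT P -> measurable_fun [set: RR] (fun x => P (x, y)).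
Proof. by move=> mP; exact: (measurableT_comp mP (pair2_measurable y)). Qed.

Lemma integral_plane_swap P : measurable_fun setT P -> (forall z, 0 <= P z)%E ->
  (\int[mu]_x \int[mu]_y P (x, y) = \int[mu]_y \int[mu]_x P (x, y))%E.
Proof. by move=> mP P0; exact: fubini_tonelli. Qed.

Let shear P (c e : R) : e != 0 -> measurable_fun setT P -> (forall z, 0 <= P z)%E ->
  (\int[mu]_x \int[mu]_y P (x, y) = `|e|%:E * \int[mu]_x \int[mu]_y P (x, (c * x + e * y)%R))%E.
Proof.
move=> e0 mP P0; rewrite -ge0_integralZl//.
- apply: eq_integral => x _; rewrite (@integral_affine R e (c * x)) //.
    by congr (_ * _)%E; apply: eq_integral => y _; rewrite addrC.
  exact: measurable_slice1.
- have mQ : measurable_fun [set: RR * RR] (fun z => P (z.1, (c * z.1 + e * z.2)%R)).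
    apply: (measurableT_comp mP); apply: measurable_fun_pair => //; exact: measurable_lin.
  exact: (measurable_fun_fubini_tonelli_F _ mQ (fun z => P0 _)).
- by move=> x _; exact: integral_ge0.
Qed.

(** A linear map of the plane is a product of shears along the two axes, up to an
    exchange of the coordinates, so one-dimensional substitutions suffice. *)
Lemma integral_linear_plane P (a b c d : R) : a * d - b * c != 0 ->
  measurable_fun setT P -> (forall z, 0 <= P z)%E ->
  (\int[mu]_x \int[mu]_y P (x, y) =
   `|a * d - b * c|%:E * \int[mu]_x \int[mu]_y P ((a * x + b * y)%R, (c * x + d * y)%R))%E.
Proof.
move=> det0 mP P0.
pose Q (z : RR * RR) := P ((a * z.1 + b * z.2)%R, (c * z.1 + d * z.2)%R).
have mQ : measurable_fun setT Q := measurableT_comp mP (measurable_linmap a b c d).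
have Q0 z : (0 <= Q z)%E by exact: P0.
have Qint y : (0 <= \int[mu]_x Q (x, y))%E by exact: integral_ge0.
have mQint : measurable_fun [set: RR] (fun y => \int[mu]_x Q (x, y))%E.
  exact: (measurable_fun_fubini_tonelli_G _ mQ Q0).
transitivity (`|a * d - b * c|%:E * \int[mu]_y \int[mu]_x Q (x, y))%E; last first.
  by congr (_ * _)%E; rewrite -integral_plane_swap.
have [a0|a0] := eqVneq a 0.
  have [b0 c0] : b != 0 /\ c != 0.
    by move: det0; rewrite a0 mul0r sub0r oppr_eq0 mulf_eq0 negb_or => /andP[].
  rewrite (@integral_affine R b 0 (fun x => \int[mu]_y P (x, y)) b0)%E; last 2 first.
  - exact: (measurable_fun_fubini_tonelli_F _ mP P0).
  - by move=> x; exact: integral_ge0.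
  rewrite a0 mul0r sub0r normrN normrM EFinM -muleA; congr (_ * _)%E.
  rewrite -ge0_integralZl//; apply: eq_integral => y _.
  rewrite (@integral_affine R c (d * y)) //; last exact: measurable_slice1.
  by congr (_ * _)%E; apply: eq_integral => x _; rewrite /Q/= a0 mul0r add0r addr0.
pose e := d - b * c / a.
have eE : a * e = a * d - b * c by rewrite /e; field.
have e0 : e != 0 by move: det0; rewrite -eE mulf_eq0 negb_or => /andP[].
have mS : measurable_fun [set: RR * RR] (fun z => P (z.1, (c / a * z.1 + e * z.2)%R)).
  apply: (measurableT_comp mP); apply: measurable_fun_pair => //; exact: measurable_lin.
rewrite (shear (c / a) e0 mP P0) (integral_plane_swap mS (fun z => P0 _)).
have -> : `|a * d - b * c|%:E = (`|e|%:E * `|a|%:E)%E.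
  by rewrite -EFinM -normrM -eE mulrC.
rewrite -muleA; congr (_ * _)%E.
rewrite -ge0_integralZl//; apply: eq_integral => y _.
rewrite (@integral_affine R a (b * y)) //; last exact: (measurable_slice2 _ mS).
by congr (_ * _)%E; apply: eq_integral => x _; rewrite /Q/=; congr (P (_, _)); rewrite /e; field.
Qed.

End PlaneIntegrals.

(** * Rotation invariance of the spherical area *)

Section PeriodicIntegral.
Variable R : realType.
Notation mu := (@lebesgue_measure R).
Variable G : measurableTypeR R -> \bar R.
Hypotheses (mG : measurable_fun setT G) (G0 : forall x, (0 <= G x)%E).

Lemma integral_shift (a b c : R) :
  (\int[mu]_(x in `[(a + c)%R, (b + c)%R[%classic) G x = \int[mu]_(x in `[a, b[%classic) G (x + c)%R)%E.
Proof.
rewrite integral_mkcond [RHS]integral_mkcond.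
rewrite (@integral_affine R 1 c) ?oner_neq0//.
- rewrite normr1 mul1e; apply: eq_integral => x _; rewrite !patchE mul1r.
  congr (if _ then _ else _); apply/idP/idP; rewrite !inE/= !in_itv/=;
    by rewrite lerD2r ltrD2r.
- by apply/(measurable_restrict _ _ _).1 => //; exact: measurable_funTS.
- by move=> x; rewrite patchE; case: ifP.
Qed.

Lemma integral_split (a b c : R) : a <= b <= c ->
  (\int[mu]_(x in `[a, c[%classic) G x =
   \int[mu]_(x in `[a, b[%classic) G x + \int[mu]_(x in `[b, c[%classic) G x)%E.
Proof.
move=> /andP[ab bc]; rewrite -ge0_integral_setU//=.
- by rewrite -itv_bndbnd_setU// bnd_simp.
- exact: measurable_funTS.
- apply/disj_setPRL => u /=; rewrite !in_itv/= => /andP[bu _] /andP[_].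
  by rewrite ltNge bu.
Qed.

Lemma integral_period (T a b : R) : (forall x, G (x + T)%R = G x) -> a <= b <= a + T ->
  (\int[mu]_(x in `[a, (a + T)%R[%classic) G x = \int[mu]_(x in `[b, (b + T)%R[%classic) G x)%E.
Proof.
move=> GT /andP[ab baT].
rewrite (@integral_split a b (a + T)) ?ab// (@integral_split b (a + T) (b + T)) ?lerD2r ?ab ?baT//.
rewrite addeC; congr (_ + _)%E; rewrite integral_shift.
by apply: eq_integral => x _; rewrite GT.
Qed.

End PeriodicIntegral.

Section HomogeneousArea.
Variable R : realType.
Notation mu := (@lebesgue_measure R).
Local Notation RR := (measurableTypeR R).
Implicit Types chi : R -> R -> R -> R.

(** The integral over the sphere of a function that is constant on rays. *)
Definition ray_area chi : \bar R :=
  (\int[mu]_(theta in `[0%R, (2 * pi)%R]) \int[mu]_(phi in `[0%R, pi])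
    (sin phi * chi (sin phi * cos theta) (sin phi * sin theta) (cos phi))%R%:E)%E.

Definition ray_fun chi := [/\ measurable_fun [set: RR * RR * RR] (fun z => chi z.1.1 z.1.2 z.2 : RR),
  forall x y z, 0 <= chi x y z &
  forall r x y z, 0 < r -> chi (r * x) (r * y) (r * z) = chi x y z].

(** The density of the spherical area in the plane tangent at an end of the first
    axis. *)
Definition gnomonic_weight (t v : R) := (Num.sqrt (1 + t ^+ 2 + v ^+ 2)) ^- 3.

Lemma gnomonic_weight_ge0 t v : 0 <= gnomonic_weight t v.
Proof. by rewrite invr_ge0 exprn_ge0// sqrtr_ge0. Qed.

Section Fixed.
Variable chi : R -> R -> R -> R.
Hypothesis chiP : ray_fun chi.

Lemma measurable_ray_fun d (T : measurableType d) (f g h : T -> RR) : measurable_fun setT f ->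
  measurable_fun setT g -> measurable_fun setT h ->
  measurable_fun [set: T] (fun x => chi (f x) (g x) (h x) : RR).
Proof.
move=> mf mg mh; have [m _ _] := chiP.
exact: (measurableT_comp m (measurable_fun_pair (measurable_fun_pair mf mg) mh)).
Qed.

Let msin : measurable_fun [set: RR] (@sin R : RR -> RR).
Proof. by apply: continuous_measurable_fun; exact: continuous_sin. Qed.

Let mcos : measurable_fun [set: RR] (@cos R : RR -> RR).
Proof. by apply: continuous_measurable_fun; exact: continuous_cos. Qed.

Let cos_tan (y : R) : cos y != 0 -> 1 + tan y ^+ 2 = cos y ^- 2.
Proof.
move=> c0; have -> : 1 + tan y ^+ 2 = (cos y ^+ 2 + sin y ^+ 2) / cos y ^+ 2.
  by rewrite /tan; field.
by rewrite cos2Dsin2 mul1r.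
Qed.

Let cos_sqrt (y : R) : 0 < cos y -> Num.sqrt (1 + tan y ^+ 2) = (cos y)^-1.
Proof.
by move=> c0; rewrite cos_tan ?gt_eqF// -exprVn sqrtr_sqr ger0_norm// invr_ge0 ltW.
Qed.

(** The substitution [h = cot phi] along a meridian. *)
Lemma meridian_integral (c s : R) :
  (\int[mu]_(phi in `[0%R, pi]) (sin phi * chi (sin phi * c) (sin phi * s) (cos phi))%R%:E =
   \int[mu]_h (chi c s h * (Num.sqrt (1 + h ^+ 2)) ^- 3)%R%:E)%E.
Proof.
have [_ chi0 chiH] := chiP.
have p0 : 0 < pi :> R := pi_gt0 R.
pose F (h : RR) := (chi c s h * (Num.sqrt (1 + h ^+ 2))^-1)%:E.
have mF : measurable_fun setT F.
  apply/measurable_EFinP; apply: measurable_funM; first exact: measurable_ray_fun.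
  apply: continuous_measurable_fun => x; apply: dv_cont; apply: dvV.
    by rewrite gt_eqF// sqrt1D2_gt0.
  exact: (@dv_sqrt1D2 _ id _ _ (dv_id x)).
have F0 h : (0 <= F h)%E by rewrite lee_fin mulr_ge0// invr_ge0 sqrtr_ge0.
transitivity (\int[mu]_(y in `](- (pi / 2))%R, (pi / 2)%R[%classic) F (tan y))%E; last first.
  rewrite integral_tan//; apply: eq_integral => h _; rewrite -EFinM; congr EFin.
  rewrite -mulrA; congr (_ * _); rewrite -[X in _ * X^-1]sqr_sqrt1D2 -invfM -exprS//.
pose P (phi : RR) := (sin phi * chi (sin phi * c) (sin phi * s) (cos phi))%:E.
have mP : measurable_fun setT P.
  apply/measurable_EFinP; apply: measurable_funM => //.
  by apply: measurable_ray_fun => //; exact: measurable_funM.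
rewrite integral_mkcond (@integral_affine R (-1) (pi / 2)) ?oppr_eq0 ?oner_neq0//; last 2 first.
- by apply/(measurable_restrict _ _ _).1 => //; exact: measurable_funTS.
- move=> x; rewrite patchE; case: ifP => //; rewrite inE/= => x0.
  by rewrite lee_fin mulr_ge0// sin_ge0_pi.
rewrite normrN normr1 mul1e.
transitivity (\int[mu]_(y in `[(- (pi / 2))%R, (pi / 2)%R]%classic)
    (cos y * chi (cos y * c) (cos y * s) (sin y))%:E)%E.
  rewrite [RHS]integral_mkcond; apply: eq_integral => y _; rewrite !patchE.
  have -> : (-1 * y + pi / 2 \in `[0, pi]%classic) = (y \in `[(- (pi / 2)), (pi / 2)]%classic).
    by apply/idP/idP; rewrite !inE/= !in_itv/= => /andP[? ?]; apply/andP; split; lra.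
  by rewrite sinDpihalf cosDpihalf mulN1r cosN sinN opprK.
rewrite integral_itv_bndoo; last first.
  apply: measurable_funTS; apply/measurable_EFinP; apply: measurable_funM => //.
  by apply: measurable_ray_fun => //; exact: measurable_funM.
apply: eq_integral => y; rewrite inE/= => yI; have c0 := cos_gt0_pihalf yI.
rewrite /F cos_sqrt// invrK mulrC; congr (_ * _)%:E.
have -> : sin y = cos y * tan y by rewrite /tan mulrCA divff ?mulr1// gt_eqF.
by rewrite chiH.
Qed.

Let mcube : measurable_fun [set: RR] (fun u => (Num.sqrt (1 + u ^+ 2)) ^- 3 : RR).
Proof.
apply: continuous_measurable_fun => u; apply: dv_cont.
have dr := @dv_sqrt1D2 _ id u _ (dv_id u).
apply: (@dvV _ (fun v => Num.sqrt (1 + v ^+ 2) ^+ 3)).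
  by rewrite expf_neq0// gt_eqF// sqrt1D2_gt0.
exact: (dvM dr (dvM dr dr)).
Qed.

Lemma measurable_gnomonic_weight : measurable_fun [set: RR * RR] (fun z => gnomonic_weight z.1 z.2 : RR).
Proof.
have msq : measurable_fun [set: RR * RR] (fun z => Num.sqrt (z.1 ^+ 2 + z.2 ^+ 2) : RR).
  apply: (measurableT_comp (f := @Num.sqrt R)).
    by apply: continuous_measurable_fun; exact: sqrt_continuous.
  by apply: measurable_funD; apply: measurable_funX.
apply: (eq_measurable_fun _ _ (measurableT_comp mcube msq)) => z _ /=.
by rewrite /gnomonic_weight sqr_sqrtr ?addr_ge0 ?sqr_ge0// addrA.
Qed.

Let mweight t : measurable_fun [set: RR] (fun v => gnomonic_weight t v : RR).
Proof. exact: (measurableT_comp measurable_gnomonic_weight (pair1_measurable t)). Qed.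

(** The substitution [v = h sqrt (1 + t ^ 2)] passes from heights over the
    equator to a vertical line of the tangent plane. *)
Lemma gnomonic_slice (sigma t : R) :
  (\int[mu]_h (chi (sigma / Num.sqrt (1 + t ^+ 2)) (sigma * t / Num.sqrt (1 + t ^+ 2)) h *
     (Num.sqrt (1 + h ^+ 2)) ^- 3)%R%:E =
   (1 + t ^+ 2)%R%:E * \int[mu]_v (chi sigma (sigma * t) v * gnomonic_weight t v)%R%:E)%E.
Proof.
have [_ chi0 chiH] := chiP.
have := sqr_sqrt1D2 t; have := sqrt1D2_gt0 t; set r := Num.sqrt _ => r0 rE.
have rV : r^-1 != 0 by rewrite invr_eq0 gt_eqF.
pose F (h : RR) := (chi (sigma / r) (sigma * t / r) h * (Num.sqrt (1 + h ^+ 2)) ^- 3)%:E.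
have mF : measurable_fun setT F.
  by apply/measurable_EFinP; apply: measurable_funM => //; exact: measurable_ray_fun.
have F0 h : (0 <= F h)%E by rewrite lee_fin mulr_ge0// invr_ge0 exprn_ge0// sqrtr_ge0.
have maff : measurable_fun [set: RR] (fun x => r^-1 * x + 0 : RR).
  by apply: measurable_funD => //; exact: measurable_funM.
rewrite (@integral_affine R r^-1 0 F rV mF F0).
rewrite -!ge0_integralZl//; last 4 first.
- by apply/measurable_EFinP; apply: measurable_funM; [exact: measurable_ray_fun|exact: mweight].
- by move=> v _; rewrite lee_fin mulr_ge0// gnomonic_weight_ge0.
- by rewrite lee_fin addr_ge0// sqr_ge0.
- exact: (measurableT_comp mF maff).
apply: eq_integral => v _; rewrite /F -!EFinM addr0; congr EFin.
rewrite ger0_norm ?invr_ge0 ?(ltW r0)// [sigma / r]mulrC [sigma * t / r]mulrC chiH ?invr_gt0//.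
have -> : Num.sqrt (1 + (r^-1 * v) ^+ 2) = Num.sqrt (1 + t ^+ 2 + v ^+ 2) / r.
  have -> : 1 + (r^-1 * v) ^+ 2 = (1 + t ^+ 2 + v ^+ 2) * r ^- 2.
    by rewrite -rE; field; rewrite gt_eqF.
  by rewrite sqrtrM ?addr_ge0 ?sqr_ge0// -exprVn sqrtr_sqr ger0_norm// invr_ge0 ltW.
rewrite /gnomonic_weight -rE; field.
by rewrite (gt_eqF r0) gt_eqF// sqrtr_gt0 ltr_pwDl ?exprn_gt0// sqr_ge0.
Qed.

Let G (theta : RR) : \bar R :=
  (\int[mu]_h (chi (cos theta) (sin theta) h * (Num.sqrt (1 + h ^+ 2)) ^- 3)%R%:E)%E.

Let G0 theta : (0 <= G theta)%E.
Proof.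
have [_ chi0 _] := chiP.
by apply: integral_ge0 => h _; rewrite lee_fin mulr_ge0// invr_ge0 exprn_ge0// sqrtr_ge0.
Qed.

Let mG : measurable_fun setT G.
Proof.
have [_ chi0 _] := chiP.
pose P (z : RR * RR) := (chi (cos z.1) (sin z.1) z.2 * (Num.sqrt (1 + z.2 ^+ 2)) ^- 3)%:E.
apply: (@measurable_fun_fubini_tonelli_F _ _ _ _ R mu P).
  apply/measurable_EFinP; apply: measurable_funM.
    by apply: measurable_ray_fun; [exact: (measurableT_comp mcos)|exact: (measurableT_comp msin)|].
  exact: (measurableT_comp mcube).
by move=> z; rewrite lee_fin mulr_ge0// invr_ge0 exprn_ge0// sqrtr_ge0.
Qed.

Let GT theta : G (theta + 2 * pi) = G theta.
Proof. by rewrite /G cosD_turn sinD_turn. Qed.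

Let ray_areaE : ray_area chi = (\int[mu]_(theta in `[0%R, (2 * pi)%R[%classic) G theta)%E.
Proof.
rewrite /ray_area integral_itv_bndo_bndc; last exact: measurable_funTS.
by apply: eq_integral => theta _; exact: meridian_integral.
Qed.

Lemma ray_area_shift (alpha : R) : `|alpha| <= 2 * pi ->
  ray_area chi = (\int[mu]_(theta in `[0%R, (2 * pi)%R[%classic) G (theta + alpha)%R)%E.
Proof.
move=> al; rewrite ray_areaE -(integral_shift mG G0).
have p0 : 0 < pi :> R := pi_gt0 R.
move: al; rewrite ler_norml => /andP[a1 a2].
have [a0|a0] := leP 0 alpha.
  rewrite -[X in `[_, X[%classic]add0r (@integral_period _ G mG G0 _ 0 alpha) ?add0r ?a0//.
  by rewrite [(_ + alpha)%R]addrC.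
rewrite -[X in `[_, X[%classic]add0r -(@integral_period _ G mG G0 _ alpha 0) ?(ltW a0)//=.
  by rewrite add0r [(_ + alpha)%R]addrC.
by lra.
Qed.

Let mul_cancel (r : R) (x : \bar R) : r != 0 -> (r%:E * x * (r^-1)%R%:E = x)%E.
Proof. by move=> r0; rewrite muleAC -EFinM divff// mul1e. Qed.

(** The contribution of the vertical line over [(sigma, sigma t)] in the plane
    tangent at the end [sigma = 1] or [sigma = - 1] of the first axis. *)
Let half (sigma : R) (t : RR) : \bar R :=
  (\int[mu]_v (chi sigma (sigma * t) v * gnomonic_weight t v)%R%:E)%E.

Let half0 sigma t : (0 <= half sigma t)%E.
Proof.
have [_ chi0 _] := chiP.
by apply: integral_ge0 => v _; rewrite lee_fin mulr_ge0// gnomonic_weight_ge0.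
Qed.

Let mhalf sigma : measurable_fun setT (half sigma).
Proof.
have [_ chi0 _] := chiP.
pose P (z : RR * RR) := (chi sigma (sigma * z.1) z.2 * gnomonic_weight z.1 z.2)%:E.
apply: (@measurable_fun_fubini_tonelli_F _ _ _ _ R mu P).
  apply/measurable_EFinP; apply: measurable_funM; last exact: measurable_gnomonic_weight.
  by apply: measurable_ray_fun => //; exact: measurable_funM.
by move=> z; rewrite lee_fin mulr_ge0// gnomonic_weight_ge0.
Qed.

Let G_half (sigma theta : R) : 0 < cos theta ->
  (\int[mu]_h (chi (sigma * cos theta) (sigma * sin theta) h *
     (Num.sqrt (1 + h ^+ 2)) ^- 3)%R%:E =
   (1 + tan theta ^+ 2)%R%:E * half sigma (tan theta))%E.
Proof.
move=> c0; rewrite /half -gnomonic_slice cos_sqrt//; apply: eq_integral => h _.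
rewrite !invrK -mulrA; congr (chi _ (_ * _) _ * _)%:E.
by rewrite /tan divfK// gt_eqF.
Qed.

Let G_itv (sigma : R) :
  (\int[mu]_(theta in `[(- (pi / 2))%R, (pi / 2)%R[%classic)
    \int[mu]_h (chi (sigma * cos theta) (sigma * sin theta) h *
     (Num.sqrt (1 + h ^+ 2)) ^- 3)%R%:E = \int[mu]_t half sigma t)%E.
Proof.
have [_ chi0 _] := chiP.
pose F (t : RR) := ((1 + t ^+ 2)%R%:E * half sigma t)%E.
have mF : measurable_fun setT F.
  apply: emeasurable_funM; last exact: mhalf.
  apply/measurable_EFinP; apply: measurable_funD => //; exact: measurable_funX.
have F0 t : (0 <= F t)%E by rewrite mule_ge0// lee_fin addr_ge0// sqr_ge0.
transitivity (\int[mu]_(y in `](- (pi / 2))%R, (pi / 2)%R[%classic) F (tan y))%E; last first.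
  rewrite (integral_tan mF F0); apply: eq_integral => t _; rewrite /F mul_cancel//.
  by rewrite gt_eqF// ltr_pwDl// sqr_ge0.
pose P (z : RR * RR) := (chi (sigma * cos z.1) (sigma * sin z.1) z.2 * (Num.sqrt (1 + z.2 ^+ 2)) ^- 3)%:E.
have mP : measurable_fun setT (fubini_F mu P).
  apply: measurable_fun_fubini_tonelli_F.
    apply/measurable_EFinP; apply: measurable_funM.
      by apply: measurable_ray_fun; [apply: measurable_funM; [|exact: (measurableT_comp mcos)]
        |apply: measurable_funM; [|exact: (measurableT_comp msin)]|].
    exact: (measurableT_comp mcube).
  by move=> z; rewrite lee_fin mulr_ge0// invr_ge0 exprn_ge0// sqrtr_ge0.
rewrite integral_itv_bndoo; last exact: (measurable_funTS mP).
by apply: eq_integral => theta; rewrite inE/= => /cos_gt0_pihalf c0; exact: G_half.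
Qed.

(** Central projection onto the planes tangent to the sphere at the two ends of
    the first axis. *)
Lemma ray_area_gnomonic : ray_area chi =
  (\int[mu]_t \int[mu]_v ((chi 1 t v + chi (-1) t v) * gnomonic_weight t v)%R%:E)%E.
Proof.
have [_ chi0 chiH] := chiP.
have p0 : 0 < pi :> R := pi_gt0 R.
transitivity (\int[mu]_t half 1 t + \int[mu]_t half (-1) t)%E; last first.
  have N1 : (-1 : R) != 0 by rewrite oppr_eq0 oner_neq0.
  rewrite (@integral_affine R (-1) 0 (half (-1)) N1 (mhalf _) (half0 _)).
  pose f2 (t : RR) := half (-1) (-1 * t + 0)%R.
  have f20 t : (0 <= f2 t)%E by exact: half0.
  have mflip : measurable_fun [set: RR] (fun t => -1 * t + 0 : RR).
    by apply: measurable_funD; [exact: measurable_funM|].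
  have mf2 : measurable_fun setT f2 := measurableT_comp (mhalf (-1)) mflip.
  rewrite normrN normr1 mul1e.
  rewrite -(ge0_integralD mu measurableT (fun t _ => half0 1 t) (mhalf 1) (fun t _ => f20 t) mf2).
  apply: eq_integral => t _.
  pose h (sigma u : R) (v : RR) := (chi sigma (sigma * u) v * gnomonic_weight u v)%:E.
  have h0 sigma u v : (0 <= h sigma u v)%E by rewrite lee_fin mulr_ge0// gnomonic_weight_ge0.
  have mh sigma u : measurable_fun setT (h sigma u).
    by apply/measurable_EFinP; apply: measurable_funM; [exact: measurable_ray_fun|exact: mweight].
  transitivity (\int[mu]_v (h 1%R t v + h (-1)%R (-1 * t + 0)%R v))%E.
    exact/esym/(ge0_integralD mu measurableT (fun v _ => h0 1 t v) (mh 1 t)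
      (fun v _ => h0 (-1) (-1 * t + 0) v) (mh (-1) (-1 * t + 0))).
  apply: eq_integral => v _; rewrite /h -EFinD mulrDl mul1r; congr (_ + _ * _)%:E.
    by congr (chi _ _ _); ring.
  by rewrite /gnomonic_weight; congr (Num.sqrt _ ^- 3); ring.
rewrite ray_areaE -[X in `[_, X[%classic]add0r.
rewrite -(@integral_period _ G mG G0 _ (- (pi / 2)) 0 GT); last by apply/andP; split; lra.
rewrite (@integral_split _ G mG G0 _ (pi / 2)); last by apply/andP; split; lra.
have e1 : (\int[mu]_(x in `[(- (pi / 2))%R, (pi / 2)%R[%classic) G x = \int[mu]_t half 1 t)%E.
  rewrite -(G_itv 1); apply: eq_integral => theta _.
  by apply: eq_integral => h _; rewrite !mul1r.
have e2 : (\int[mu]_(x in `[(pi / 2)%R, (- (pi / 2) + 2 * pi)%R[%classic) G x =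
    \int[mu]_t half (-1) t)%E.
  have h1 : - (pi / 2) + 2 * pi = pi / 2 + pi :> R by field.
  have h2 : pi / 2 = - (pi / 2) + pi :> R by field.
  rewrite h1 [X in `[X, _[%classic]h2 (integral_shift mG G0) -(G_itv (-1)).
  apply: eq_integral => theta _; rewrite /G cosDpi sinDpi.
  by apply: eq_integral => h _; rewrite !mulN1r.
by rewrite e1 e2.
Qed.

End Fixed.
End HomogeneousArea.

Section Rotations.
Variable R : realType.
Notation mu := (@lebesgue_measure R).
Local Notation RR := (measurableTypeR R).
Variable chi : R -> R -> R -> R.
Hypothesis chiP : ray_fun chi.

Lemma ray_fun_linear (a1 a2 a3 b1 b2 b3 c1 c2 c3 : R) :
  ray_fun (fun x y z => chi (a1 * x + a2 * y + a3 * z) (b1 * x + b2 * y + b3 * z)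
    (c1 * x + c2 * y + c3 * z)).
Proof.
have mlin (u1 u2 u3 : R) : measurable_fun [set: RR * RR * RR]
    (fun w => u1 * w.1.1 + u2 * w.1.2 + u3 * w.2 : RR).
  have m11 : measurable_fun [set: RR * RR * RR] (fun w => w.1.1 : RR).
    by apply: (measurableT_comp (f := fst)) => //; exact: measurable_fst.
  have m12 : measurable_fun [set: RR * RR * RR] (fun w => w.1.2 : RR).
    by apply: (measurableT_comp (f := snd)) => //; exact: measurable_snd.
  by apply: measurable_funD; [apply: measurable_funD|]; apply: measurable_funM.
have [_ chi0 chiH] := chiP; split => [|x y z|r x y z r0]; last 2 first.
- exact: chi0.
- by rewrite -[RHS](chiH r)//; congr chi; ring.
exact: (measurable_ray_fun chiP (mlin _ _ _) (mlin _ _ _) (mlin _ _ _)).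
Qed.

Lemma ray_area_rotation_z (alpha : R) : `|alpha| <= 2 * pi ->
  ray_area (fun x y z => chi (x * cos alpha - y * sin alpha) (x * sin alpha + y * cos alpha) z) =
  ray_area chi.
Proof.
move=> al; have p0 : 0 < pi :> R := pi_gt0 R.
set chi' := (X in ray_area X = _).
have chi'P : ray_fun chi'.
  have := ray_fun_linear (cos alpha) (- sin alpha) 0 (sin alpha) (cos alpha) 0 0 0 1.
  congr ray_fun; apply/funext => x; apply/funext => y; apply/funext => z.
  by rewrite /chi'; congr chi; ring.
have al0 : `|0 : R| <= 2 * pi by rewrite normr0 mulr_ge0// ltW.
rewrite (ray_area_shift chi'P al0) (ray_area_shift chiP al).
apply: eq_integral => theta _; apply: eq_integral => h _.
by rewrite /chi' addr0 cosD sinD; congr (chi _ _ _ * _)%:E; ring.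
Qed.

(** In the planes tangent at the ends of the first axis the map is a linear
    isometry, and the density depends only on the distance from the origin. *)
Lemma ray_area_rotation_x (a b c d : R) :
  a ^+ 2 + c ^+ 2 = 1 -> b ^+ 2 + d ^+ 2 = 1 -> a * b + c * d = 0 ->
  ray_area (fun x y z => chi x (a * y + b * z) (c * y + d * z)) = ray_area chi.
Proof.
move=> ac bd abcd; have [_ chi0 _] := chiP.
set chi' := (X in ray_area X = _).
have chi'P : ray_fun chi'.
  have := ray_fun_linear 1 0 0 0 a b 0 c d.
  congr ray_fun; apply/funext => x; apply/funext => y; apply/funext => z.
  by rewrite /chi'; congr chi; ring.
have det2 : (a * d - b * c) ^+ 2 = 1.
  transitivity ((a ^+ 2 + c ^+ 2) * (b ^+ 2 + d ^+ 2) - (a * b + c * d) ^+ 2); first by ring.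
  by rewrite ac bd abcd; ring.
have det0 : a * d - b * c != 0 by apply/eqP => e; move: det2; rewrite e expr0n/= => /eqP; rewrite eq_sym oner_eq0.
have det1 : `|a * d - b * c| = 1.
  by apply/eqP; rewrite -(@eqrXn2 _ 2)// expr1n real_normK ?num_real// det2.
pose P (z : RR * RR) := ((chi 1 z.1 z.2 + chi (-1) z.1 z.2) * gnomonic_weight z.1 z.2)%:E.
have mP : measurable_fun setT P.
  apply/measurable_EFinP; apply: measurable_funM; last exact: measurable_gnomonic_weight.
  by apply: measurable_funD; apply: (measurable_ray_fun chiP).
have P0 z : (0 <= P z)%E by rewrite lee_fin mulr_ge0 ?addr_ge0// gnomonic_weight_ge0.
rewrite (ray_area_gnomonic chiP) (ray_area_gnomonic chi'P).
transitivity (\int[mu]_t \int[mu]_v P (t, v))%E; last by [].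
rewrite (integral_linear_plane det0 mP P0) det1 mul1e.
apply: eq_integral => t _; apply: eq_integral => v _; rewrite /P /chi'/=.
congr (_ * _)%:E; rewrite /gnomonic_weight; congr (Num.sqrt _ ^- 3).
transitivity (1 + (a ^+ 2 + c ^+ 2) * t ^+ 2 + (b ^+ 2 + d ^+ 2) * v ^+ 2 + 2 * (a * b + c * d) * t * v).
  by rewrite ac bd abcd; ring.
by ring.
Qed.

End Rotations.

(** * Measurability of open sets in space *)

Section BoxNeighbourhoods.
Variable R : realType.
Local Notation RR := (measurableTypeR R).

(** A set that contains a box around each of its points is a countable union of
    boxes with rational ends. *)
Lemma measurable_box_open (S : set (RR * RR * RR)) :
  (forall z, S z -> exists2 e : R, 0 < e & forall x y w : R,
     `|z.1.1 - x| < e -> `|z.1.2 - y| < e -> `|z.2 - w| < e -> S (x, y, w)) ->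
  measurable S.
Proof.
move=> Sopen.
pose itv (q : rat * rat) : set RR := `](ratr q.1 : R), (ratr q.2 : R)[%classic.
pose box (q : rat * rat * (rat * rat) * (rat * rat)) : set (RR * RR * RR) :=
  itv q.1.1 `*` itv q.1.2 `*` itv q.2.
pose F q := if pselect (box q `<=` S) then box q else set0.
have -> : S = \bigcup_q F q.
  apply/seteqP; split => [[[x y] w] Sz|z [q _]]; last by rewrite /F; case: pselect => // sub /sub.
  have [e e0 he] := Sopen _ Sz.
  have near_itv (u : R) : exists q : rat * rat, [/\ itv q u & forall v, itv q v -> `|u - v| < e].
    have [l] := @rat_in_itvoo R (u - e) u ltac:(lra).
    have [r] := @rat_in_itvoo R u (u + e) ltac:(lra).
    rewrite !in_itv/= => /andP[r1 r2] /andP[l1 l2].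
    exists (l, r); split; first by rewrite /itv/= in_itv/= l2.
    move=> v; rewrite /itv/= in_itv/= => /andP[v1 v2].
    by rewrite ltr_distlC; apply/andP; split; lra.
  have [q1 [h1 k1]] := near_itv x; have [q2 [h2 k2]] := near_itv y.
  have [q3 [h3 k3]] := near_itv w.
  exists (q1, q2, q3) => //; rewrite /F; case: pselect => [sub|[]]; first by split => //; split.
  by move=> -[[x' y'] w'] [[/= /k1 a1 /k2 a2] /k3 a3]; exact: he.
apply: countable_bigcupT_measurable; first exact: countableP.
move=> q; rewrite /F; case: pselect => [sub|nsub]; last exact: measurable0.
have mi p : measurable (itv p) by exact: measurable_itv.
exact: (measurableX (measurableX (mi _) (mi _)) (mi _)).
Qed.

End BoxNeighbourhoods.

(** * Euclidean structure of space *)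

Section EuclideanVectors.
Variable R : realType.
Local Notation V := 'rV[R]_3.
Implicit Types u v w : V.

Definition vec3 (x y z : R) : V := \row_(i < 3) [:: x; y; z]`_i.

Lemma dotC u v : dot u v = dot v u.
Proof. by apply: eq_bigr => i _; rewrite mulrC. Qed.

Lemma dotDl u v w : dot (u + v) w = dot u w + dot v w.
Proof. by rewrite -big_split; apply: eq_bigr => i _; rewrite mxE mulrDl. Qed.

Lemma dotZl (a : R) u w : dot (a *: u) w = a * dot u w.
Proof. by rewrite /dot mulr_sumr; apply: eq_bigr => i _; rewrite mxE mulrA. Qed.

Lemma dotDr u v w : dot w (u + v) = dot w u + dot w v.
Proof. by rewrite !(dotC w) dotDl. Qed.

Lemma dotZr (a : R) u w : dot w (a *: u) = a * dot w u.
Proof. by rewrite !(dotC w) dotZl. Qed.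

Lemma dotNl u w : dot (- u) w = - dot u w.
Proof. by rewrite -scaleN1r dotZl mulN1r. Qed.

Lemma dotNr u w : dot w (- u) = - dot w u.
Proof. by rewrite !(dotC w) dotNl. Qed.

Lemma dot0l w : dot 0 w = 0.
Proof. by rewrite -(scale0r w) dotZl mul0r. Qed.

Lemma dot_ge0 u : 0 <= dot u u.
Proof. by apply: sumr_ge0 => i _; rewrite -expr2 sqr_ge0. Qed.

Lemma dot_eq0 u : dot u u = 0 -> u = 0.
Proof.
move=> /eqP; rewrite psumr_eq0 => [/allP h|i _]; last by rewrite -expr2 sqr_ge0.
apply/rowP => i; rewrite mxE; apply/eqP.
by have := h i (mem_index_enum _); rewrite -expr2 sqrf_eq0.
Qed.

Lemma dot_gt0 u : u != 0 -> 0 < dot u u.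
Proof.
move=> u0; rewrite lt_neqAle dot_ge0 andbT eq_sym; apply/eqP => /dot_eq0 e.
by rewrite e eqxx in u0.
Qed.

Lemma dot_vec3 x y z x' y' z' : dot (vec3 x y z) (vec3 x' y' z') = x * x' + y * y' + z * z'.
Proof. by rewrite /dot !big_ord_recr big_ord0 /= !mxE /= add0r. Qed.

Lemma vec3E u : exists x y z, u = vec3 x y z.
Proof.
exists (u ord0 (inord 0)), (u ord0 (inord 1)), (u ord0 (inord 2)).
apply/rowP => i; rewrite mxE; case: i => [[|[|[|//]]] h] /=; congr (u _ _); apply: val_inj;
  by rewrite /= inordK.
Qed.

Lemma orthonormal_expansion (a b c : V) : dot a a = 1 -> dot b b = 1 -> dot c c = 1 ->
  dot a b = 0 -> dot a c = 0 -> dot b c = 0 ->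
  forall u, u = dot u a *: a + dot u b *: b + dot u c *: c.
Proof.
move=> aa bb cc ab ac bc u.
pose M : 'M[R]_3 := \matrix_(i < 3, j < 3) [:: a; b; c]`_i ord0 j.
have MM : M *m M^T = 1%:M.
  apply/matrixP => i j; rewrite !mxE.
  transitivity (dot [:: a; b; c]`_i [:: a; b; c]`_j).
    by apply: eq_bigr => k _; rewrite !mxE.
  by case: i => [[|[|[|//]]] hi]; case: j => [[|[|[|//]]] hj] //=; rewrite ?aa ?bb ?cc ?ab ?ac ?bc // dotC.
have {}MM := mulmx1C MM.
rewrite -{1}[u]mulmx1 -MM mulmxA; apply/rowP => j.
rewrite mxE !big_ord_recr big_ord0 /= add0r !mxE /=.
by congr (_ * _ + _ * _ + _ * _); apply: eq_bigr => k _; rewrite !mxE.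
Qed.

Let dotE : exists i j k : 'I_3, forall u v,
  dot u v = u ord0 i * v ord0 i + u ord0 j * v ord0 j + u ord0 k * v ord0 k.
Proof. by do 3 eexists; move=> u v; rewrite /dot !big_ord_recr big_ord0 /= add0r. Qed.

Lemma continuous_dot w : continuous (dot w).
Proof.
have [i [j [k e]]] := dotE.
have cm l : continuous (fun u : V => w ord0 l * u ord0 l).
  by move=> u; exact: (cvgM (cvg_cst _) (@coord_continuous _ _ _ ord0 l u)).
rewrite (_ : dot w = fun u => w ord0 i * u ord0 i + w ord0 j * u ord0 j + w ord0 k * u ord0 k).
  by move=> u; exact: (cvgD (cvgD (cm i u) (cm j u)) (cm k u)).
by apply/funext => u; rewrite e.
Qed.

Lemma continuous_dot2 : continuous (fun u : V => dot u u).
Proof.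
have [i [j [k e]]] := dotE.
have cm l : continuous (fun u : V => u ord0 l * u ord0 l).
  by move=> u; exact: (cvgM (@coord_continuous _ _ _ ord0 l u) (@coord_continuous _ _ _ ord0 l u)).
rewrite (_ : (fun u : V => dot u u) =
  fun u => u ord0 i * u ord0 i + u ord0 j * u ord0 j + u ord0 k * u ord0 k).
  by move=> u; exact: (cvgD (cvgD (cm i u) (cm j u)) (cm k u)).
by apply/funext => u; rewrite e.
Qed.

Lemma dv_dot w (f : R -> V) s : derivable f s 1 ->
  has_deriv (fun s => dot w (f s)) s (dot w (derive1 f s)).
Proof.
move=> df; have dfi := (derivable_mxP f s 1).1 df.
have di i : has_deriv (fun s => w ord0 i * f s ord0 i) s (w ord0 i * derive1 f s ord0 i).
  apply: dv_eq.
    apply: dvM; first exact: dv_cst.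
    exact: derivableP (dfi ord0 i).
  by rewrite mulr0 addr0 derive1E derive_mx// mxE.
have h : is_derive s 1 (\sum_(i < 3) (fun s => w ord0 i * f s ord0 i))
  (\sum_(i < 3) w ord0 i * derive1 f s ord0 i) by exact: is_derive_sum.
by apply: dv_fun h => x; rewrite fct_sumE.
Qed.

Lemma dv_dot2 (f g : R -> V) s : derivable f s 1 -> derivable g s 1 ->
  has_deriv (fun s => dot (f s) (g s)) s (dot (derive1 f s) (g s) + dot (f s) (derive1 g s)).
Proof.
move=> df dg; have dfi := (derivable_mxP f s 1).1 df; have dgi := (derivable_mxP g s 1).1 dg.
have di i : has_deriv (fun s => f s ord0 i * g s ord0 i) s
    (derive1 f s ord0 i * g s ord0 i + f s ord0 i * derive1 g s ord0 i).
  apply: dv_eq.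
    by apply: dvM; [exact: derivableP (dfi ord0 i)|exact: derivableP (dgi ord0 i)].
  by rewrite !derive1E (derive_mx df) (derive_mx dg) !mxE addrC [X in X + _]mulrC.
have h : is_derive s 1 (\sum_(i < 3) (fun s => f s ord0 i * g s ord0 i))
  (\sum_(i < 3) (derive1 f s ord0 i * g s ord0 i + f s ord0 i * derive1 g s ord0 i)).
  exact: is_derive_sum.
rewrite /dot -big_split; apply: dv_fun h => x; rewrite fct_sumE//.
Qed.

End EuclideanVectors.

(** * The cone over a convex domain *)

Section Cone.
Variables (R : realType) (D : set 'rV[R]_3) (q : 'rV[R]_3).
Local Notation V := 'rV[R]_3.
Hypothesis Dq : D `<=` open_hemisphere q.
Hypothesis Dopen : exists2 U : set V, open U & D = U `&` @sphere R.
Hypothesis Dconv : geodesically_convex D.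
Implicit Types x y v w : V.

Definition cone (C : set V) (v : V) : Prop := exists2 r : R, 0 < r & C (r *: v).

Lemma coneZ r v : 0 < r -> cone D v -> cone D (r *: v).
Proof.
move=> r0 [r' r'0 Dv]; exists (r' / r); first exact: divr_gt0.
by rewrite scalerA divfK// gt_eqF.
Qed.

Lemma in_cone x : D x -> cone D x.
Proof. by move=> Dx; exists 1; rewrite ?scale1r. Qed.

Lemma domain_unit x : D x -> dot x x = 1.
Proof. by move=> /Dq[]. Qed.

Lemma cone_sphere x : dot x x = 1 -> cone D x -> D x.
Proof.
move=> x1 [r r0 Dx]; have := domain_unit Dx; rewrite dotZl dotZr x1 mulr1 => /eqP.
rewrite -expr2 sqrf_eq1 => /orP[/eqP r1|/eqP r1]; last by move: r0; rewrite r1 ltr0N1.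
by move: Dx; rewrite r1 scale1r.
Qed.

Lemma cone_pos x : cone D x -> 0 < dot q x.
Proof. by move=> [r r0 /Dq[_]]; rewrite dotZr pmulr_rgt0. Qed.

Lemma cone_neq0 x : cone D x -> x != 0.
Proof.
move=> /cone_pos h; apply/eqP => e; move: h; rewrite e dotC dot0l ltxx//.
Qed.

(** The normalization of a positive combination lies on the shortest geodesic
    segment from [x] to [y]. *)
Let cone_comb x y (a b : R) : D x -> D y -> 0 < a -> 0 < b -> cone D (a *: x + b *: y).
Proof.
move=> Dx Dy a0 b0; have xx := domain_unit Dx; have yy := domain_unit Dy.
pose c := dot x y; pose z := y - c *: x.
have xz : dot x z = 0 by rewrite dotDr dotNr dotZr xx mulr1 subrr.
have zz : dot z z = 1 - c ^+ 2.
  by rewrite {1}/z dotDl dotNl dotZl xz mulr0 subr0 /z dotDr dotNr dotZr yy (dotC y) expr2.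
have [z0|z0] := eqVneq z 0.
  have yE : y = c *: x by apply/eqP; rewrite -subr_eq0; apply/eqP.
  have c0 : 0 < c.
    have := cone_pos (in_cone Dy); rewrite yE dotZr pmulr_lgt0//.
    exact: cone_pos (in_cone Dx).
  by rewrite yE scalerA -scalerDl; apply: coneZ; [rewrite addr_gt0 ?mulr_gt0|exact: in_cone].
have z2 : 0 < 1 - c ^+ 2 by rewrite -zz dot_gt0.
have c1 : -1 <= c <= 1 by apply/andP; split; nra.
pose sl := Num.sqrt (1 - c ^+ 2).
have sl0 : 0 < sl by rewrite sqrtr_gt0.
have sl2 : sl ^+ 2 = 1 - c ^+ 2 by rewrite sqr_sqrtr// ltW.
pose v := sl^-1 *: z.
have vv : dot v v = 1.
  by rewrite dotZl dotZr zz -sl2; field; rewrite gt_eqF.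
have xv : dot x v = 0 by rewrite dotZr xz mulr0.
have cl : cos (acos c) = c by rewrite acosK// in_itv.
have sinl : sin (acos c) = sl by rewrite sin_acos.
have lpi : 0 <= acos c <= pi by rewrite acos_ge0//= acos_lepi.
have gy : geodesic x v (acos c) = y.
  by rewrite /geodesic cl sinl /v scalerA divff ?gt_eqF// scale1r /z addrC subrK.
pose w := a *: x + b *: y.
have w0 : w != 0.
  apply/eqP => e; have : dot q w = 0 by rewrite e dotC dot0l.
  rewrite dotDr !dotZr; have := cone_pos (in_cone Dx); have := cone_pos (in_cone Dy); nra.
pose r := Num.sqrt (dot w w).
have r0 : 0 < r by rewrite sqrtr_gt0 dot_gt0.
have r2 : r ^+ 2 = (a + b * c) ^+ 2 + (b * sl) ^+ 2.
  rewrite sqr_sqrtr ?dot_ge0// /w !dotDl !dotDr !dotZl !dotZr xx yy (dotC y) -/c.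
  by rewrite exprMn sl2; ring.
pose u := (a + b * c) / r.
have u2 : u ^+ 2 + (b * sl / r) ^+ 2 = 1.
  by rewrite /u !expr_div_n -mulrDl -r2 divff// expf_neq0// gt_eqF.
have bs0 : 0 < b * sl / r by rewrite divr_gt0// mulr_gt0.
have u1 : -1 <= u <= 1 by apply/andP; split; nra.
have cosu : cos (acos u) = u by rewrite acosK// in_itv.
have sinu : sin (acos u) = b * sl / r.
  rewrite sin_acos//; have -> : 1 - u ^+ 2 = (b * sl / r) ^+ 2 by rewrite -u2; ring.
  by rewrite sqrtr_sqr gtr0_norm.
exists r^-1; first by rewrite invr_gt0.
have -> : r^-1 *: w = geodesic x v (acos u).
  rewrite /geodesic cosu sinu /v /z /w !scalerDr !scalerN !scalerA.
  have -> : b * sl / r * sl^-1 = r^-1 * b by field; rewrite (gt_eqF r0) (gt_eqF sl0).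
  rewrite /u mulrDl scalerDl addrACA [(b * c / r) *: x + _]addrC.
  by rewrite -[in RHS]addrA [b * c / r]mulrC mulrA addNr addr0 [a / r]mulrC.
apply: (Dconv Dx vv xv lpi); first by rewrite gy.
rewrite acos_ge0//= leNgt; apply/negP => lt.
have : 0 <= sin (acos u - acos c).
  apply: sin_ge0_pi; have := acos_lepi u1; have := acos_ge0 c1.
  by move=> *; apply/andP; split; lra.
rewrite sinB cosu sinu cl sinl.
have -> : b * sl / r * c - u * sl = - (a * sl / r) by rewrite /u; ring.
by rewrite oppr_ge0 leNgt divr_gt0// mulr_gt0.
Qed.

Lemma coneD x y : cone D x -> cone D y -> cone D (x + y).
Proof.
move=> [r r0 Dx] [r' r'0 Dy].
have -> : x + y = r^-1 *: (r *: x) + r'^-1 *: (r' *: y).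
  by rewrite !scalerA !mulVf ?gt_eqF// !scale1r.
by apply: cone_comb; rewrite ?invr_gt0.
Qed.

Lemma cone_near v : cone D v -> \forall w \near v, cone D w.
Proof.
move=> [r r0 Dv]; have [U oU DE] := Dopen.
have v0 : v != 0 by apply: cone_neq0; exists r.
have vv0 : 0 < dot v v by rewrite dot_gt0.
pose phi w : V := (Num.sqrt (dot w w))^-1 *: w.
have phiv : phi v = r *: v.
  rewrite /phi; congr (_ *: _); have := domain_unit Dv; rewrite dotZl dotZr mulrA => e.
  have -> : dot v v = r^-1 ^+ 2.
    have rn : r ^+ 2 != 0 by rewrite expf_neq0// gt_eqF.
    by apply: (mulfI rn); rewrite exprVn mulfV// expr2.
  by rewrite sqrtr_sqr gtr0_norm ?invr_gt0// invrK.
have csq : (fun w => Num.sqrt (dot w w)) @ v --> Num.sqrt (dot v v).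
  exact: (continuous_comp (@continuous_dot2 R v) (@sqrt_continuous R _)).
have sv0 : Num.sqrt (dot v v) != 0 by rewrite gt_eqF// sqrtr_gt0.
have cphi : phi @ v --> phi v by exact: (cvgZ (cvgV sv0 csq) cvg_id).
have Uphi : U (phi v) by rewrite phiv; move: Dv; rewrite DE => -[].
have n1 : \forall w \near v, U (phi w) := cphi _ (open_nbhs_nbhs (conj oU Uphi)).
have n2 : \forall w \near v, 0 < dot w w := @continuous_dot2 R v _ (lt_nbhsr vv0).
near=> w; have w0 : 0 < dot w w by near: w.
exists (Num.sqrt (dot w w))^-1; first by rewrite invr_gt0 sqrtr_gt0.
rewrite DE; split; first by near: w.
rewrite /sphere/= dotZl dotZr mulrA -expr2 exprVn sqr_sqrtr ?ltW// mulVf// gt_eqF//.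
Unshelve. all: by end_near. Qed.

Lemma cone_closureD x y r : closure D x -> cone D y -> 0 <= r -> cone D (r *: x + y).
Proof.
move=> Dx Dy; rewrite le_eqVlt => /predU1P[<-|r0]; first by rewrite scale0r add0r.
have cf : (fun x' : V => y + r *: (x - x')) @ x --> y.
  rewrite -[X in _ --> X](_ : y + r *: (x - x) = y); last by rewrite subrr scaler0 addr0.
  exact: (cvgD (cvg_cst _) (cvgZ (cvg_cst _) (cvgB (cvg_cst _) cvg_id))).
have [x' [Dx' cx']] := Dx _ (cf _ (cone_near Dy)).
have -> : r *: x + y = r *: x' + (y + r *: (x - x')).
  by apply/rowP => i; rewrite !mxE; ring.
by apply: coneD cx'; apply: coneZ => //; exact: in_cone.
Qed.

End Cone.

(** * The boundary curve of a convex domain *)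

Lemma second_derivative_ge0 (R : realType) (u u' u'' : R -> R) (s : R) :
  (forall x, has_deriv u x (u' x)) -> (forall x, has_deriv u' x (u'' x)) ->
  {for s, continuous u''} -> (forall x, u s <= u x) -> u' s = 0 -> 0 <= u'' s.
Proof.
move=> du du' cu'' umin u's; rewrite leNgt; apply/negP => neg.
have /nbhs_ballP[e /= e0 he] := cu'' _ (lt_nbhsl neg).
have {}he y : s <= y < s + e -> u'' y < 0.
  by move=> /andP[y1 y2]; apply: he; rewrite /ball/= ltr_distlC; apply/andP; split; lra.
have u'0 y : s < y < s + e -> u' y < 0.
  move=> /andP[y1 y2]; rewrite -u's -ltrN2.
  apply: (dv_sincr (fun x => dvN (du' x))) y1 => x /andP[x1 x2].
  by rewrite oppr_gt0 he// (ltW x1) (lt_trans x2).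
have : - u s < - u (s + e / 2).
  apply: (dv_sincr (fun x => dvN (du x))); last by lra.
  by move=> x /andP[x1 x2]; rewrite oppr_gt0 u'0// x1; lra.
by rewrite ltrN2 ltNge umin.
Qed.

Section BoundingCurve.
Variables (R : realType) (gamma nu : R -> 'rV[R]_3) (D : set 'rV[R]_3) (L : R) (q : 'rV[R]_3).
Local Notation V := 'rV[R]_3.
Local Notation T := (derive1 gamma).
Hypothesis L0 : 0 < L.
Hypothesis gsmooth : smooth gamma.
Hypothesis gsphere : forall s, sphere (gamma s).
Hypothesis gunit : forall s, dot (T s) (T s) = 1.
Hypothesis gL : forall s, gamma (s + L) = gamma s.
Hypothesis gq : range gamma `<=` open_hemisphere q.
Hypothesis Dq : D `<=` open_hemisphere q.
Hypothesis D0 : D !=set0.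
Hypothesis Dopen : exists2 U : set V, open U & D = U `&` @sphere R.
Hypothesis Dconv : geodesically_convex D.
Hypothesis Dbnd : closure D `\` D = range gamma.
Hypothesis Hnu : inward_normal gamma D nu.

Lemma curve_closure s : closure D (gamma s).
Proof. by have : range gamma (gamma s) by []; rewrite -Dbnd => -[]. Qed.

Lemma curve_out s : ~ D (gamma s).
Proof. by have : range gamma (gamma s) by []; rewrite -Dbnd => -[]. Qed.

Lemma dgamma s : derivable gamma s 1. Proof. exact: (@gsmooth 0%N s). Qed.

Lemma dtangent s : derivable T s 1. Proof. exact: (@gsmooth 1%N s). Qed.

Lemma dacc s : derivable (derive1n 2 gamma) s 1. Proof. exact: (@gsmooth 2%N s). Qed.

Lemma curve_tangent s : dot (gamma s) (T s) = 0.
Proof.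
have := dv_val (dv_dot2 (@dgamma s) (@dgamma s)).
have -> : (fun s => dot (gamma s) (gamma s)) = fun=> 1 by apply/funext => x; exact: gsphere.
by rewrite (dv_val (dv_cst 1 s)) (dotC (T s)); lra.
Qed.

Lemma acc_curve s : dot (derive1n 2 gamma s) (gamma s) = -1.
Proof.
have := dv_val (dv_dot2 (@dgamma s) (@dtangent s)).
have -> : (fun s => dot (gamma s) (T s)) = fun=> 0 by apply/funext => x; exact: curve_tangent.
by rewrite (dv_val (dv_cst 0 s)) gunit dotC -[derive1 T s]/(derive1n 2 gamma s) => h; lra.
Qed.

Lemma acc_tangent s : dot (derive1n 2 gamma s) (T s) = 0.
Proof.
have := dv_val (dv_dot2 (@dtangent s) (@dtangent s)).
have -> : (fun s => dot (T s) (T s)) = fun=> 1 by apply/funext => x; exact: gunit.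
by rewrite (dv_val (dv_cst 1 s)) (dotC (T s)) -[derive1 T s]/(derive1n 2 gamma s) => h; lra.
Qed.

Lemma frame_expansion s u :
  u = dot u (gamma s) *: gamma s + dot u (T s) *: T s + dot u (nu s) *: nu s.
Proof.
have [n1 n2 n3 _] := Hnu s.
by apply: orthonormal_expansion;
  [exact: gsphere|exact: gunit|exact: n1|exact: curve_tangent|rewrite dotC|rewrite dotC].
Qed.

Lemma acc_expansion s :
  derive1n 2 gamma s = - gamma s + geodesic_curvature gamma nu s *: nu s.
Proof.
by rewrite [LHS](frame_expansion s) acc_curve acc_tangent scaleN1r scale0r addr0.
Qed.

(** Otherwise [gamma s] would be a positive combination of [y], of a point of
    the curve near [gamma s] and of a point of the domain in the direction of
    the inward normal, hence an interior point. *)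
Lemma normal_not_neg s y : cone D y -> ~ dot (nu s) y < 0.
Proof.
move=> Dy neg; have [n1 n2 n3 nin] := Hnu s.
pose a := dot y (gamma s); pose b := dot y (T s); pose c := - dot y (nu s).
have c0 : 0 < c by rewrite oppr_gt0 dotC.
have yE : y = a *: gamma s + b *: T s - c *: nu s.
  by rewrite {1}(frame_expansion s y) /c scaleNr opprK.
have [tau [tau0 sint cost Dtau]] : exists tau, [/\ 0 < tau, 0 < sin tau,
    0 < c * cos tau + a * sin tau & D (geodesic (gamma s) (nu s) tau)].
  have /nbhs_ballP[e /= e0 he] := nin.
  have df := dvD (dvM (dv_cst c 0) (is_derive_cos 0)) (dvM (dv_cst a 0) (is_derive_sin 0)).
  have f0 : 0 < c * cos 0 + a * sin 0 by rewrite cos0 sin0; lra.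
  have /nbhs_ballP[d /= d0 hd] := dv_cont df (lt_nbhsr f0).
  pose m := Num.min (Num.min e d) pi / 2.
  have m0 : 0 < m by rewrite divr_gt0// !lt_min e0 d0 pi_gt0.
  have [me md mp] : [/\ m < e, m < d & m < pi].
    have := pi_gt0 R; rewrite /m; set x := Num.min (Num.min e d) pi.
    have x0 : 0 < x by rewrite !lt_min e0 d0 pi_gt0.
    have : x <= e by rewrite !ge_min lexx.
    have : x <= d by rewrite !ge_min lexx orbT.
    have : x <= pi by rewrite ge_min lexx orbT.
    by move=> *; split; lra.
  exists m; split => //.
  - by apply: sin_gt0_pi; rewrite m0.
  - by apply: hd; rewrite /ball/= sub0r normrN gtr0_norm.
  - by apply: he => //; rewrite /ball/= sub0r normrN gtr0_norm.
pose g := geodesic (gamma s) (nu s) tau.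
pose qt (h : R) := h^-1 *: (gamma (h + s) - gamma s).
pose B (h : R) := (c / sin tau) *: g + b *: (qt h - T s).
have cB : B h @[h --> 0^'] --> (c / sin tau) *: g.
  have cq : qt h @[h --> 0^'] --> T s.
    have := @dgamma s; rewrite /derivable -/(derive gamma s 1) -derive1E.
    have -> // : (fun h => h^-1 *: ((gamma \o shift s) (h *: 1) - gamma s)) = qt.
    by apply/funext => h; rewrite /qt /= /GRing.scale /= mulr1.
  rewrite -[X in _ --> X](_ : (c / sin tau) *: g + b *: (T s - T s) = _); last first.
    by rewrite subrr scaler0 addr0.
  exact: (cvgD (cvg_cst _) (cvgZ (cvg_cst _) (cvgB cq (cvg_cst _)))).
have cg : cone D ((c / sin tau) *: g).
  by apply: coneZ; [rewrite divr_gt0|exact: in_cone].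
have /nbhs_ballP[e /= e0 he] := cB _ (cone_near Dq Dopen cg).
have [h [h0 bh cBh]] : exists h, [/\ h != 0, 0 <= - b / h & cone D (B h)].
  have [b0|b0] := leP b 0.
    exists (e / 2); have h0 : 0 < e / 2 by rewrite divr_gt0.
    split; first by rewrite gt_eqF.
      by rewrite divr_ge0 ?oppr_ge0// ltW.
    by apply: he; [rewrite /ball/= sub0r normrN gtr0_norm//; lra|rewrite /= gt_eqF].
  exists (- (e / 2)); have h0 : 0 < e / 2 by rewrite divr_gt0.
  split; first by rewrite oppr_eq0 gt_eqF.
    by rewrite invrN mulrNN divr_ge0// ltW.
  by apply: he; [rewrite /ball/= sub0r opprK gtr0_norm//; lra|rewrite /= oppr_eq0 gt_eqF].
have cyB : cone D (y + B h) := coneD Dq Dconv Dy cBh.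
have := cone_closureD Dq Dopen Dconv (@curve_closure (h + s)) cyB bh.
pose K := a - b / h + c * cos tau / sin tau.
have -> : - b / h *: gamma (h + s) + (y + B h) = K *: gamma s.
  rewrite {1}yE /B /qt /g /geodesic /K.
  apply/rowP => i; rewrite !mxE; move: (gamma s ord0 i) (gamma (h + s) ord0 i) (T s ord0 i) (nu s ord0 i).
  by move=> x1 x2 x3 x4; field; rewrite h0 gt_eqF.
have K0 : 0 < K.
  have -> : K = - b / h + (c * cos tau + a * sin tau) / sin tau.
    by rewrite /K; field; rewrite h0 gt_eqF.
  by rewrite ltr_wpDl// divr_gt0.
move=> cK; apply: (@curve_out s); apply: (cone_sphere Dq); first exact: gsphere.
rewrite -[gamma s]scale1r -(mulVf (lt0r_neq0 K0)) -scalerA; apply: coneZ cK.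
by rewrite invr_gt0.
Qed.

(** Moving [y] slightly against the normal stays in the open cone. *)
Lemma normal_pos s y : D y -> 0 < dot (nu s) y.
Proof.
move=> Dy; have cy := in_cone Dy; have [n1 _ _ _] := Hnu s.
rewrite lt_neqAle leNgt; apply/andP; split; last exact/negP/normal_not_neg.
apply/eqP => e.
have cf : (fun h : R => y - h *: nu s) @ (0 : R) --> y.
  rewrite -[X in _ --> X](_ : y - (0 : R) *: nu s = _); last by rewrite scale0r subr0.
  exact: (cvgB (cvg_cst _) (cvgZ cvg_id (cvg_cst _))).
have /nbhs_ballP[d /= d0 hd] := cf _ (cone_near Dq Dopen cy).
have d2 : 0 < d / 2 by rewrite divr_gt0.
apply: (@normal_not_neg s (y - (d / 2) *: nu s)).
  by apply: hd; rewrite /ball/= sub0r normrN gtr0_norm//; lra.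
by rewrite dotDr dotNr dotZr n1 -e; lra.
Qed.

Lemma normal_ge0 s y : closure D y -> 0 <= dot (nu s) y.
Proof.
move=> Dy; rewrite leNgt; apply/negP => neg.
have [x [Dx xneg]] := Dy _ (@continuous_dot R (nu s) y _ (lt_nbhsl neg)).
by have := normal_pos s Dx; rewrite ltNge ltW.
Qed.

(** The height of the curve in the direction of the normal at [s] is minimal at
    [s]. *)
Lemma curvature_ge0 s : 0 <= geodesic_curvature gamma nu s.
Proof.
have [_ n2 n3 _] := Hnu s.
rewrite /geodesic_curvature dotC.
apply: (@second_derivative_ge0 _ (fun x => dot (nu s) (gamma x)) (fun x => dot (nu s) (T x))
  (fun x => dot (nu s) (derive1n 2 gamma x)) s).
- by move=> x; exact: dv_dot (@dgamma x).
- by move=> x; exact: dv_dot (@dtangent x).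
- exact: dv_cont (dv_dot (nu s) (@dacc s)).
- by move=> x; rewrite n2; apply: normal_ge0; exact: curve_closure.
- by [].
Qed.

(** At the point [p] of the closed cone nearest to the centre [q] of the
    hemisphere, [q - p] is non-positive on the cone, so [p] is as positive on
    the curve as [q] is. As the cone is open, an almost nearest point is taken
    instead. *)
Lemma exists_center : exists2 p, D p & forall s, 0 < dot p (gamma s).
Proof.
have [delta d0 hdelta] : exists2 delta, 0 < delta & forall s, delta <= dot q (gamma s).
  have cq : {within `[0, L], continuous (fun s => dot q (gamma s))}.
    by apply: (@dv_within _ _ (fun s => dot q (T s))) => x; exact: dv_dot (@dgamma x).
  have [c _ hc] := EVT_min (ltW L0) cq.
  exists (dot q (gamma c)); first by have [_] : open_hemisphere q (gamma c) by apply: gq.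
  move=> s; have [k /andP[k1 k2]] := shift_into 0 s L0.
  rewrite -(periodic_int gL s k); apply: hc.
  by rewrite in_itv/= k1 ltW// -[X in _ < X]add0r.
pose eta := delta / 2; have eta0 : 0 < eta by rewrite divr_gt0.
pose S := [set r | exists2 y, cone D y & r = dot (q - y) (q - y)].
have infS : has_inf S.
  split; first by case: D0 => y Dy; exists (dot (q - y) (q - y)), y => //; exact: in_cone.
  by exists 0 => _ [y _ ->]; exact: dot_ge0.
have [_ [p cp ->] pinf] := inf_adherent (exprn_gt0 2 eta0) infS.
have near_max y : D y -> dot (q - p) y <= eta.
  move=> Dy; have cy : cone D (p + eta *: y).
    by apply: (coneD Dq Dconv cp); apply: coneZ => //; exact: in_cone.
  have : inf S <= dot (q - (p + eta *: y)) (q - (p + eta *: y)).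
    by apply: ge_inf; [case: infS|exists (p + eta *: y)].
  rewrite opprD addrA; move: pinf; move: (q - p) => w pinf.
  have -> : dot (w - eta *: y) (w - eta *: y) = dot w w - 2 * eta * dot w y + eta ^+ 2.
    rewrite dotDl !dotDr !dotNl !dotNr !dotZl !dotZr (domain_unit Dq Dy) (dotC y); ring.
  move=> h; have h2 : eta * dot w y <= eta * eta by move: h pinf; rewrite expr2; nra.
  by rewrite -(ler_pM2l eta0).
have [r r0 Dp] := cp; exists (r *: p) => // s; rewrite dotZl mulr_gt0//.
have : dot (q - p) (gamma s) <= eta.
  rewrite leNgt; apply/negP => lt.
  have [x [Dx xlt]] := @curve_closure s _ (@continuous_dot R (q - p) (gamma s) _ (lt_nbhsr lt)).
  by have := near_max x Dx; rewrite leNgt xlt.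
by rewrite dotDl dotNl; have := hdelta s; rewrite /eta; lra.
Qed.

End BoundingCurve.

(** * The area of a domain in a rotated frame *)

Section RadialSlice.
Variables (R : realType) (D : set 'rV[R]_3) (q : 'rV[R]_3).
Local Notation V := 'rV[R]_3.
Hypothesis Dq : D `<=` open_hemisphere q.
Hypothesis Dopen : exists2 U : set V, open U & D = U `&` @sphere R.
Hypothesis Dconv : geodesically_convex D.

(** A half great circle from a point of [D] leaves [D] at the first boundary
    point it meets and does not come back. *)
Lemma radial_slice (p u g : V) (phi0 phi : R) : D p -> closure D g -> ~ D g ->
  sphere g -> g = cos phi0 *: p + sin phi0 *: u -> 0 < phi0 < pi -> 0 <= phi <= pi ->
  cone D (cos phi *: p + sin phi *: u) <-> phi < phi0.
Proof.
move=> Dp Dg Dng g1 gE /andP[p0 ppi] /andP[f0 fpi].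
have sp0 : 0 < sin phi0 by apply: sin_gt0_pi; rewrite p0.
split=> [cw|lt]; last first.
  have sp : 0 < sin (phi0 - phi) by apply: sin_gt0_pi; apply/andP; split; lra.
  have c1 : cone D (sin (phi0 - phi) *: p) by apply: coneZ => //; exact: in_cone.
  have := cone_closureD Dq Dopen Dconv Dg c1 (sin_ge0_pi (introT andP (conj f0 fpi))).
  have -> : sin phi *: g + sin (phi0 - phi) *: p = sin phi0 *: (cos phi *: p + sin phi *: u).
    by rewrite gE; apply/rowP => i; rewrite !mxE sinB; ring.
  move=> c2; rewrite -[X in cone D X]scale1r -(mulVf (lt0r_neq0 sp0)) -scalerA.
  by apply: coneZ c2; rewrite invr_gt0.
rewrite ltNge; apply/negP; rewrite le_eqVlt => /predU1P[e|lt].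
  by apply: Dng; apply: (cone_sphere Dq) => //; rewrite gE e.
have [pi_phi|] := eqVneq phi pi.
  have := cone_pos Dq cw; have := cone_pos Dq (in_cone Dp).
  by rewrite pi_phi cospi sinpi scale0r addr0 dotZr; lra.
move=> phi_pi; have phi_lt : phi < pi by rewrite lt_neqAle phi_pi.
have sphi : 0 < sin phi by apply: sin_gt0_pi; apply/andP; split; lra.
have sd : 0 < sin (phi - phi0) by apply: sin_gt0_pi; apply/andP; split; lra.
have := coneD Dq Dconv (coneZ sd (in_cone Dp)) (coneZ sp0 cw).
have -> : sin (phi - phi0) *: p + sin phi0 *: (cos phi *: p + sin phi *: u) = sin phi *: g.
  by rewrite gE; apply/rowP => i; rewrite !mxE sinB; ring.
move=> c2; apply: Dng; apply: (cone_sphere Dq) => //.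
rewrite -[X in cone D X]scale1r -(mulVf (lt0r_neq0 sphi)) -scalerA.
by apply: coneZ c2; rewrite invr_gt0.
Qed.

Definition cone_indic (e1 e2 e3 : V) (x y z : R) : R :=
  \1_(cone D) (x *: e1 + y *: e2 + z *: e3).

Let vec3_combo (x y z : R) : vec3 x y z = x *: vec3 1 0 0 + y *: vec3 0 1 0 + z *: vec3 0 0 1.
Proof.
by apply/rowP => i; rewrite !mxE; case: i => [[|[|[|//]]] h] /=; ring.
Qed.

Lemma ray_fun_cone_indic : ray_fun (cone_indic (vec3 1 0 0) (vec3 0 1 0) (vec3 0 0 1)).
Proof.
split=> [|x y z|r x y z r0].
- pose S : set (measurableTypeR R * measurableTypeR R * measurableTypeR R) :=
    [set z | cone D (vec3 z.1.1 z.1.2 z.2)].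
  have mS : measurable S.
    apply: measurable_box_open => -[[x y] z] /= Sz.
    have /nbhs_ballP[e /= e0 he] := cone_near Dq Dopen Sz.
    exists e => // x' y' z' hx hy hz; apply: he; split => // i j; rewrite !mxE.
    by case: j => [[|[|[|//]]] h].
  have -> : (fun z : measurableTypeR R * measurableTypeR R * measurableTypeR R =>
      cone_indic (vec3 1 0 0) (vec3 0 1 0) (vec3 0 0 1) z.1.1 z.1.2 z.2) = \1_S.
    by apply/funext => z; rewrite /cone_indic -vec3_combo !indicE; congr (_%:R).
  exact: measurable_indic.
- by rewrite /cone_indic indicE; case: (_ \in _).
- rewrite /cone_indic -!vec3_combo.
  have -> : vec3 (r * x) (r * y) (r * z) = r *: vec3 x y z.
    by apply/rowP => i; rewrite !mxE; case: i => [[|[|[|//]]] h] /=; ring.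
  rewrite !indicE; congr (_%:R); congr nat_of_bool; apply/idP/idP; rewrite !inE; last exact: coneZ.
  move=> c; rewrite -[X in cone D X]scale1r -(mulVf (lt0r_neq0 r0)) -scalerA.
  by apply: coneZ c; rewrite invr_gt0.
Qed.

Lemma sphere_area_ray :
  sphere_area D = ray_area (cone_indic (vec3 1 0 0) (vec3 0 1 0) (vec3 0 0 1)).
Proof.
rewrite /sphere_area /ray_area; apply: eq_integral => theta _; apply: eq_integral => phi _.
congr (_ * _)%:E; rewrite /cone_indic -vec3_combo !indicE; congr (_%:R); congr nat_of_bool.
have unit : dot (spherical_coordinates phi theta) (spherical_coordinates phi theta) = 1.
  rewrite dot_vec3 -!expr2 !exprMn -mulrDr cos2Dsin2 mulr1.
  by rewrite addrC cos2Dsin2.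
by apply/idP/idP; rewrite !inE; [exact: in_cone|exact: (cone_sphere Dq)].
Qed.

(** An orthonormal frame with last vector [r U + h e_3], where
    [U = (- sin alpha, cos alpha, 0)]. *)
Definition frame1 (alpha : R) : V := vec3 (cos alpha) (sin alpha) 0.
Definition frame2 (alpha r h eps : R) : V :=
  vec3 (- (eps * h * sin alpha)) (eps * h * cos alpha) (- (eps * r)).
Definition frame3 (alpha r h : R) : V := vec3 (- (r * sin alpha)) (r * cos alpha) h.

(** The frame is obtained from the coordinate axes by an isometry that fixes the
    first axis and a rotation around the last one. *)
Lemma sphere_area_frame (alpha r h eps : R) : `|alpha| <= 2 * pi ->
  r ^+ 2 + h ^+ 2 = 1 -> eps ^+ 2 = 1 ->
  sphere_area D = ray_area (cone_indic (frame1 alpha) (frame2 alpha r h eps) (frame3 alpha r h)).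
Proof.
move=> al rh eps2; set chi := cone_indic (vec3 1 0 0) (vec3 0 1 0) (vec3 0 0 1).
have chiP : ray_fun chi := ray_fun_cone_indic.
pose chiz x y z := chi (x * cos alpha - y * sin alpha) (x * sin alpha + y * cos alpha) z.
have chizP : ray_fun chiz.
  have := ray_fun_linear chiP (cos alpha) (- sin alpha) 0 (sin alpha) (cos alpha) 0 0 0 1.
  congr ray_fun; apply/funext => x; apply/funext => y; apply/funext => z.
  by rewrite /chiz; congr chi; ring.
rewrite sphere_area_ray -(ray_area_rotation_z chiP al) -/chiz.
rewrite -(@ray_area_rotation_x _ chiz chizP (eps * h) r (- (eps * r)) h).
- congr ray_area; apply/funext => x; apply/funext => y; apply/funext => z.
  rewrite /chiz /chi /cone_indic -vec3_combo; congr (\1_ _ _).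
  by apply/rowP => i; rewrite !mxE; case: i => [[|[|[|//]]] hi] /=; ring.
- by rewrite sqrrN !exprMn eps2 !mul1r addrC.
- exact: rh.
- by ring.
Qed.

End RadialSlice.

(** * The area in polar coordinates around an interior point *)

Section AxisArea.
Variables (R : realType) (D : set 'rV[R]_3) (q e1 e2 p : 'rV[R]_3) (gamma : R -> 'rV[R]_3).
Variables (x1 x2 x3 th w Qp : R -> R) (L c : R).
Local Notation V := 'rV[R]_3.
Notation mu := (@lebesgue_measure R).
Hypothesis Dq : D `<=` open_hemisphere q.
Hypothesis Dopen : exists2 U : set V, open U & D = U `&` @sphere R.
Hypothesis Dconv : geodesically_convex D.
Hypothesis Dp : D p.
Hypothesis Dgamma : forall s, closure D (gamma s).
Hypothesis Dngamma : forall s, ~ D (gamma s).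
Hypothesis gsphere : forall s, sphere (gamma s).
Hypothesis gE : forall s, gamma s = x1 s *: e1 + x2 s *: e2 + x3 s *: p.
Hypothesis xx : forall s, x1 s ^+ 2 + x2 s ^+ 2 + x3 s ^+ 2 = 1.
Hypothesis rad0 : forall s, 0 < x1 s ^+ 2 + x2 s ^+ 2.
Hypothesis dth : forall s, has_deriv th s (w s).
Hypothesis w0 : forall s, 0 < w s.
Hypothesis x1E : forall s, x1 s = Num.sqrt (x1 s ^+ 2 + x2 s ^+ 2) * cos (th s).
Hypothesis x2E : forall s, x2 s = Num.sqrt (x1 s ^+ 2 + x2 s ^+ 2) * sin (th s).
Hypothesis cx3 : continuous x3.
Hypothesis L0 : 0 < L.
Hypothesis x1L : forall s, x1 (s + L) = x1 s.
Hypothesis x2L : forall s, x2 (s + L) = x2 s.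
Hypothesis wL : forall s, w (s + L) = w s.
Hypothesis ginj : {in `[0, L[ &, injective gamma}.
Hypothesis dQp : forall s, has_deriv Qp s (x3 s * w s).
Hypothesis QpL : forall s, Qp (s + L) = Qp s + c.

Let colat s := acos (x3 s).

Let x3_itv s : -1 <= x3 s <= 1.
Proof.
have h : x3 s ^+ 2 <= 1 by have := xx s; have := rad0 s; lra.
by apply/andP; split; nra.
Qed.

Let cos_colat s : cos (colat s) = x3 s.
Proof. by rewrite /colat acosK// in_itv; exact: x3_itv. Qed.

Let sin_colat s : sin (colat s) = Num.sqrt (x1 s ^+ 2 + x2 s ^+ 2).
Proof. by rewrite /colat sin_acos ?x3_itv//; congr Num.sqrt; rewrite -(xx s); ring. Qed.

Let colat_itv s : 0 < colat s < pi.
Proof.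
have s0 : 0 < sin (colat s) by rewrite sin_colat sqrtr_gt0.
rewrite !lt_neqAle acos_ge0 ?x3_itv// acos_lepi ?x3_itv// !andbT; apply/andP; split; apply/eqP => e.
  by move: s0; rewrite -e sin0 ltxx.
by move: s0; rewrite e sinpi ltxx.
Qed.

Let slice s theta phi : cos theta = cos (th s) -> sin theta = sin (th s) -> 0 <= phi <= pi ->
  cone D ((sin phi * cos theta) *: e1 + (sin phi * sin theta) *: e2 + cos phi *: p) <->
  phi < colat s.
Proof.
move=> ec es hphi; pose u := cos theta *: e1 + sin theta *: e2.
have -> : (sin phi * cos theta) *: e1 + (sin phi * sin theta) *: e2 + cos phi *: p =
    cos phi *: p + sin phi *: u.
  by apply/rowP => i; rewrite !mxE; ring.
apply: (radial_slice Dq Dopen Dconv Dp (@Dgamma s) (@Dngamma s) (@gsphere s)) => //.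
by rewrite cos_colat sin_colat gE /u scalerDr !scalerA ec es -x1E -x2E addrC.
Qed.

Let th_lt x y : x < y -> th x < th y.
Proof. by move=> xy; apply: dv_sincr dth _ xy => z _. Qed.

Let cth (a b : R) : {within `[a, b], continuous th} := dv_within (A := `[a, b]) dth.

(** After more than one turn the curve would meet again the half-plane of its
    starting point, in which the domain has a single boundary point. *)
Lemma boundary_winding s : th (s + L) = th s + 2 * pi.
Proof.
have incr x : th (x + L) = th x + (th L - th 0).
  by rewrite -(periodic_increment x dth wL) [RHS]addrC subrK.
pose t := th L - th 0.
have t0 : 0 < t by rewrite subr_gt0 th_lt.
have radn x : Num.sqrt (x1 x ^+ 2 + x2 x ^+ 2) != 0 by rewrite gt_eqF// sqrtr_gt0.
have ct : cos (th 0 + t) = cos (th 0).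
  by have := x1E (0 + L); rewrite incr x1L x2L [LHS]x1E => /(mulfI (radn 0)).
have st : sin (th 0 + t) = sin (th 0).
  by have := x2E (0 + L); rewrite incr x1L x2L [LHS]x2E => /(mulfI (radn 0)).
have t1 : cos t = 1.
  have -> : cos t = cos (th 0 + t - th 0) by congr cos; ring.
  by rewrite cosB ct st -!expr2 cos2Dsin2.
rewrite incr -/t; congr (_ + _).
have := cos_eq1 t1 t0; rewrite le_eqVlt => /predU1P[//|t2].
have p0 : 0 < pi :> R := pi_gt0 R.
have [|s' ] := @IVT R th 0 L (th 0 + 2 * pi) (ltW L0) (@cth 0 L).
  have hh : th 0 < th L := th_lt L0.
  by rewrite min_l ?max_r ?(ltW hh)//; apply/andP; split; rewrite /t in t2; lra.
rewrite in_itv/= => /andP[s0 sL] ths.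
have {}s0 : 0 < s'.
  by rewrite lt_neqAle s0 andbT; apply/eqP => e; move: ths; rewrite -e; lra.
have {}sL : s' < L.
  by rewrite lt_neqAle sL andbT; apply/eqP => e; move: ths t2; rewrite e /t; lra.
have cs : cos (th s') = cos (th 0) by rewrite ths cosD_turn.
have ss : sin (th s') = sin (th 0) by rewrite ths sinD_turn.
have /andP[c00 c0pi] := colat_itv 0; have /andP[cs0 cspi] := colat_itv s'.
have ce : colat s' = colat 0.
  have sl phi : 0 <= phi <= pi -> phi < colat s' <-> phi < colat 0.
    move=> hphi; rewrite -(slice erefl erefl hphi (s := s')).
    by rewrite -(slice (s := 0) cs ss hphi).
  have [lt|lt|//] := ltgtP (colat s') (colat 0).
    by have /sl : 0 <= colat s' <= pi; [rewrite !ltW|move=> [_ /(_ lt)]; rewrite ltxx].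
  by have /sl : 0 <= colat 0 <= pi; [rewrite !ltW|move=> [/(_ lt)]; rewrite ltxx].
suff : gamma s' = gamma 0.
  move=> /ginj; rewrite !in_itv/= (ltW s0) sL lexx L0 => /(_ isT isT) e.
  by move: s0; rewrite e ltxx.
have e3 : x3 s' = x3 0 by rewrite -!cos_colat ce.
have er : Num.sqrt (x1 s' ^+ 2 + x2 s' ^+ 2) = Num.sqrt (x1 0 ^+ 2 + x2 0 ^+ 2).
  by rewrite -!sin_colat ce.
have ex1 : x1 s' = x1 0 by rewrite x1E er cs -x1E.
have ex2 : x2 s' = x2 0 by rewrite x2E er ss -x2E.
by rewrite !gE ex1 ex2 e3.
Qed.

Let th_surj theta : exists s, th s = theta.
Proof.
have p0 : 0 < pi :> R := pi_gt0 R.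
have p20 : 0 < 2 * pi :> R by lra.
have [k /andP[k1 k2]] := shift_into (th 0) theta p20.
have thL0 : th L = th 0 + 2 * pi by rewrite -(boundary_winding 0) add0r.
have [|s _ ths] := @IVT R th 0 L (theta + k%:~R * (2 * pi)) (ltW L0) (@cth 0 L).
  have hh : th 0 < th L := th_lt L0.
  by rewrite min_l ?max_r ?(ltW hh)//; rewrite thL0 k1 ltW.
have per x : th (x + L) - 2 * pi / L * (x + L) = th x - 2 * pi / L * x.
  by rewrite boundary_winding; field; rewrite gt_eqF.
exists (s + (- k)%:~R * L).
have := @periodic_int R R (fun x => th x - 2 * pi / L * x) L per s (- k).
rewrite ths mulrNz => h.
have e : 2 * pi / L * (s + - k%:~R * L) = 2 * pi / L * s - k%:~R * (2 * pi).
  by field; rewrite gt_eqF.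
by move: h; rewrite e; lra.
Qed.

(** The longitude is a parameter of the curve, and the meridian of longitude
    [th s] contributes the integral of [sin] up to the colatitude, which is
    [1 - x3 s]. *)
Lemma axis_area : ray_area (cone_indic D e1 e2 p) = (2 * pi - c)%:E.
Proof.
have p0 : 0 < pi :> R := pi_gt0 R.
have [sg sgE] := choice th_surj.
have th_inj x y : th x = th y -> x = y.
  by case: (ltgtP x y) => // /th_lt + e; rewrite e ltxx.
have sgK x : sg (th x) = x by apply: th_inj; rewrite sgE.
have dsg theta : has_deriv sg theta (w (sg theta))^-1.
  rewrite -{1}(sgE theta); apply: (@is_derive_inverse _ th sg).
  - by near=> x; exact: sgK.
  - by near=> x; exact: dv_cont (dth x).
  - exact: dth.
  - by rewrite gt_eqF.
have sgL theta : sg (theta + 2 * pi) = sg theta + L.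
  by apply: th_inj; rewrite sgE boundary_winding sgE.
have csg : continuous sg by move=> x; exact: dv_cont (dsg x).
pose F theta := theta - Qp (sg theta).
have dF theta : has_deriv F theta (1 - x3 (sg theta)).
  apply: dv_eq.
    by apply: dvD; [exact: dv_id|apply: dvN; exact: dv_comp (dQp _) (dsg _)].
  by rewrite mulrK// unitfE gt_eqF.
rewrite /ray_area; transitivity (\int[mu]_(theta in `[0%R, (2 * pi)%R]) (1 - x3 (sg theta))%:E)%E.
  apply: eq_integral => theta _.
  have /andP[c0 cpi] := colat_itv (sg theta).
  transitivity (\int[mu]_(phi in `[0%R, (colat (sg theta))%R]) (sin phi)%:E)%E.
    rewrite -[RHS]integral_itv_bndo_bndc; last first.
      by apply/measurable_EFinP/measurable_funTS; apply: continuous_measurable_fun; exact: continuous_sin.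
    rewrite integral_mkcond [RHS]integral_mkcond; apply: eq_integral => phi _.
    rewrite !patchE !mem_setE !in_itv/=; case: ifPn => hphi; last first.
      by rewrite ifN//; apply: contra hphi => /andP[-> h]/=; rewrite ltW// (lt_trans h).
    have sl := slice (s := sg theta) (theta := theta) (congr1 cos (esym (sgE theta)))
      (congr1 sin (esym (sgE theta))) hphi.
    case/andP: (hphi) => -> _ /=; rewrite /cone_indic indicE; case: ifPn => h.
      by rewrite mem_set ?mulr1//; apply/sl.
    by rewrite memNset ?mulr0// => /sl; rewrite (negbTE h).
  have dncos (y : R) : has_deriv (fun x : R => - cos x) y (sin y).
    by apply: dv_eq; [apply: dvN; exact: is_derive_cos|rewrite opprK].
  rewrite (@continuous_FTC2 R _ (fun x : R => - cos x))//.
  - by rewrite cos_colat cos0 -EFinB; congr EFin; ring.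
  - by apply: continuous_subspaceT; exact: continuous_sin.
  - split.
    + by move=> x _; case: (dncos x).
    + by apply: cvg_at_right_filter; exact: dv_cont (dncos _).
    + by apply: cvg_at_left_filter; exact: dv_cont (dncos _).
  - by move=> x _; exact: dv_val (dncos x).
have p2 : 0 < 2 * pi :> R by lra.
have cf : continuous (fun theta : R => 1 - x3 (sg theta)).
  move=> x; have cx : {for x, continuous (fun theta => x3 (sg theta))}.
    by apply: continuous_comp; [exact: csg|exact: cx3].
  by apply: cvgB; [exact: cvg_cst|exact: cx].
rewrite (@continuous_FTC2 R _ F)//.
- have := sgL 0; rewrite add0r /F => ->; rewrite QpL -EFinB; congr EFin; ring.
- exact: continuous_subspaceT.
- split.
  + by move=> x _; case: (dF x).
  + by apply: cvg_at_right_filter; exact: dv_cont (dF _).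
  + by apply: cvg_at_left_filter; exact: dv_cont (dF _).
- by move=> x _; exact: dv_val (dF x).
Unshelve. all: by end_near. Qed.

End AxisArea.

(** * The adapted frame, Gauss-Bonnet and the theorem *)

Section Frame.
Variable R : realType.
Local Notation V := 'rV[R]_3.

Lemma frame3_exists (p : V) : dot p p = 1 -> exists alpha r h,
  [/\ `|alpha| <= 2 * pi, r ^+ 2 + h ^+ 2 = 1 & p = frame3 alpha r h].
Proof.
have [a [b [h ->]]] := vec3E p; rewrite dot_vec3 -!expr2 => abh.
pose r := Num.sqrt (a ^+ 2 + b ^+ 2).
have r2 : r ^+ 2 = a ^+ 2 + b ^+ 2 by rewrite sqr_sqrtr// addr_ge0// sqr_ge0.
have p0 : 0 <= pi :> R := pi_ge0 R.
have [r0|r0] := eqVneq r 0.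
  exists 0, r, h; split; first by rewrite normr0 mulr_ge0.
    by rewrite r2.
  have : a ^+ 2 + b ^+ 2 == 0 by rewrite -r2 r0 expr0n.
  rewrite paddr_eq0 ?sqr_ge0// !sqrf_eq0 => /andP[/eqP -> /eqP ->].
  by rewrite /frame3 r0 !mul0r oppr0.
have [alpha [ca sa al]] : exists a', [/\ cos a' = b / r, sin a' = - a / r & `|a'| <= pi].
  apply: exists_angle; rewrite !expr_div_n sqrrN -mulrDl addrC -r2 divff//.
  by rewrite expf_neq0.
exists alpha, r, h; split; [by lra|by rewrite r2|].
by rewrite /frame3 ca sa; congr vec3; field.
Qed.

Lemma frame_orthonormal (alpha r h eps : R) : r ^+ 2 + h ^+ 2 = 1 -> eps ^+ 2 = 1 ->
  let e1 := frame1 alpha in let e2 := frame2 alpha r h eps in let e3 := frame3 alpha r h in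
  [/\ dot e1 e1 = 1, dot e2 e2 = 1 & dot e3 e3 = 1] /\
  [/\ dot e1 e2 = 0, dot e1 e3 = 0 & dot e2 e3 = 0].
Proof.
move=> rh ee /=; rewrite !dot_vec3; have cs := cos2Dsin2 alpha.
move: (cos alpha) (sin alpha) cs => c s cs; split; split.
- by rewrite -cs; ring.
- transitivity (eps ^+ 2 * (h ^+ 2 * (c ^+ 2 + s ^+ 2) + r ^+ 2)); first by ring.
  by rewrite cs ee mulr1 addrC rh mulr1.
- transitivity (r ^+ 2 * (c ^+ 2 + s ^+ 2) + h ^+ 2); first by ring.
  by rewrite cs mulr1.
- by ring.
- by ring.
- transitivity (eps * h * r * (c ^+ 2 + s ^+ 2) - eps * h * r); first by ring.
  by rewrite cs; ring.
Qed.

Lemma unit_normal_cross (x1 x2 x3 t1 t2 t3 m1 m2 m3 : R) :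
  x1 ^+ 2 + x2 ^+ 2 + x3 ^+ 2 = 1 -> t1 ^+ 2 + t2 ^+ 2 + t3 ^+ 2 = 1 ->
  x1 * t1 + x2 * t2 + x3 * t3 = 0 -> m1 ^+ 2 + m2 ^+ 2 + m3 ^+ 2 = 1 ->
  m1 * x1 + m2 * x2 + m3 * x3 = 0 -> m1 * t1 + m2 * t2 + m3 * t3 = 0 ->
  exists l, [/\ l ^+ 2 = 1, m1 = l * (x2 * t3 - x3 * t2),
    m2 = l * (x3 * t1 - x1 * t3) & m3 = l * (x1 * t2 - x2 * t1)].
Proof.
move=> xx tt xt mm mx mt.
have nn := norm_cross xx tt xt.
pose n := vec3 (x2 * t3 - x3 * t2) (x3 * t1 - x1 * t3) (x1 * t2 - x2 * t1).
have mE : vec3 m1 m2 m3 = dot (vec3 m1 m2 m3) n *: n.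
  have := @orthonormal_expansion _ (vec3 x1 x2 x3) (vec3 t1 t2 t3) n.
  rewrite !dot_vec3 -!expr2 => /(_ xx tt nn xt) h.
  rewrite {1}(h _ _ (vec3 m1 m2 m3)); [|by ring|by ring].
  by rewrite !dot_vec3 mx mt !scale0r !add0r.
set l := dot _ n in mE; exists l; split.
- have : dot (vec3 m1 m2 m3) (vec3 m1 m2 m3) = 1 by rewrite dot_vec3 -!expr2.
  by rewrite {1 2}mE dotZl dotZr /n dot_vec3 -!expr2 nn mulr1 -expr2.
- by have /rowP/(_ (inord 0)) := mE; rewrite !mxE /= inordK.
- by have /rowP/(_ (inord 1)) := mE; rewrite !mxE /= inordK.
- by have /rowP/(_ (inord 2)) := mE; rewrite !mxE /= inordK.
Qed.

(** The determinant of three vectors, expanded along the first. *)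
Definition triple_product (a1 a2 a3 x1 x2 x3 t1 t2 t3 : R -> R) s :=
  a1 s * (x2 s * t3 s - x3 s * t2 s) + a2 s * (x3 s * t1 s - x1 s * t3 s) +
  a3 s * (x1 s * t2 s - x2 s * t1 s).

Lemma triple_product_continuous (a1 a2 a3 x1 x2 x3 t1 t2 t3 : R -> R) :
  continuous a1 -> continuous a2 -> continuous a3 -> continuous x1 -> continuous x2 ->
  continuous x3 -> continuous t1 -> continuous t2 -> continuous t3 ->
  continuous (triple_product a1 a2 a3 x1 x2 x3 t1 t2 t3).
Proof.
move=> ca1 ca2 ca3 cx1 cx2 cx3 ct1 ct2 ct3.
have c2 (u v u' v' : R -> R) : continuous u -> continuous v -> continuous u' -> continuous v' ->
    continuous (fun s => u s * v s - u' s * v' s).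
  by move=> cu cv cu' cv' s; exact: (cvgB (cvgM (cu s) (cv s)) (cvgM (cu' s) (cv' s))).
move=> s; exact: (cvgD (cvgD (cvgM (ca1 s) (c2 _ _ _ _ cx2 ct3 cx3 ct2 s))
  (cvgM (ca2 s) (c2 _ _ _ _ cx3 ct1 cx1 ct3 s))) (cvgM (ca3 s) (c2 _ _ _ _ cx1 ct2 cx2 ct1 s))).
Qed.

Lemma triple_product_periodic (a1 a2 a3 x1 x2 x3 t1 t2 t3 : R -> R) (L : R) :
  (forall s, a1 (s + L) = a1 s) -> (forall s, a2 (s + L) = a2 s) ->
  (forall s, a3 (s + L) = a3 s) -> (forall s, x1 (s + L) = x1 s) ->
  (forall s, x2 (s + L) = x2 s) -> (forall s, x3 (s + L) = x3 s) ->
  (forall s, t1 (s + L) = t1 s) -> (forall s, t2 (s + L) = t2 s) ->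
  (forall s, t3 (s + L) = t3 s) -> forall s,
  triple_product a1 a2 a3 x1 x2 x3 t1 t2 t3 (s + L) =
  triple_product a1 a2 a3 x1 x2 x3 t1 t2 t3 s.
Proof.
move=> a1L a2L a3L x1L x2L x3L t1L t2L t3L s.
by rewrite /triple_product a1L a2L a3L x1L x2L x3L t1L t2L t3L.
Qed.

Lemma dv_periodic (f f' : R -> R) (L : R) : (forall x, has_deriv f x (f' x)) ->
  (forall x, f (x + L) = f x) -> forall x, f' (x + L) = f' x.
Proof.
move=> df fL x; rewrite -(dv_val (df x)).
have h : has_deriv (fun y => f (y + L)) x (f' (x + L)).
  apply: dv_eq.
    apply: (@dv_comp _ f (fun y => y + L)); first exact: df.
    by apply: dvD; [exact: dv_id|exact: dv_cst].
  by rewrite addr0 mulr1.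
by rewrite -(dv_val h) (funext fL).
Qed.

Lemma continuous_sign (f : R -> R) : continuous f -> (forall x, f x != 0) ->
  (forall x, 0 < f x) \/ (forall x, f x < 0).
Proof.
move=> cf f0; have key x y : x <= y -> ~ f x * f y < 0.
  move=> xy neg; have [|z _ fz] := @IVT R f x y 0 xy (continuous_subspaceT cf).
    by case: (ltgtP (f x) (f y)) => *; apply/andP; split; nra.
  by have := f0 z; rewrite fz eqxx.
have same x : 0 < f 0 * f x.
  rewrite lt_neqAle eq_sym mulf_neq0//= leNgt; apply/negP => neg.
  have [x0|/ltW x0] := leP 0 x; first exact: (key _ _ x0 neg).
  by apply: (key _ _ x0); rewrite mulrC.
have [f00|f00] := ltP 0 (f 0); [left|right] => x; have := same x.
  by rewrite pmulr_rgt0.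
by rewrite nmulr_rgt0// lt_neqAle f0.
Qed.

End Frame.

Section Assembly.
Variables (R : realType) (gamma nu : R -> 'rV[R]_3) (D : set 'rV[R]_3) (L : R) (q : 'rV[R]_3).
Local Notation V := 'rV[R]_3.
Local Notation T := (derive1 gamma).
Hypothesis L0 : 0 < L.
Hypothesis gsmooth : smooth gamma.
Hypothesis gsphere : forall s, sphere (gamma s).
Hypothesis gunit : forall s, dot (T s) (T s) = 1.
Hypothesis gL : forall s, gamma (s + L) = gamma s.
Hypothesis ginj : {in `[0, L[ &, injective gamma}.
Hypothesis gq : range gamma `<=` open_hemisphere q.
Hypothesis Dq : D `<=` open_hemisphere q.
Hypothesis D0 : D !=set0.
Hypothesis Dopen : exists2 U : set V, open U & D = U `&` @sphere R.
Hypothesis Dconv : geodesically_convex D.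
Hypothesis Dbnd : closure D `\` D = range gamma.
Hypothesis Hnu : inward_normal gamma D nu.

Local Notation k := (geodesic_curvature gamma nu).
Local Notation a := (derive1n 2 gamma).

(** A positive frame whose last vector [p] is a centre of the domain. The inward
    normal is the cross product of position and velocity up to a sign, which is
    constant because the last coordinate of the normal never vanishes. *)
Lemma adapted_frame : exists e1 e2 p : V,
  [/\ D p, forall s, 0 < dot p (gamma s), sphere_area D = ray_area (cone_indic D e1 e2 p),
   forall u, u = dot e1 u *: e1 + dot e2 u *: e2 + dot p u *: p &
   forall s, [/\ dot e1 (nu s) = dot e2 (gamma s) * dot p (T s) - dot p (gamma s) * dot e2 (T s),
     dot e2 (nu s) = dot p (gamma s) * dot e1 (T s) - dot e1 (gamma s) * dot p (T s) &
     dot p (nu s) = dot e1 (gamma s) * dot e2 (T s) - dot e2 (gamma s) * dot e1 (T s)]].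
Proof.
have [p Dp ppos] := exists_center L0 gsmooth gL gq Dq D0 Dconv Dbnd.
have pnu s : 0 < dot p (nu s).
  by rewrite dotC; exact: (normal_pos gsmooth gsphere gunit Dq Dopen Dconv Dbnd Hnu).
have [alpha [r [h [al rh pE]]]] := frame3_exists (domain_unit Dq Dp).
pose e1 := frame1 alpha; pose e2 eps := frame2 alpha r h eps.
have expand eps : eps ^+ 2 = 1 -> forall u, u = dot e1 u *: e1 + dot (e2 eps) u *: e2 eps + dot p u *: p.
  move=> ee u; have [[e11 e22 e33] [e12 e13 e23]] := frame_orthonormal alpha rh ee.
  rewrite (dotC e1) (dotC (e2 eps)) (dotC p) pE.
  exact: orthonormal_expansion.
have coord eps : eps ^+ 2 = 1 -> forall u v,
    dot u v = dot e1 u * dot e1 v + dot (e2 eps) u * dot (e2 eps) v + dot p u * dot p v.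
  by move=> ee u v; rewrite {1}(expand eps ee u) !dotDl !dotZl.
pose n3 eps s := dot e1 (gamma s) * dot (e2 eps) (T s) - dot (e2 eps) (gamma s) * dot e1 (T s).
(* in any frame the normal is, up to sign, the cross product *)
have cross eps s : eps ^+ 2 = 1 -> exists l, [/\ l ^+ 2 = 1,
   dot e1 (nu s) = l * (dot (e2 eps) (gamma s) * dot p (T s) - dot p (gamma s) * dot (e2 eps) (T s)),
   dot (e2 eps) (nu s) = l * (dot p (gamma s) * dot e1 (T s) - dot e1 (gamma s) * dot p (T s)) &
   dot p (nu s) = l * n3 eps s].
  move=> ee; have [nn ng nt _] := Hnu s.
  apply: unit_normal_cross; rewrite ?expr2 -coord//; first exact: gsphere.
  exact: curve_tangent.
have n3_cont : continuous (n3 1).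
  move=> s; apply: dv_cont; apply: dvD.
    by apply: dvM; apply: dv_dot; [exact: dgamma|exact: dtangent].
  by apply: dvN; apply: dvM; apply: dv_dot; [exact: dgamma|exact: dtangent].
have n3_neq0 s : n3 1 s != 0.
  have [l [_ _ _ e]] := cross 1 s (expr1n _ _); apply/eqP => z.
  by have := pnu s; rewrite e z mulr0 ltxx.
(* the reflection of the second vector makes the frame positive *)
have [eps [ee n3_gt0]] : exists eps, eps ^+ 2 = 1 /\ forall s, 0 < n3 eps s.
  have [pos|neg] := continuous_sign n3_cont n3_neq0; first by exists 1; rewrite expr1n.
  exists (-1); rewrite sqrrN expr1n; split=> // s; have := neg s.
  have e u : dot (e2 (-1)) u = - dot (e2 1) u.
    rewrite -dotNl; congr dot; apply/rowP => i; rewrite !mxE.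
    by case: i => [[|[|[|//]]] hi] /=; ring.
  by rewrite /n3 !e; lra.
exists e1, (e2 eps), p; split; [exact: Dp|exact: ppos| |exact: expand ee|].
  by rewrite pE; exact: (sphere_area_frame Dq Dopen al rh ee).
move=> s; have [l [ll h1 h2 h3]] := cross eps s ee.
suff l1 : l = 1 by rewrite h1 h2 h3 l1 !mul1r.
have := pnu s; rewrite h3 pmulr_lgt0// => l0.
by move/eqP: ll; rewrite sqrf_eq1 => /orP[/eqP//|/eqP lN]; move: l0; rewrite lN; lra.
Qed.

Lemma mean_of_primitive (f K : R -> R) : continuous f -> (forall x, has_deriv K x (f x)) ->
  \int[lebesgue_measure]_(x in `[0, L]) f x = K L - K 0.
Proof.
move=> cf dK; rewrite /Rintegral (@continuous_FTC2 _ f K 0 L L0).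
- by rewrite -EFinB.
- exact: continuous_subspaceT.
- split; first by move=> x _; case: (dK x).
  + by apply: cvg_at_right_filter; exact: (dv_cont (dK 0)).
  + by apply: cvg_at_left_filter; exact: (dv_cont (dK L)).
- by move=> x _; exact: (dv_val (dK x)).
Qed.

Lemma injective_period s s' : gamma s = gamma s' -> `|s - s'| < L -> s = s'.
Proof.
wlog ss : s s' / s <= s'.
  move=> h e d; have [le|/ltW le] := leP s s'; first exact: h.
  by apply/esym/h => //; rewrite distrC.
rewrite distrC ger0_norm ?subr_ge0// => e d.
have [i /andP[i1 i2]] := shift_into 0 s L0; rewrite add0r in i2.
have gi x (j : int) : gamma (x + j%:~R * L) = gamma x by exact: periodic_int.
have [c|c] := ltP (s' + i%:~R * L) L.
  apply: (@addIr _ (i%:~R * L)); apply: ginj; last by rewrite !gi.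
    by rewrite in_itv/= i1 i2.
  by rewrite in_itv/= c (le_trans i1)// lerD2r.
have := @ginj (s + i%:~R * L) (s' + i%:~R * L - L); rewrite !in_itv/= i1 i2 gi.
have -> : s' + i%:~R * L - L = s' + (i - 1)%:~R * L by rewrite intrB; ring.
rewrite gi intrB => /(_ isT) h.
have : s + i%:~R * L = s' + (i%:~R - 1) * L by apply: h => //; nra.
lra.
Qed.

(** The coordinates in the adapted frame satisfy the hypotheses of [axis_area] and
    of [four_average_points]. *)
Lemma gauss_bonnet_and_four_points : exists b s1 s2 s3 s4,
  [/\ sphere_area D = (2 * pi - b * L)%:E, average_curvature gamma nu L = b,
   s1 < s2 < s3, s3 < s4 < s1 + L & [/\ k s1 = b, k s2 = b, k s3 = b & k s4 = b]].
Proof.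
have [e1 [e2 [p [Dp ppos areaE expand cross]]]] := adapted_frame.
pose x1 s := dot e1 (gamma s); pose x2 s := dot e2 (gamma s); pose x3 s := dot p (gamma s).
pose t1 s := dot e1 (T s); pose t2 s := dot e2 (T s); pose t3 s := dot p (T s).
have x30 s : 0 < x3 s by exact: ppos.
have n30 s : 0 < x1 s * t2 s - x2 s * t1 s.
  have [_ _ <-] := cross s; rewrite dotC.
  exact: (normal_pos gsmooth gsphere gunit Dq Dopen Dconv Dbnd Hnu).
have coord u v : dot u v = dot e1 u * dot e1 v + dot e2 u * dot e2 v + dot p u * dot p v.
  by rewrite {1}(expand u) !dotDl !dotZl.
have xx s : x1 s ^+ 2 + x2 s ^+ 2 + x3 s ^+ 2 = 1 by rewrite !expr2 -coord; exact: gsphere.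
have tt s : t1 s ^+ 2 + t2 s ^+ 2 + t3 s ^+ 2 = 1 by rewrite !expr2 -coord.
have xt s : x1 s * t1 s + x2 s * t2 s + x3 s * t3 s = 0 by rewrite -coord; exact: curve_tangent.
have dx w s : has_deriv (fun s => dot w (gamma s)) s (dot w (T s)).
  by apply: dv_dot; exact: dgamma.
have da w s : has_deriv (fun s => dot w (T s)) s (dot w (a s)) by apply: dv_dot; exact: dtangent.
have xL w s : dot w (gamma (s + L)) = dot w (gamma s) by rewrite gL.
have tL w : forall s, dot w (T (s + L)) = dot w (T s) := dv_periodic (dx w) (xL w).
have aL w : forall s, dot w (a (s + L)) = dot w (a s) := dv_periodic (da w) (tL w).
have aE w s : dot w (a s) = - dot w (gamma s) + k s * dot w (nu s).
  by rewrite (acc_expansion gsmooth gsphere gunit Hnu) dotDr dotNr dotZr.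
have dt1 s : has_deriv t1 s (- x1 s + k s * (x2 s * t3 s - x3 s * t2 s)).
  by have [<- _ _] := cross s; apply: dv_eq (da e1 s) (aE e1 s).
have dt2 s : has_deriv t2 s (- x2 s + k s * (x3 s * t1 s - x1 s * t3 s)).
  by have [_ <- _] := cross s; apply: dv_eq (da e2 s) (aE e2 s).
have dt3 s : has_deriv t3 s (- x3 s + k s * (x1 s * t2 s - x2 s * t1 s)).
  by have [_ _ <-] := cross s; apply: dv_eq (da p s) (aE p s).
have x1L s : x1 (s + L) = x1 s by exact: xL.
have x2L s : x2 (s + L) = x2 s by exact: xL.
have x3L s : x3 (s + L) = x3 s by exact: xL.
have t1L s : t1 (s + L) = t1 s by exact: tL.
have t2L s : t2 (s + L) = t2 s by exact: tL.
have t3L s : t3 (s + L) = t3 s by exact: tL.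
pose al u s := dot u (a s).
have kE : k = triple_product (al e1) (al e2) (al p) x1 x2 x3 t1 t2 t3.
  apply/funext => s; rewrite /triple_product /al.
  by have [<- <- <-] := cross s; exact: coord.
have kL : forall s, k (s + L) = k s.
  rewrite kE; exact: (triple_product_periodic (aL e1) (aL e2) (aL p) x1L x2L x3L t1L t2L t3L).
have ck : continuous k.
  have cx u : continuous (fun s => dot u (gamma s)) by move=> s; apply: dv_cont; exact: dx.
  have ct u : continuous (fun s => dot u (T s)) by move=> s; apply: dv_cont; exact: da.
  have ca u : continuous (al u) by move=> s; apply: dv_cont; apply: dv_dot; exact: dacc.
  rewrite kE; exact: (triple_product_continuous (ca e1) (ca e2) (ca p) (cx e1) (cx e2) (cx p)
    (ct e1) (ct e2) (ct p)).
have [K dK] := continuous_primitive ck.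
pose b := (K L - K 0) / L.
have bL : b * L = K L - K 0 by rewrite /b divfK ?gt_eqF.
have KL s : K (s + L) = K s + b * L by rewrite bL -(periodic_increment s dK kL); ring.
have k0 s : 0 <= k s by exact: (curvature_ge0 gsmooth gsphere gunit Dq Dopen Dconv Dbnd Hnu).
have avg : average_curvature gamma nu L = b.
  by rewrite /average_curvature (mean_of_primitive ck dK) mulrC.
(* the curve is its own equidistant at distance 0 *)
have con0 s : con3 x1 x2 x3 t1 t2 0 s = x1 s * t2 s - x2 s * t1 s by rewrite /con3 mul0r addr0.
have G0 s : 0 < con3 x1 x2 x3 t1 t2 0 s by rewrite con0.
have radE s : rad2 x1 x2 x3 t1 t2 t3 0 s = x1 s ^+ 2 + x2 s ^+ 2.
  by rewrite /rad2 /eqd1 /eqd2 !mul0r !subr0.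
have rad0 s : 0 < x1 s ^+ 2 + x2 s ^+ 2 by rewrite -radE; exact: (rad2_gt0 xx tt xt G0).
pose w s := (x1 s * t2 s - x2 s * t1 s) / (x1 s ^+ 2 + x2 s ^+ 2).
have wE s : angspeed x1 x2 x3 t1 t2 t3 k 0 s = w s.
  by rewrite /angspeed radE con0 mul0r addr0 mul1r.
have [th thE] := equidistant_angle xx tt xt (dx e1) (dx e2) (dx p) dt1 dt2 dt3 ck G0.
have dth s : has_deriv th s (w s) by have [h _ _] := thE s; rewrite -wE.
have x1E s : x1 s = Num.sqrt (x1 s ^+ 2 + x2 s ^+ 2) * cos (th s).
  by have [_ h _] := thE s; rewrite -radE -h /eqd1 mul0r subr0.
have x2E s : x2 s = Num.sqrt (x1 s ^+ 2 + x2 s ^+ 2) * sin (th s).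
  by have [_ _ h] := thE s; rewrite -radE -h /eqd2 mul0r subr0.
have w0 s : 0 < w s by rewrite divr_gt0.
have wL s : w (s + L) = w s by rewrite /w x1L x2L t1L t2L.
have gE s : gamma s = x1 s *: e1 + x2 s *: e2 + x3 s *: p by exact: expand.
have cx3 : continuous x3 by move=> s; apply: dv_cont; exact: (dx p s).
have Dgamma s : closure D (gamma s) by exact: (@curve_closure _ _ _ Dbnd).
have Dngamma s : ~ D (gamma s) by exact: (@curve_out _ _ _ Dbnd).
have thL : forall s, th (s + L) = th s + 2 * pi.
  exact: (boundary_winding Dq Dopen Dconv Dp Dgamma Dngamma gsphere gE xx rad0 dth w0 x1E x2E
    L0 x1L x2L wL ginj).
(* Gauss-Bonnet: the course of the curve, its angle with the parallels, returns
   to its initial value *)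
pose Qp s := K s - atan (t3 s / (x1 s * t2 s - x2 s * t1 s)).
have dQp s : has_deriv Qp s (x3 s * w s).
  have := dv_course xx tt xt (dx e1) (dx e2) (dx p) dt1 dt2 dt3 G0 s.
  have s1 : Num.sqrt (1 + 0 ^+ 2) = 1 :> R by rewrite expr0n addr0 sqrtr1.
  rewrite s1 wE /eqd3 mul0r divr1 !subr0 => h.
  apply: dv_eq; first apply: dvD (dK s) (dvN (dv_fun _ h)).
    by move=> y; rewrite /= mul1r con0.
  by ring.
have QpL s : Qp (s + L) = Qp s + b * L.
  by rewrite /Qp KL x1L x2L t1L t2L t3L; ring.
have area : sphere_area D = (2 * pi - b * L)%:E.
  rewrite areaE; exact: (axis_area Dq Dopen Dconv Dp Dgamma Dngamma gsphere gE xx rad0 dth w0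
    x1E x2E cx3 L0 x1L x2L wL ginj dQp QpL).
have [s1 [s2 [s3 [s4 [h1 h2 h3]]]]] := four_average_points L0 xx tt xt (dx e1) (dx e2) (dx p)
  dt1 dt2 dt3 ck x1L x2L x3L t1L t2L t3L kL dK KL k0 n30 x30 dth x1E x2E thL.
by exists b, s1, s2, s3, s4; split; [exact: area|exact: avg|exact: h1|exact: h2|exact: h3].
Qed.

End Assembly.

Theorem mainTheorem1 (R : realType) (gamma nu : R -> 'rV[R]_3)
    (D : set 'rV[R]_3) (L A : R)
    (hgamma : smooth_simple_closed_curve gamma L)
    (hD : bounds_convex_domain gamma D)
    (hA : sphere_area D = A%:E)
    (hnu : inward_normal gamma D nu) :
  average_curvature gamma nu L = (2 * pi - A) / L /\
  exists s : 'I_4 -> R,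
    injective (gamma \o s) /\
    forall i : 'I_4,
      geodesic_curvature gamma nu (s i) = average_curvature gamma nu L.
Proof.
have [L0 gsmooth gsphere gunit [gL ginj]] := hgamma.
have [q [_ gq Dq [[D0 _ Dopen] Dconv] Dbnd]] := hD.
have [b [s1 [s2 [s3 [s4 [area -> s12 s34 [k1 k2 k3 k4]]]]]]] :=
  gauss_bonnet_and_four_points L0 gsmooth gsphere gunit gL ginj gq Dq D0 Dopen Dconv Dbnd hnu.
have -> : A = 2 * pi - b * L by apply: EFin_inj; rewrite -hA.
split; first by rewrite opprB addrC subrK mulfK ?gt_eqF.
have [[/andP[l1 l2] /andP[l3 l4]]] := conj s12 s34.
exists (fun i : 'I_4 => [:: s1; s2; s3; s4]`_i); split; last first.
  by case=> [[|[|[|[|//]]]] hi].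
move=> i j /= /(injective_period L0 gL ginj) h.
apply: val_inj; move: h.
case: i => [[|[|[|[|//]]]] hi]; case: j => [[|[|[|[|//]]]] hj] //=; rewrite ltr_norml => h;
  exfalso; have := h ltac:(apply/andP; split; lra); lra.
Qed.
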